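(* Let $\mathcal M^\sigma$ be the free $\mathbb Z[x,x^{-1}]$-module with basis $\{M^\sigma_\tau:\tau\in\mathcal K^J\}$. (a) There is a unique $\mathcal H$-module structure on $\mathcal M^\sigma$ with, for all $s\in S$ and $\tau\in\mathcal K^J$: $H_sM^\sigma_\tau=M^\sigma_{s\tau}$ if $s\in\mathrm{Asc}^<(\tau;\sigma)$; $H_sM^\sigma_\tau=M^\sigma_{s\tau}+(x-x^{-1})M^\sigma_\tau$ if $s\in\mathrm{Des}^<(\tau;\sigma)$; $H_sM^\sigma_\tau=-x^{-1}M^\sigma_\tau$ if $s\in\mathrm{Asc}^=(\tau;\sigma)$; $H_sM^\sigma_\tau=xM^\sigma_\tau$ if $s\in\mathrm{Des}^=(\tau;\sigma)$. (b) There is a unique $\mathcal H$-compatible bar operator $M\mapsto\overline M$ on $\mathcal M^\sigma$ fixing $M^\sigma_\tau$ for every $\tau\in\mathcal K^J$ with $\mathrm{Des}^<(\tau;\sigma)=\varnothing$; it is an involution and satisfies $\overline{M^\sigma_\tau}\in M^\sigma_\tau+\sum_{\upsilon\prec\tau}\mathbb Z[x,x^{-1}]M^\sigma_\upsilon$ for all $\tau$. (c) $\mathcal M^\sigma$ has a unique basis $\{\underline M^\sigma_\tau:\tau\in\mathcal K^J\}$ with $\overline{\underline M^\sigma_\tau}=\underline M^\sigma_\tau\in M^\sigma_\tau+\sum_{\upsilon\prec\tau}x^{-1}\mathbb Z[x^{-1}]M^\sigma_\upsilon$ for all $\tau\in\mathcal K^J$.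
   Context: Let $(W,S)$ be a finite Coxeter system with length $\ell$, Bruhat order $\le$, reflections $T=\{wsw^{-1}:w\in W,s\in S\}$. $\mathrm{Aut}(W,S)$: automorphisms $\varphi$ of $W$ with $\varphi(S)=S$; $W^+=W\rtimes\mathrm{Aut}(W,S)$ with $(v,\alpha)(w,\beta)=(v\,\alpha(w),\alpha\beta)$, $\ell(w,\varphi)=\ell(w)$, $w\equiv(w,1)$. $z\in W^+$ is a perfect involution if $z^2=1$ and $(zt)^4=1$ for all $t\in T$. Fix $J\subseteq S$: $W_J=\langle J\rangle$; $\mathscr I_J$ = perfect involutions of $(W_J)^+=W_J\rtimes\mathrm{Aut}(W_J,J)$, with $W_J$ acting by $v:(y,\theta)\mapsto(v\,y\,\theta(v)^{-1},\theta)$; $z$ is $W_J$-minimal if $\ell(szs)\ge\ell(z)$ for all $s\in J$ (unique in each $W_J$-class). $W^J=\{w:\ell(ws)>\ell(w)\ \forall s\in J\}$, $\mathcal K^J=W^J\times\mathscr I_J$, $\mathrm{ht}(w,z)=\ell(w)+\tfrac12(\ell(z)-\ell(z_{\min}))$ with $z_{\min}$ the $W_J$-minimal conjugate of $z$. For $s\in S$, $\tau=(w,z)$: $s\tau=(sw,z)$ if $sw\in W^J$, else $s\tau=(w,tzt)$ with $t=w^{-1}sw\in J$; this is a $W$-action. Quasiparabolic Bruhat order on $\mathscr I_J$: transitive closure of $z<tzt$ for reflections $t$ of $W_J$ with $\ell(z)<\ell(tzt)$. Partial order $\prec$ on $\mathcal K^J$: $(w,z)\prec(w',z')$ iff same $W$-orbit,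 $\mathrm{ht}(w,z)<\mathrm{ht}(w',z')$, and either $w<w'$ (Bruhat) or $w=w'$ and $z<z'$ (quasiparabolic Bruhat). Fix a homomorphism $\sigma:W_J\to\{\pm1\}$; for $\tau=(w,z)$: $\mathrm{Asc}^<(\tau;\sigma)=\{s:\mathrm{ht}(s\tau)>\mathrm{ht}(\tau)\}$, $\mathrm{Des}^<(\tau;\sigma)=\{s:\mathrm{ht}(s\tau)<\mathrm{ht}(\tau)\}$, $\mathrm{Asc}^=(\tau;\sigma)=\{s:\mathrm{ht}(s\tau)=\mathrm{ht}(\tau),\ \sigma(w^{-1}sw)=-1\}$, $\mathrm{Des}^=(\tau;\sigma)=\{s:\mathrm{ht}(s\tau)=\mathrm{ht}(\tau),\ \sigma(w^{-1}sw)=1\}$ (when $\mathrm{ht}(s\tau)=\mathrm{ht}(\tau)$, $w^{-1}sw\in J$). $\mathcal H$: the Iwahori–Hecke algebra of $(W,S)$, free over $\mathbb Z[x,x^{-1}]$ with basis $H_w$, $H_sH_w=H_{sw}$ if $\ell(sw)>\ell(w)$, $H_{sw}+(x-x^{-1})H_w$ otherwise. Antilinear means $\phi(pa)=\bar p\phi(a)$ with $\bar{\ }:x\mapsto x^{-1}$. The bar operator of $\mathcal H$ is the antilinear ring involution with $\overline{H_w}=(H_{w^{-1}})^{-1}$; an $\mathcal H$-compatible bar operator on an $\mathcal H$-module is an antilinear map with $\overline{HA}=\overline H\,\overline A$. *)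

(* Defs.v *)
From HB Require Import structures.
From mathcomp Require Import all_boot all_order all_algebra all_fingroup.
From mathcomp Require Import fraction.
From Stdlib Require Import ClassicalEpsilon.

Set Implicit Arguments.
Unset Strict Implicit.
Unset Printing Implicit Defensive.

Import GRing.Theory.
Local Open Scope ring_scope.

(* The ring Z[x, x^{-1}] of Laurent polynomials, realised as the       *)
(* subring of the fraction field Q(x) = Frac(Z[x]) consisting of the   *)
(* elements p / x^n with p in Z[x].                                    *)

Definition Fx := {fraction {poly int}}.
Notation tofr := (@FracField.tofrac _).
Notation "x %:F" := (tofr x).
Definition xF : Fx := ('X)%:F.

Definition laurent_prop (f : Fx) : Prop :=
  exists (p : {poly int}) (n : nat), f = p%:F / xF ^+ n.
Definition is_laurent (f : Fx) : bool :=
  if excluded_middle_informative (laurent_prop f) then true else false.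

Lemma is_laurentP f : reflect (laurent_prop f) (is_laurent f).
Proof.
by rewrite /is_laurent; case: excluded_middle_informative => h; constructor.
Qed.

Lemma xF_neq0 : xF != 0.
Proof. by rewrite /xF -(rmorph0 tofr) tofrac_eq polyX_eq0. Qed.

Lemma frac_sub (F : fieldType) (A B P Q : F) : A != 0 -> B != 0 ->
  P / A - Q / B = (P * B - Q * A) / (A * B).
Proof.
move=> hA hB.
by rewrite invfM mulrBl -!mulrA [B * _]mulrC !mulrA mulfK // mulrAC mulfK.
Qed.

Lemma frac_mul (F : fieldType) (A B P Q : F) :
  P / A * (Q / B) = (P * Q) / (A * B).
Proof. by rewrite invfM mulrACA. Qed.

Lemma laurent_closed : subring_closed is_laurent.
Proof.
have xn n : xF ^+ n != 0 by rewrite expf_neq0 // xF_neq0.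
split.
- by apply/is_laurentP; exists 1, 0%N; rewrite rmorph1 expr0 divr1.
- move=> a b /is_laurentP [p [n ->]] /is_laurentP [q [m ->]]; apply/is_laurentP.
  exists (p * 'X^m - q * 'X^n), (n + m)%N.
  by rewrite frac_sub // rmorphB !rmorphM !rmorphXn /= -/xF exprD.
- move=> a b /is_laurentP [p [n ->]] /is_laurentP [q [m ->]]; apply/is_laurentP.
  exists (p * q), (n + m)%N.
  by rewrite frac_mul rmorphM exprD.
Qed.

Record laurent := Laurent { lval :> Fx ; lvalP : is_laurent lval }.
HB.instance Definition _ := [isSub for lval].
HB.instance Definition _ := [Choice of laurent by <:].
HB.instance Definition _ :=
  GRing.SubChoice_isSubComNzRing.Build Fx is_laurent laurent laurent_closed.

Lemma xL_proof : is_laurent xF.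
Proof. by apply/is_laurentP; exists 'X, 0%N; rewrite expr0 divr1. Qed.

Lemma xLinv_proof : is_laurent (xF^-1).
Proof. by apply/is_laurentP; exists 1, 1%N; rewrite rmorph1 expr1 div1r. Qed.

Definition xL : laurent := Laurent xL_proof.
Definition xLinv : laurent := Laurent xLinv_proof.

(* the bar involution of Z[x,x^{-1}]:  sum a_i x^i |-> sum a_i x^{-i}
   (written f = p(x) / x^n  |->  p(x^{-1}) x^n) *)
Definition lbar_rel (f g : laurent) : Prop :=
  exists (p : {poly int}) (n : nat),
    lval f = p%:F / xF ^+ n /\
    lval g = (\sum_(i < size p) (p`_i)%:~R / xF ^+ i) * xF ^+ n.
Definition lbar (f : laurent) : laurent := epsilon (inhabits 0) (lbar_rel f).

Definition in_negpart (f : laurent) : Prop :=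
  exists p : {poly int}, lval f = \sum_(i < size p) (p`_i)%:~R / xF ^+ i.+1.

(* Coxeter systems.  W is the whole finite group gT, S a set of        *)
(* generators.                                                         *)

Section Coxeter.
Variable gT : finGroupType.
Local Open Scope group_scope.

Fixpoint wordset (S : {set gT}) (n : nat) : {set gT} :=
  if n is n'.+1 then wordset S n' :|: [set x * s | x in wordset S n', s in S]
  else [set 1].

(* length with respect to the generating set S: the least n such that w
   is a product of n generators (w is always reachable within #|gT|
   steps when S generates a group containing w) *)
Definition len (S : {set gT}) (w : gT) : nat :=
  find (fun n => w \in wordset S n) (iota 0 #|gT|).

Definition reflections (G S : {set gT}) : {set gT} :=
  [set w * s * w^-1 | w in G, s in S].

(* (gT, S) is a (finite) Coxeter system: S is a generating set of
   involutions and gT has the Coxeter presentation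
   < S | (s t)^{m(s,t)} = 1 >, m(s,t) = order of s t, expressed by the
   universal property of that presentation (tested on finite groups). *)
Definition coxeter_system (S : {set gT}) : Prop :=
  [/\ <<S>> = [set: gT],
      {in S, forall s, #[s] = 2%N} &
      forall (hT : finGroupType) (f : gT -> hT),
        {in S &, forall s t, (f s * f t) ^+ #[s * t] = 1} ->
        exists phi : {morphism [set: gT] >-> hT}, {in S, forall s, phi s = f s}].

(* an element (w, phi) is stored as a pair in gT * {perm gT};
   automorphisms of G are the elements of MathComp's  Aut G  *)
Definition ext := (gT * {perm gT})%type.

(* (v,a)(w,b) = (v a(w), a o b);  in MathComp (b * a) x = a (b x) *)
Definition emul (a b : ext) : ext := (a.1 * a.2 b.1, b.2 * a.2).
Definition eone : ext := (1, 1).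
Definition einj (w : gT) : ext := (w, 1).

Definition in_ext (G J : {set gT}) (a : ext) : bool :=
  [&& a.1 \in G, a.2 \in Aut G & a.2 @: J == J].

Definition perfect (T : {set gT}) (z : ext) : bool :=
  (emul z z == eone) &&
  [forall t in T, let u := emul z (einj t) in
                  emul u (emul u (emul u u)) == eone].

End Coxeter.

Unset Implicit Arguments.
Section Setting.
Context {gT : finGroupType}.
Variables (S J : {set gT}).
Variable sigma : gT -> int.
Local Open Scope group_scope.

Definition WJ : {set gT} := <<J>>.
Definition TJ : {set gT} := reflections WJ J.
Definition T : {set gT} := reflections [set: gT] S.

Definition IJ : {set ext gT} := [set z | in_ext WJ J z && perfect TJ z].

Definition elen (z : ext gT) : nat := len J z.1.

Definition vconj (v : gT) (z : ext gT) : ext gT := (v * z.1 * (z.2 v)^-1, z.2).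

Definition Wmin (z : ext gT) : bool :=
  [forall s in J, (elen z <= elen (emul (emul (einj s) z) (einj s)))%N].

Definition zclass (z : ext gT) : {set ext gT} := [set vconj v z | v in WJ].

Definition len_zmin (z : ext gT) : nat :=
  if [pick z' in zclass z | Wmin z'] is Some z' then elen z' else 0%N.

Definition WJup : {set gT} := [set w | [forall s in J, (len S w < len S (w * s))%N]].
Definition KJ : {set gT * ext gT} := [set tau | (tau.1 \in WJup) && (tau.2 \in IJ)].
Definition KJt : finType := {tau : gT * ext gT | tau \in KJ}.

Definition ht (tau : gT * ext gT) : rat :=
  ((len S tau.1)%:R + ((elen tau.2)%:R - (len_zmin tau.2)%:R) / 2%:R)%R.

Definition sact (s : gT) (tau : gT * ext gT) : gT * ext gT :=
  if s * tau.1 \in WJup then (s * tau.1, tau.2)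
  else let t := tau.1^-1 * s * tau.1 in
       (tau.1, emul (emul (einj t) tau.2) (einj t)).

Definition same_orbit (tau ups : gT * ext gT) : bool :=
  connect (fun a b => [exists s in S, b == sact s a]) tau ups.

Definition bruhat_lt (v w : gT) : bool :=
  (v != w) &&
  connect (fun a b => [exists t in T, (b == a * t) && (len S a < len S b)%N]) v w.

Definition qbruhat_lt (z z' : ext gT) : bool :=
  (z != z') &&
  connect (fun a b => [&& a \in IJ, b \in IJ &
             [exists t in TJ, (b == emul (emul (einj t) a) (einj t))
                              && (elen a < elen b)%N]]) z z'.

Definition prec (ups tau : gT * ext gT) : bool :=
  [&& same_orbit ups tau, (ht ups < ht tau)%R &
      bruhat_lt ups.1 tau.1 || ((ups.1 == tau.1) && qbruhat_lt ups.2 tau.2)].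

Definition no_strict_descent (tau : gT * ext gT) : bool :=
  [forall s in S, ~~ (ht (sact s tau) < ht tau)%R].

Definition Mod := {ffun KJt -> laurent}.
Definition msc (c : laurent) (m : Mod) : Mod := [ffun i : KJt => (c * m i)%R].
(* the basis element M_tau (tau is assumed to lie in K^J) *)
Definition Mb (tau : gT * ext gT) : Mod :=
  [ffun i : KJt => if val i == tau then 1%R else 0%R].

Definition Hs_Mb (s : gT) (tau : gT * ext gT) : Mod :=
  let st := sact s tau in
  if (ht tau < ht st)%R then Mb st                                  (* Asc^< *)
  else if (ht st < ht tau)%R then (Mb st + msc (xL - xLinv) (Mb tau))%R (* Des^< *)
  else if sigma (tau.1^-1 * s * tau.1) == (-1)%R
       then msc (- xLinv)%R (Mb tau)                                 (* Asc^= *)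
       else msc xL (Mb tau).                                         (* Des^= *)

Definition Hk := {ffun gT -> laurent}.
Definition hsc (c : laurent) (h : Hk) : Hk := [ffun w : gT => (c * h w)%R].
Definition Hb (w : gT) : Hk := [ffun u : gT => if u == w then 1%R else 0%R].
Definition Hone : Hk := Hb 1.

(* left multiplication by H_s:
   H_s H_w = H_{sw} if l(sw) > l(w), H_{sw} + (x - x^{-1}) H_w otherwise *)
Definition Lgen (s : gT) (b : Hk) : Hk :=
  [ffun u : gT => (b (s * u)%g +
              (if (len S (s * u)%g < len S u)%N then (xL - xLinv) * b u else 0))%R].

(* left multiplication by H_w = H_{s_1} ... H_{s_k} (reduced word) *)
Fixpoint Happ (n : nat) (w : gT) (b : Hk) : Hk :=
  if n is n'.+1 then
    if [pick s in S | (len S (s * w) < len S w)%N] is Some s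
    then Lgen s (Happ n' (s * w) b) else b
  else b.

Definition Hmul (a b : Hk) : Hk := (\sum_(w : gT) hsc (a w) (Happ (len S w) w b))%R.

Definition Hinv (w : gT) : Hk :=
  epsilon (inhabits Hone)
    (fun h => Hmul h (Hb w) = Hone /\ Hmul (Hb w) h = Hone).

Definition barH (h : Hk) : Hk := (\sum_(w : gT) hsc (lbar (h w)) (Hinv w^-1))%R.

Definition hecke_module_structure (act : Hk -> Mod -> Mod) : Prop :=
  [/\ forall c h h' m, act (hsc c h + h')%R m = (msc c (act h m) + act h' m)%R,
      forall c h m m', act h (msc c m + m')%R = (msc c (act h m) + act h m')%R,
      forall m, act Hone m = m,
      forall h h' m, act (Hmul h h') m = act h (act h' m) &
      forall s (i : KJt), s \in S -> act (Hb s) (Mb (val i)) = Hs_Mb s (val i)].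

Definition bar_operator (act : Hk -> Mod -> Mod) (psi : Mod -> Mod) : Prop :=
  [/\ forall c m m', psi (msc c m + m')%R = (msc (lbar c) (psi m) + psi m')%R,
      forall h m, psi (act h m) = act (barH h) (psi m) &
      forall i : KJt, no_strict_descent (val i) -> psi (Mb (val i)) = Mb (val i)].

Definition is_basis (B : KJt -> Mod) : Prop :=
  forall m : Mod, exists! c : {ffun KJt -> laurent},
    m = (\sum_(i : KJt) msc (c i) (B i))%R.

End Setting.

(* Main.v *)
(** The universal property of a Coxeter group, applied to permutations of
    W x {+1,-1}, gives the cocycle of left inversion sets
    N(uv) = N(u) + u N(v) u^-1, whence the exchange condition, parabolic
    decompositions and Matsumoto's theorem. For a perfect involution
    z = (y, th) every reflection r commutes with z r z; comparing N(y) with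
    N(g y th(g)^-1) shows that conjugation by r raises the length iff r is
    not in N(y), and that a class has a single minimal element.

    The braid relations on the span of the perfect involutions of W_J^+ are
    checked on the orbit of a minimal z under a dihedral parabolic <s,t>.
    Either z sends no reflection of <s,t> to a different one, and the orbit is
    a quotient of the regular module; or the product of such a reflection and
    its conjugate is the longest element of <s,t> and fixes z, and the orbit
    has at most two points. The module M is then induced from H_J to H.

    The bar operator is H_w (x) M_(y,th) |-> c bar(H_w) bar(H_y) M_(y^-1,th),
    where c depends only on the class and is fixed at the minimal element,
    for which every letter of y stabilises z. It is unique, and an involution,
    because M is generated by the elements without strict descents;
    unitriangularity follows by lifting in both Bruhat orders, and the
    canonical basis by the Kazhdan-Lusztig argument. *)

Require Import Defs.
From HB Require Import structures.
From mathcomp Require Import all_boot all_order all_algebra all_fingroup.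
From mathcomp Require Import cyclic zify ring.
From Stdlib Require Import ClassicalEpsilon FunctionalExtensionality.

Set Implicit Arguments.
Unset Strict Implicit.
Unset Printing Implicit Defensive.

Import GRing.Theory Num.Theory.

(** * Words and the inversion cocycle *)

Section Words.
Variable gT : finGroupType.
Implicit Types (S J : {set gT}) (w s t r : gT).
Local Open Scope group_scope.

(** No root system is built: the Boolean cocycle [n] carries all the geometry. Orthogonality of
    roots is replaced by [n_commute]: distinct commuting reflections are not inversions of one
    another. For a perfect involution this applies to [r] and [z r z], so [r z r = r (z r z) z]
    multiplies [y] by two orthogonal reflections, which raise or lower the length together. A
    reflection that moves [z] thus changes the length by at least two, and level steps are fixed
    points; hence the form of the action of [H_s].

    The bar formula comes from the ascent [y -> s y t] with [t = th(s)]. There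
    [bar H_(s y t) = bar H_s bar H_y bar H_t], while [H_t] carries the basis vector of [(y^-1, th)]
    to that of [(t y^-1 s, th)]; [bar H_t] cancels this step, so the formula obeys the recursion
    that [bar H_s] forces.

    The regular module and the two modules of the theorem share one operator template, so quadratic
    relations are checked once, and braid relations are transported along intertwiners from the
    regular module wherever one exists. *)

Lemma gen_ind J (P : gT -> Prop) :
  P 1 -> (forall s w, s \in J -> w \in <<J>> -> P w -> P (s * w)) ->
  forall w, w \in <<J>> -> P w.
Proof.
move=> P1 PM w /gen_prodgP [k [c cJ ->]].
suff: \prod_i c i \in <<J>> /\ P (\prod_i c i) by case.
elim: k c cJ => [|k IH] c cJ; first by rewrite big_ord0; split.
rewrite big_ord_recl; case: (IH (fun i => c (lift ord0 i))) => // wJ Pw.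
by split; [rewrite groupM // mem_gen | apply: PM].
Qed.

Lemma gen_indr J (P : gT -> Prop) :
  P 1 -> (forall s w, s \in J -> w \in <<J>> -> P w -> P (w * s)) ->
  forall w, w \in <<J>> -> P w.
Proof.
move=> P1 PM w /gen_prodgP [k [c cJ ->]].
suff: \prod_i c i \in <<J>> /\ P (\prod_i c i) by case.
elim: k c cJ => [|k IH] c cJ; first by rewrite big_ord0; split.
rewrite big_ord_recr; case: (IH (fun i => c (widen_ord (leqnSn k) i))) => // wJ Pw.
by split; [rewrite groupM // mem_gen | apply: PM].
Qed.

Definition wprod (ws : seq gT) : gT := \prod_(s <- ws) s.

Lemma wprod_cons s ws : wprod (s :: ws) = s * wprod ws.
Proof. by rewrite /wprod big_cons. Qed.

Lemma wprod_rcons s ws : wprod (rcons ws s) = wprod ws * s.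
Proof. by rewrite /wprod -cats1 big_cat big_seq1. Qed.

Lemma wordsetP J k w :
  reflect (exists ws, [/\ all (mem J) ws, size ws <= k & wprod ws = w])
          (w \in wordset J k).
Proof.
apply: (iffP idP).
  elim: k w => [|k IH] w /=.
    by rewrite inE => /eqP->; exists [::]; rewrite /wprod big_nil.
  rewrite inE => /orP [/IH [ws [wJ sz <-]]|].
    by exists ws; split=> //; apply: leqW.
  case/imset2P=> u s /IH [ws [wJ sz <-]] sJ ->.
  exists (rcons ws s); split; last by rewrite wprod_rcons.
    by rewrite all_rcons /= sJ.
  by rewrite size_rcons.
case=> ws [wJ sz <-].
elim: k ws wJ sz => [|k IH] ws wJ sz.
  by move: sz; rewrite leqn0 => /nilP->; rewrite /wprod big_nil /= inE.
case/lastP: ws wJ sz => [|ws s].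
  by move=> _ _; rewrite /= inE (IH [::]).
rewrite all_rcons size_rcons ltnS => /andP [sJ wJ] sz /=.
by rewrite inE wprod_rcons; apply/orP; right; apply: imset2_f => //; apply: IH.
Qed.

(** The chain of sets [wordset J k] grows strictly until it stabilises, and a stable set contains 1
    and is closed under right multiplication by [J]. Hence the bounded search in [len] succeeds on
    all of [<<J>>]. *)
Lemma wordset_full J k : k < #|wordset J k| \/ {subset <<J>> <= wordset J k}.
Proof.
elim: k => [|k [IH|IH]]; first by left; rewrite cards1.
  have sub : wordset J k \subset wordset J k.+1 by apply: subsetUl.
  case: (eqVneq (wordset J k.+1) (wordset J k)) => [e|ne].
    right=> w wJ; move: w wJ; apply: gen_indr.
      by apply/wordsetP; exists [::]; rewrite /wprod big_nil.
    move=> s w sJ _; rewrite {1}e => wk.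
    by rewrite inE; apply/orP; right; apply: imset2_f.
  left; apply: leq_ltn_trans IH _; apply: proper_card.
  by rewrite properEneq eq_sym ne.
by right=> w /IH wk; rewrite /= inE wk.
Qed.

Lemma len_wordset J w : w \in <<J>> -> w \in wordset J (len J w).
Proof.
move=> wJ; have g0 : 0 < #|gT| by apply/card_gt0P; exists 1.
have h : has (fun k => w \in wordset J k) (iota 0 #|gT|).
  apply/hasP; exists #|gT|.-1; first by rewrite mem_iota add0n prednK // leqnn.
  case: (wordset_full J #|gT|.-1) => [|/(_ _ wJ) //].
  rewrite prednK // => le.
  have/eqP e: wordset J #|gT|.-1 == setT by rewrite eqEcard subsetT cardsT.
  by rewrite e.
have := nth_find 0 h; rewrite nth_iota //.
by rewrite -[X in _ < X](size_iota 0) -has_find.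
Qed.

Lemma len_min J k w : w \in wordset J k -> len J w <= k.
Proof.
move=> wk; rewrite leqNgt; apply/negP => lt.
have szk : k < #|gT|.
  apply: leq_trans lt _; rewrite -[X in _ <= X](size_iota 0) /len.
  exact: find_size.
by have := before_find 0 lt; rewrite nth_iota // add0n wk.
Qed.

Lemma len_word J w : w \in <<J>> ->
  exists ws, [/\ all (mem J) ws, size ws = len J w & wprod ws = w].
Proof.
move=> wJ; case/wordsetP: (len_wordset wJ) => ws [wsJ sz e].
exists ws; split=> //; apply/eqP; rewrite eqn_leq sz /=.
by apply: len_min; apply/wordsetP; exists ws.
Qed.

Lemma len_wprod J ws : all (mem J) ws -> len J (wprod ws) <= size ws.
Proof. by move=> wJ; apply: len_min; apply/wordsetP; exists ws. Qed.

Lemma len1 J : len J 1 = 0.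
Proof.
by apply/eqP; rewrite -leqn0; apply: len_min; rewrite /= inE.
Qed.

Lemma len_eq0 J w : w \in <<J>> -> len J w = 0 -> w = 1.
Proof.
by move=> wJ e; have := len_wordset wJ; rewrite e /= inE => /eqP.
Qed.

Lemma len_mull J s w : s \in J -> w \in <<J>> -> len J (s * w) <= (len J w).+1.
Proof.
move=> sJ /len_word [ws [wJ <- <-]].
by rewrite -wprod_cons; apply: (@len_wprod J (s :: ws)); rewrite /= sJ.
Qed.

End Words.

Section Cocycle.
Variables (gT : finGroupType) (S : {set gT}).
Local Open Scope group_scope.

(* [n w r] tells whether the reflection [r] is a left inversion of [w]. *)
Definition inversion_cocycle (n : gT -> gT -> bool) : Prop :=
  (forall u v r, n (u * v) r = n u r (+) n v (r ^ u)) /\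
  {in S, forall s r, n s r = (r == s)}.

(** A discrete model of the action on roots: [(r, e)] stands for the root of [r] with sign [e], and
    [s] changes the sign of its own root only. All of [gT] serves as index set, which avoids a type
    of reflections. *)
Definition flip (s : gT) (x : gT * bool) : gT * bool :=
  (x.1 ^ s, x.2 (+) (x.1 == s)).

Lemma flip_inj s : injective (flip s).
Proof.
move=> [r e] [r' e'] [/conjg_inj <-].
by case: e e' (r == s) => [] [] [].
Qed.

(** The sign counts, modulo two, how often [r] occurs in the list [s], [sts], [ststs], ... of length
    [2k]. *)
Lemma flip_powers s t k r e : s * s = 1 -> t * t = 1 ->
  ((perm (@flip_inj s) * perm (@flip_inj t)) ^+ k) (r, e) =
  (r ^ ((s * t) ^+ k),
   e (+) \big[addb/false]_(0 <= j < k.*2) (r == (s * t) ^+ j * s)).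
Proof.
move=> ss tt; have sV : s^-1 = s by apply/eqP; rewrite eq_invg_mul ss.
have tV : t^-1 = t by apply/eqP; rewrite eq_invg_mul tt.
have sp j : s * (s * t) ^- j = (s * t) ^+ j * s.
  elim: j => [|j IH]; first by rewrite expg0 invg1 mulg1 mul1g.
  rewrite {1}expgSr expgS !invMg sV tV !mulgA.
  by rewrite -(mulgA (s * t) s) IH !mulgA.
elim: k => [|k IH].
  by rewrite !expg0 perm1 conjg1 big_geq // addbF.
rewrite expgSr permM IH permM !permE /flip /=; congr (_, _).
  by rewrite -!conjgM -expgSr.
rewrite doubleS big_nat_recr // big_nat_recr //= -!addbA; congr (_ (+) (_ (+) _)).
set p := s * t in sp *.
have E1 : (r ^ p ^+ k == s) = (r == p ^+ k.*2 * s).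
  rewrite -(inj_eq (conjg_inj (p ^- k))) -conjgM mulgV conjg1 conjgE invgK.
  by rewrite sp mulgA -expgD addnn.
have E2 : ((r ^ p ^+ k) ^ s == t) = (r == p ^+ k.*2.+1 * s).
  rewrite -(inj_eq (conjg_inj (s * p ^- k))) -!conjgM.
  rewrite !mulgA -[_ * s * s]mulgA ss mulg1 mulgV.
  rewrite conjg1 !conjgE invMg invgK sV.
  rewrite (_ : p ^+ k * s * (t * (s * p ^- k)) = p ^+ k * p * (s * p ^- k)); last by rewrite /p !mulgA.
  by rewrite sp mulgA -expgSr -expgD addSn addnn.
by rewrite E1 E2.
Qed.

Lemma coxeter_gen : coxeter_system S -> forall w, w \in <<S>>.
Proof. by case=> -> _ _ w; rewrite inE. Qed.

Lemma coxeter_mulss : coxeter_system S -> {in S, forall s, s * s = 1}.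
Proof. by case=> _ o2 _ s /o2 e; have := expg_order s; rewrite e expgS expg1. Qed.

Lemma coxeter_cocycle : coxeter_system S -> exists n, inversion_cocycle n.
Proof.
move=> cox; have gen := coxeter_gen cox; have ss := coxeter_mulss cox.
case: cox => _ _ /(_ _ (fun s => perm (@flip_inj s))) [].
  move=> s t sS tS; apply/permP => [[r e]].
  rewrite perm1 flip_powers ?ss // expg_order conjg1 -addnn.
  (* Since [(s t)^m = 1], the second half of the list repeats the first, and the sign cancels. *)
  rewrite (big_cat_nat (leq0n #[s * t]%g) (leq_addr _ _)) /=.
  rewrite -{2}[#[s * t]%g]add0n big_addn addnK.
  under [X in _ (+) (_ (+) X)]eq_bigr => j _ do
    rewrite expgD expg_order mulg1.
  by rewrite addbb addbF.
move=> phi phiS.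
exists (fun w r => (phi w (r, false)).2).
have phiM u v : phi (u * v) = phi u * phi v by rewrite morphM ?inE.
have phiE s r e : s \in S -> phi s (r, e) = (r ^ s, e (+) (r == s)).
  by move=> sS; rewrite phiS // permE.
have E w : forall r e, phi w (r, e) = (r ^ w, e (+) (phi w (r, false)).2).
  move: w (gen w); apply: gen_ind.
    by move=> r e; rewrite morph1 !perm1 conjg1 addbF.
  move=> s w sS _ IH r e.
  rewrite phiM !permM !(phiE s _ _ sS) (IH _ (e (+) _)) /=.
  by rewrite conjgM (IH _ (r == s)) /= addbA.
split.
  by move=> u v r; rewrite phiM permM [X in phi v X]E E /=.
by move=> s sS r; rewrite phiE.
Qed.

End Cocycle.

(** * Exchange condition and parabolic subgroups *)

Section CoxeterTheory.
Variables (gT : finGroupType) (S : {set gT}) (n : gT -> gT -> bool).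
Hypothesis cox : coxeter_system S.
Hypothesis nP : inversion_cocycle S n.
Implicit Types (J : {set gT}) (w s t r u v : gT).
Local Open Scope group_scope.
Local Notation ell := (len S).

Lemma in_genS w : w \in <<S>>. Proof. exact: coxeter_gen. Qed.
Hint Resolve in_genS : core.

Lemma invS s : s \in S -> s^-1 = s.
Proof. by move=> sS; apply/eqP; rewrite eq_invg_mul (coxeter_mulss cox). Qed.

Lemma mulSS s : s \in S -> s * s = 1. Proof. exact: coxeter_mulss. Qed.

Lemma mulSK s w : s \in S -> s * (s * w) = w.
Proof. by move=> sS; rewrite mulgA mulSS // mul1g. Qed.

Lemma mulKS s w : s \in S -> w * s * s = w.
Proof. by move=> sS; rewrite -mulgA mulSS // mulg1. Qed.

Lemma n_mul u v r : n (u * v) r = n u r (+) n v (r ^ u).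
Proof. by case: nP. Qed.

Lemma n_gen s r : s \in S -> n s r = (r == s).
Proof. by move=> sS; case: nP => _ ->. Qed.

Lemma n1 r : n 1 r = false.
Proof. by rewrite -(mulg1 1) n_mul conjg1 addbb. Qed.

Lemma n_inv w r : n w^-1 r = n w (r ^ w^-1).
Proof.
by have := n_mul w^-1 w r; rewrite mulVg n1; case: (n _ _); case: (n _ _).
Qed.

(** Reading the cocycle along the word, the first letter equal to the transported [r] is the one
    that multiplication by [r] deletes. Recording only the set of letters and a smaller size is
    enough to bound lengths and to stay inside a parabolic subgroup. *)
Lemma exchange ws r : all (mem S) ws -> n (wprod ws) r ->
  exists ws' : seq gT, [/\ {subset ws' <= ws}, size ws' < size ws
                & wprod ws' = r * wprod ws].
Proof.
elim: ws r => [|s ws IH] r /=; first by rewrite /wprod big_nil n1.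
case/andP=> sS wS; rewrite wprod_cons n_mul n_gen //.
have [-> _|rs /=] := eqVneq r s.
  by exists ws; rewrite mulSK //; split=> // x xw; rewrite inE xw orbT.
case/(IH _ wS) => ws' [sub sz e]; exists (s :: ws'); split=> //.
  by move=> x; rewrite !inE => /orP [-> //|/sub ->]; rewrite orbT.
by rewrite wprod_cons e conjgE !mulgA mulgV mul1g.
Qed.

Lemma n_lt w r : n w r -> ell (r * w) < ell w.
Proof.
case: (len_word (in_genS w)) => ws [wS <- <-] /(exchange wS) [ws' [sub sz <-]].
apply: leq_ltn_trans sz; apply: len_wprod.
by apply/allP => x /sub; apply/allP.
Qed.

Lemma n_mulss s w : s \in S -> n (s * w) s = ~~ n w s.
Proof. by move=> sS; rewrite n_mul n_gen // eqxx conjgE mulKg addTb. Qed.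

Lemma n_desc w s : s \in S -> n w s = (ell (s * w) < ell w).
Proof.
move=> sS; apply/idP/idP => [|lt]; first exact: n_lt.
apply/negPn/negP => nw; have : n (s * w) s.
  by rewrite n_mulss.
by move/n_lt; rewrite mulSK // => /ltnW; rewrite leqNgt lt.
Qed.

Lemma ell_mull s w : s \in S ->
  ell (s * w) = if n w s then (ell w).-1 else (ell w).+1.
Proof.
move=> sS; have h1 := len_mull sS (in_genS w).
have := len_mull sS (in_genS (s * w)); rewrite mulSK // => h2.
case: ifP => e; first by have := n_lt e; lia.
have : n (s * w) s by rewrite n_mulss // e.
by move/n_lt; rewrite mulSK //; lia.
Qed.

Lemma ell_gt0 w s : n w s -> 0 < ell w.
Proof. by move/n_lt; lia. Qed.

Lemma ell_gen s : s \in S -> ell s = 1%N.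
Proof. by move=> sS; rewrite -(mulg1 s) ell_mull // n1 len1. Qed.

(** Deletion only uses letters of the given word, so a word in [J] can be shortened within [J]. This
    is why [len J] and [len S] agree on [<<J>>]. *)
Lemma reduced_word J w : J \subset S -> w \in <<J>> ->
  exists ws, [/\ all (mem J) ws, size ws = ell w & wprod ws = w].
Proof.
move=> /subsetP JS; move: w; apply: gen_ind.
  by exists [::]; rewrite len1 /wprod big_nil.
move=> s w sJ _ [ws [wJ sz e]]; rewrite ell_mull ?JS //.
have wS : all (mem S) ws by apply/allP => x xw; apply: JS; apply: (allP wJ).
case: ifP => nw; last first.
  by exists (s :: ws); rewrite wprod_cons e /= sJ sz.
case: (@exchange ws s wS); first by rewrite e.
move=> ws' [sub sz' e']; have wJ' : all (mem J) ws'.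
  by apply/allP => x /sub; apply/allP.
exists ws'; split; rewrite ?e' ?e //.
have : ell (wprod ws') <= size ws'.
  by apply: len_wprod; apply/allP => x xw; apply: JS; apply: (allP wJ').
rewrite e' e (ell_mull _ (JS s sJ)) nw => h; apply/eqP.
rewrite eqn_leq h andbT -ltnS prednK ?(ell_gt0 nw) //.
by apply: leq_trans sz' _; rewrite sz.
Qed.

Lemma lenJ J w : J \subset S -> w \in <<J>> -> len J w = ell w.
Proof.
move=> JS wJ; apply/eqP; rewrite eqn_leq; apply/andP; split.
  by case: (reduced_word JS wJ) => ws [wsJ <- <-]; apply: len_wprod.
case: (len_word wJ) => ws [wsJ <- <-]; apply: len_wprod.
by apply/allP => x xw; apply: (subsetP JS); apply: (allP wsJ).
Qed.

Lemma ell_mul_le u v : ell (u * v) <= ell u + ell v.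
Proof.
case: (len_word (in_genS u)) => us [uS <- <-].
case: (len_word (in_genS v)) => vs [vS <- <-].
rewrite /wprod -big_cat -size_cat; apply: (@len_wprod _ S (us ++ vs)).
by rewrite all_cat uS.
Qed.

Lemma ell_inv w : ell w^-1 = ell w.
Proof.
suff le u : ell u^-1 <= ell u.
  by apply/eqP; rewrite eqn_leq le /= -{1}(invgK w) le.
case: (len_word (in_genS u)) => ws [wS <- <-].
rewrite (_ : _^-1 = wprod (rev ws)).
  by rewrite -(size_rev ws); apply: len_wprod; rewrite all_rev.
elim: ws wS => [|s ws IH] /=; first by rewrite /wprod !big_nil invg1.
case/andP=> sS wS; rewrite wprod_cons invMg IH // rev_cons wprod_rcons.
by rewrite invS.
Qed.

Lemma ell_mulr w s : s \in S ->
  ell (w * s) = if n w^-1 s then (ell w).-1 else (ell w).+1.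
Proof. by move=> sS; rewrite -[LHS]ell_inv invMg (invS sS) ell_mull // ell_inv. Qed.

Lemma TJP J r : reflect (exists w s, [/\ w \in <<J>>, s \in J & r = s ^ w]) (r \in TJ J).
Proof.
apply: (iffP imset2P) => [[w s wJ sJ ->]|[w [s [wJ sJ ->]]]].
  by exists w^-1, s; rewrite groupV conjgE invgK mulgA.
by exists w^-1 s; rewrite ?groupV // conjgE invgK mulgA.
Qed.

Lemma TJ_gen J s : s \in J -> s \in TJ J.
Proof. by move=> sJ; apply/TJP; exists 1, s; rewrite group1 conjg1. Qed.

Lemma TJ_conj J r w : w \in <<J>> -> (r ^ w \in TJ J) = (r \in TJ J).
Proof.
move=> wJ; apply/TJP/TJP => [[u [s [uJ sJ e]]]|[u [s [uJ sJ ->]]]].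
  by exists (u * w^-1), s; rewrite groupM ?groupV // conjgM -e conjgK.
by exists (u * w), s; rewrite groupM // conjgM.
Qed.

Lemma TJ_sub J r : r \in TJ J -> r \in <<J>>.
Proof. by case/TJP=> w [s [wJ sJ ->]]; rewrite groupJ // mem_gen. Qed.

Lemma TJ_mono (I J : {set gT}) r : I \subset J -> r \in TJ I -> r \in TJ J.
Proof.
move=> IJ /TJP [w [s [wI sI ->]]]; apply/TJP; exists w, s.
by rewrite (subsetP (genS IJ)) ?(subsetP IJ) //.
Qed.

Lemma TS_eq : T S = TJ S.
Proof. by rewrite /T /TJ /WJ; case: cox => ->. Qed.

Lemma TJ_T J r : J \subset S -> r \in TJ J -> r \in T S.
Proof. by rewrite TS_eq; apply: TJ_mono. Qed.

Lemma T_mulrr r : r \in T S -> r * r = 1.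
Proof.
by rewrite TS_eq => /TJP [w [s [_ sS ->]]]; rewrite -conjMg mulSS // conj1g.
Qed.

Lemma T_inv r : r \in T S -> r^-1 = r.
Proof. by move/T_mulrr => e; apply/eqP; rewrite eq_invg_mul e. Qed.

Lemma T_conj r w : (r ^ w \in T S) = (r \in T S).
Proof. by rewrite TS_eq TJ_conj. Qed.

(** For [r = s ^ w] the contributions of [w^-1] and [w] to the cocycle cancel, and [n s s]
    remains. *)
Lemma n_refl r : r \in T S -> n r r.
Proof.
rewrite TS_eq => /TJP [w [s [_ sS e]]].
rewrite {1}e conjgE !n_mul n_inv e conjgK (n_gen _ sS) eqxx.
by rewrite conjgE mulKg addbCA addbb.
Qed.

Lemma n_reflE w r : r \in T S -> n w r = (ell (r * w) < ell w).
Proof.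
move=> rT; apply/idP/idP => [|lt]; first exact: n_lt.
apply/negPn/negP => nw; have : n (r * w) r.
  by rewrite n_mul n_refl // conjgE mulKg (negPf nw).
by move/n_lt; rewrite mulgA T_mulrr // mul1g => /ltnW; rewrite leqNgt lt.
Qed.

(* Distinct commuting reflections have orthogonal roots. *)
Lemma n_commute r r' : r \in T S -> r' != r -> r' ^ r = r' -> n r r' = false.
Proof.
rewrite TS_eq => /TJP [w [s [_ sS ->]]] ne c; rewrite conjgE.
rewrite !n_mul n_inv -[(r' ^ w^-1) ^ s]conjgM.
set q := r' ^ w^-1; have -> : r' ^ (w^-1 * s) = q.
  apply: (@conjg_inj _ w); rewrite -conjgM -mulgA -conjgE c /q.
  by rewrite -conjgM mulVg conjg1.
rewrite (n_gen _ sS) (_ : (q == s) = false) ?addFb ?addbb //.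
by apply: contraNF ne => /eqP <-; rewrite -conjgM mulVg conjg1.
Qed.

Lemma n_TJ J w r : J \subset S -> w \in <<J>> -> n w r -> r \in TJ J.
Proof.
move=> /subsetP JS wJ; move: w wJ r; apply: gen_ind => [r|s w sJ wJ IH r].
  by rewrite n1.
rewrite n_mul n_gen ?JS //; case: eqP => [-> _|_ /=]; first exact: TJ_gen.
by move/IH; rewrite TJ_conj // mem_gen.
Qed.

Lemma desc_exists J w : J \subset S -> w \in <<J>> -> w != 1 ->
  exists2 s, s \in J & n w s.
Proof.
move=> JS wJ; case: (reduced_word JS wJ) => [[|s ws] [/=]].
  by move=> _ _ <-; rewrite /wprod big_nil eqxx.
case/andP=> sJ wsJ sz e _; have sS := subsetP JS s sJ; exists s => //.
rewrite n_desc // -sz -e wprod_cons mulSK // ltnS; apply: len_wprod.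
by apply/allP => x /(allP wsJ) /(subsetP JS).
Qed.

Lemma WJupP J w : J \subset S ->
  reflect {in J, forall s, n w^-1 s = false} (w \in WJup S J).
Proof.
move=> /subsetP JS; rewrite inE; apply: (iffP forall_inP) => h s sJ.
  by have := h s sJ; rewrite ell_mulr ?JS //; case: (n _ _) => //; lia.
by rewrite ell_mulr ?JS // h.
Qed.

Lemma ell_add_gen J w v : J \subset S ->
  {in TJ J, forall r, n w^-1 r = false} -> v \in <<J>> ->
  ell (w * v) = (ell w + ell v)%N.
Proof.
move=> /subsetP JS h; move: v; apply: gen_indr; first by rewrite mulg1 len1 addn0.
move=> s v sJ vJ IH; rewrite mulgA !(ell_mulr _ (JS s sJ)) IH invMg n_mul h; last first.
  by rewrite TJ_conj ?groupV // TJ_gen.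
rewrite addbF; case: ifP => [nv|_]; last by rewrite addnS.
by have := ell_gt0 nv; rewrite ell_inv; lia.
Qed.

(** The shortest element of [w W_J] works: a right inversion in [TJ J] would shorten it inside its
    coset. This handles all reflections of [W_J], whereas [WJup] speaks of the letters of [J]
    only. *)
Lemma WJ_decomp_strong J w : J \subset S -> exists w0 v,
  [/\ {in TJ J, forall r, n w0^-1 r = false}, v \in <<J>> & w = w0 * v].
Proof.
move=> JS; case: (@arg_minnP _ 1 (mem <<J>>) (fun v => ell (w * v))) => /=.
  exact: group1.
move=> v0 vJ vmin; exists (w * v0), v0^-1; split; rewrite ?groupV ?mulgK //.
move=> r rJ; apply/negP => /n_lt.
have rV : r^-1 = r by rewrite T_inv // (TJ_T JS).
rewrite -ell_inv invMg invgK rV ell_inv -mulgA.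
by rewrite ltnNge vmin // groupM // TJ_sub.
Qed.

(** Compare with [WJ_decomp_strong]: a nontrivial factor in [W_J] would have a last letter in [J], a
    right descent of [w]. *)
Lemma WJup_n J w r : J \subset S -> w \in WJup S J -> r \in TJ J ->
  n w^-1 r = false.
Proof.
move=> JS wJ rJ; case: (WJ_decomp_strong w JS) => w0 [v [h vJ e]].
have [v1|v1] := eqVneq v 1; first by rewrite e v1 mulg1 h.
have vV1 : v^-1 != 1 by rewrite eq_invg1.
have [|s sJ ns] := desc_exists JS _ vV1; first by rewrite groupV.
move/(WJupP _ JS): wJ => /(_ s sJ); rewrite e invMg n_mul ns h //.
by rewrite TJ_conj ?groupV // TJ_gen.
Qed.

Lemma ell_add J w v : J \subset S -> w \in WJup S J -> v \in <<J>> ->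
  ell (w * v) = (ell w + ell v)%N.
Proof.
by move=> JS wJ; apply: ell_add_gen => // r; apply: WJup_n.
Qed.

Lemma WJ_decomp J w : J \subset S -> exists w0 v,
  [/\ w0 \in WJup S J, v \in <<J>> & w = w0 * v].
Proof.
move=> JS; case: (WJ_decomp_strong w JS) => w0 [v [h vJ e]]; exists w0, v.
by split=> //; apply/WJupP => // s sJ; apply: h; apply: TJ_gen.
Qed.

(** With [u = v v'^-1], both [l(w') = l(w) + l(u)] and [l(w) = l(w') + l(u^-1)] hold, so
    [l(u) = 0]. *)
Lemma WJ_uniq J w w' v v' : J \subset S -> w \in WJup S J -> w' \in WJup S J ->
  v \in <<J>> -> v' \in <<J>> -> w * v = w' * v' -> w = w' /\ v = v'.
Proof.
move=> JS wJ w'J vJ v'J e; have uJ : v * v'^-1 \in <<J>> by rewrite groupM ?groupV.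
have e' : w' = w * (v * v'^-1) by rewrite mulgA e mulgK.
have u1 : v * v'^-1 = 1.
  apply: (@len_eq0 _ S) => //.
  have := ell_add JS wJ uJ; rewrite -e' => e1.
  have := ell_add JS w'J (groupVr uJ); rewrite {1}e' mulgK; lia.
have vv : v = v' by apply/eqP; rewrite eq_mulgV1 u1.
by split=> //; move: e; rewrite vv => /mulIg.
Qed.

Lemma WJup1 J : J \subset S -> 1 \in WJup S J.
Proof. by move=> JS; apply/WJupP => // s _; rewrite invg1 n1. Qed.

(** Deodhar's lemma. Since [w] has no right inversion in [J], a right descent [t] of [s * w] can
    come only from the letter [s], which forces [s w = w t]. *)
Lemma deodhar J w s : J \subset S -> w \in WJup S J -> s \in S ->
  s * w \notin WJup S J -> w^-1 * s * w \in J /\ n w s = false.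
Proof.
move=> JS wJ sS nsw.
have [t tJ nt] : exists2 t, t \in J & n (s * w)^-1 t.
  apply/exists_inP; apply: contraNT nsw => /exists_inPn h.
  by apply/WJupP => // t /h /negPf.
move: nt; rewrite invMg (invS sS) n_mul (WJup_n JS wJ (TJ_gen tJ)) n_gen //=.
move/eqP=> e.
have tE : w^-1 * s * w = t by rewrite -e conjgE invgK !mulgA mulVg mul1g mulgKV.
rewrite tE; split=> //.
rewrite -[w]invgK n_inv invgK (_ : s ^ w = t) ?(WJup_n JS wJ) ?TJ_gen //.
by rewrite conjgE mulgA.
Qed.

Lemma WJup_desc J w s : J \subset S -> w \in WJup S J -> s \in S ->
  n w s -> s * w \in WJup S J.
Proof.
move=> JS wJ sS nw; apply/negPn/negP => h.
by case: (deodhar JS wJ sS h) => _; rewrite nw.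
Qed.

Lemma WJup_nJ J s : J \subset S -> s \in J -> s \notin WJup S J.
Proof.
move=> JS sJ; apply/negP => /(WJupP _ JS) /(_ s sJ).
have sS := subsetP JS s sJ.
by rewrite invS // n_gen // eqxx.
Qed.

End CoxeterTheory.

(** * Matsumoto's theorem *)

Lemma leq_cancel m a b j : m <= a + b -> b <= m - j -> j <= m -> j <= a.
Proof. lia. Qed.

Section Alternating.
Local Open Scope group_scope.

Fixpoint altw (gT : finGroupType) (s t : gT) k : gT :=
  if k is k'.+1 then s * altw t s k' else 1.

Fixpoint altop (V : Type) (f g : V -> V) k (x : V) : V :=
  if k is k'.+1 then f (altop g f k' x) else x.

Section AltWords.
Variables (gT : finGroupType) (s t : gT).
Hypotheses (ss : s * s = 1) (tt : t * t = 1).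

Lemma altwD (a b : gT) i j :
  altw a b (i + j) = altw a b i * (if odd i then altw b a j else altw a b j).
Proof.
elim: i a b => [|i IH] a b; first by rewrite mul1g.
by rewrite addSn /= IH mulgA; case: (odd i).
Qed.

Lemma altw_inv (a b : gT) k : a * a = 1 -> b * b = 1 ->
  (altw a b k)^-1 = if odd k then altw a b k else altw b a k.
Proof.
elim: k a b => [|k IH] a b aa bb; first by rewrite invg1.
have aV : a^-1 = a by apply/eqP; rewrite eq_invg_mul aa.
have bV : b^-1 = b by apply/eqP; rewrite eq_invg_mul bb.
rewrite [in LHS]/= invMg IH // aV.
have := altwD a b k 1; have := altwD b a k 1; rewrite addn1 /= !mulg1.
by case: (odd k) => /= e1 e2; rewrite (e1, e2).
Qed.

Lemma altw_double (a b : gT) k : altw a b k.*2 = (a * b) ^+ k.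
Proof. by elim: k => [//|k IH]; rewrite doubleS /= IH mulgA -expgS. Qed.

Lemma altw_swap k : altw s t k = altw t s k <-> (s * t) ^+ k = 1.
Proof.
have sst := altw_inv k ss tt; have tts := altw_inv k tt ss.
rewrite -altw_double -addnn altwD; split=> e.
  apply/eqP; rewrite -eq_invg_mul sst; move: e; case: (odd k) => e; apply/eqP.
    exact: e.
  by rewrite e.
have/eqP := e; rewrite -eq_invg_mul sst; case: (odd k) => /eqP // e'.
Qed.

End AltWords.
End Alternating.

Section Matsumoto.
Variables (gT : finGroupType) (S : {set gT}) (n : gT -> gT -> bool).
Hypothesis cox : coxeter_system S.
Hypothesis nP : inversion_cocycle S n.
Implicit Types (w s t r u v : gT).
Local Open Scope group_scope.
Local Notation ell := (len S).

Lemma ell_altw s t k : s \in S -> t \in S -> ell (altw s t k) <= k.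
Proof.
elim: k s t => [|k IH] s t sS tS /=; first by rewrite len1.
by apply: leq_trans (len_mull sS (in_genS cox _)) _; rewrite ltnS IH.
Qed.

Lemma altw_in (I : {set gT}) s t k : s \in I -> t \in I -> altw s t k \in <<I>>.
Proof.
elim: k s t => [|k IH] s t sI tI /=; first exact: group1.
by rewrite groupM ?IH // mem_gen.
Qed.

(** Once the first letter [s] is removed it is no longer a descent, so only [t] can follow and the
    word alternates. The descent is demanded for [0 < k] only, because 1 has none. *)
Lemma desc_altw (I : {set gT}) s t k v : I \subset S -> s \in I -> t \in I ->
  (forall b, b \in I -> b = s \/ b = t) ->
  v \in <<I>> -> ell v = k -> (0 < k -> n v s) -> v = altw s t k.
Proof.
move=> IS; elim: k s t v => [|k IH] s t v sI tI Ist vI ev nv.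
  by apply: len_eq0 ev; apply: in_genS.
have sS := subsetP IS s sI.
rewrite /= -[v](mulSK cox _ sS) -(IH t s (s * v)) //.
- by move=> b /Ist [->|->]; [right|left].
- by rewrite groupM // mem_gen.
- by rewrite (ell_mull cox nP) // nv // ev.
move=> k0; have svI : s * v \in <<I>> by rewrite groupM // mem_gen.
have e1 : ell (s * v) = k by rewrite (ell_mull cox nP) // nv // ev.
have sv1 : s * v != 1.
  by apply/eqP => e; move: e1; rewrite e len1 => e0; rewrite -e0 in k0.
case: (desc_exists cox nP IS svI sv1) => b /Ist [->|-> //].
by rewrite (n_mulss nP) // nv.
Qed.

(** Two descents give two alternating words of the same length [k], so [(s t)^k = 1] and the order
    [m] divides [k]. If [k] were at least [2m], dropping the first [2m] letters would give a shorter
    word for [v]. *)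
Lemma dihedral_longest (I : {set gT}) s t v : I \subset S -> s \in I -> t \in I ->
  (forall b, b \in I -> b = s \/ b = t) ->
  v \in <<I>> -> n v s -> n v t -> v = altw s t #[s * t] /\ ell v = #[s * t].
Proof.
move=> IS sI tI Ist vI ns nt.
have sS := subsetP IS s sI; have tS := subsetP IS t tI.
have es := @desc_altw I s t (ell v) v IS sI tI Ist vI erefl (fun _ => ns).
have et : v = altw t s (ell v).
  by apply: (@desc_altw I) => // b /Ist [->|->]; [right|left].
have st1 : (s * t) ^+ ell v = 1.
  by apply/(altw_swap (mulSS cox sS) (mulSS cox tS)); rewrite -es -et.
have /dvdnP [j ej] : #[s * t] %| ell v by rewrite order_dvdn st1.
have m0 : 0 < #[s * t] by apply: order_gt0.
have v0 := ell_gt0 cox nP ns.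
suff e : ell v = #[s * t] by split=> //; rewrite -e.
case: j ej => [|[|j]] ej; first by rewrite ej in v0.
  by rewrite ej mul1n.
have ev : v = altw s t (j * #[s * t]).
  rewrite {1}es ej (_ : (j.+2 * #[s * t] = #[s * t].*2 + j * #[s * t])%N); last by lia.
  by rewrite altwD odd_double altw_double expg_order mul1g.
have := @ell_altw s t (j * #[s * t])%N sS tS; rewrite -ev ej; lia.
Qed.

Lemma ell_altw_le s t m j : s \in S -> t \in S -> ell (altw s t m) = m ->
  j <= m -> ell (altw s t j) = j.
Proof.
move=> sS tS em jm; apply/eqP; rewrite eqn_leq ell_altw //=.
have := altwD s t j (m - j); rewrite subnKC // => e.
have := ell_mul_le cox (altw s t j)
  (if odd j then altw t s (m - j) else altw s t (m - j)).
rewrite -e em => h0; apply: leq_cancel h0 _ jm.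
by case: (odd j); apply: ell_altw.
Qed.

(** An element of maximal length in [<<[set s; t]>>] has both letters as descents, so it is
    alternating of length [m]; prefixes of a reduced word are reduced. *)
Lemma ell_altw_eq s t j : s \in S -> t \in S -> s != t -> j <= #[s * t] ->
  ell (altw s t j) = j.
Proof.
move=> sS tS st; pose I := [set s; t].
have IS : I \subset S by apply/subsetP => b; rewrite !inE => /orP [] /eqP ->.
have sI : s \in I by rewrite !inE eqxx.
have tI : t \in I by rewrite !inE eqxx orbT.
have Ist b : b \in I -> b = s \/ b = t by rewrite !inE => /orP [] /eqP; auto.
case: (@arg_maxnP _ 1 (mem <<I>>) ell) => /=; first exact: group1.
move=> v vI vmax.
have nv b : b \in I -> n v b.
  move=> bI; have bS := subsetP IS b bI; apply/negPn/negP => nb.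
  have := vmax (b * v); rewrite groupM ?(mem_gen bI) // => /(_ isT).
  by rewrite (ell_mull cox nP) // (negPf nb) ltnn.
have [ev lv] := dihedral_longest IS sI tI Ist vI (nv s sI) (nv t tI).
by apply: ell_altw_le => //; rewrite -ev.
Qed.

Lemma order_mulSC s t : s \in S -> t \in S -> #[t * s] = #[s * t].
Proof. by move=> sS tS; rewrite -orderV invMg !(invS cox). Qed.

Lemma braidW s t : s \in S -> t \in S -> altw s t #[s * t] = altw t s #[s * t].
Proof.
move=> sS tS; apply/(altw_swap (mulSS cox sS) (mulSS cox tS)).
exact: expg_order.
Qed.

Section Operators.
Variables (J : {set gT}) (V : Type) (rho : gT -> V -> V).
Hypothesis JS : J \subset S.
Hypothesis braid : forall s t, s \in J -> t \in J ->
  forall x, altop (rho s) (rho t) #[s * t] x = altop (rho t) (rho s) #[s * t] x.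

(** The recursion of [Happ] with [rho] in place of left multiplication, so that [Hmul] acts through
    it directly. The descent is an arbitrary choice; independence of it is [opW_desc]. *)
Fixpoint opw k w x : V :=
  if k is k'.+1 then
    if [pick s in J | (len S (s * w) < len S w)%N] is Some s
    then rho s (opw k' (s * w) x) else x
  else x.

Definition opW w x := opw (ell w) w x.

Lemma opW1 x : opW 1 x = x.
Proof. by rewrite /opW len1. Qed.

(* Two left descents s and t of w force w = D u with D the longest element of
   the dihedral group, so that a single braid relation is needed. *)
Lemma opW_desc s w x : s \in J -> w \in <<J>> -> n w s ->
  opW w x = rho s (opW (s * w) x).
Proof.
have [k] := ubnP (ell w); elim: k s w => // k IH s w wk sJ wJ ns.
have sS := subsetP JS s sJ.
have ew : (ell w = (ell w).-1.+1)%N by rewrite prednK // (ell_gt0 cox nP ns).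
rewrite {1}/opW ew /=; case: pickP => [t|]; last first.
  by move/(_ s); rewrite sJ -(n_desc cox nP) ?ns.
case/andP=> tJ; have tS := subsetP JS t tJ.
rewrite -(n_desc cox nP) // => nt.
have -> : opw (ell w).-1 (t * w) x = opW (t * w) x.
  by rewrite /opW (ell_mull cox nP) // nt.
case: (eqVneq s t) => [-> //|st].
pose I := [set s; t].
have IS : I \subset S by apply/subsetP => b; rewrite !inE => /orP [] /eqP ->.
have IJ : I \subset J by apply/subsetP => b; rewrite !inE => /orP [] /eqP ->.
have sI : s \in I by rewrite !inE eqxx.
have tI : t \in I by rewrite !inE eqxx orbT.
have Ist b : b \in I -> b = s \/ b = t by rewrite !inE => /orP [] /eqP; auto.
case: (WJ_decomp cox nP w^-1 IS) => u0 [v0 [u0I v0I e]].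
pose u := u0^-1; pose v := v0^-1.
have vI : v \in <<I>> by rewrite groupV.
have we : w = v * u by rewrite -[w]invgK e invMg.
have uJ : u \in <<J>>.
  have -> : u = v^-1 * w by rewrite we mulKg.
  by rewrite groupM // groupV (subsetP (genS IJ)).
have nu b v' : b \in I -> v' \in <<I>> -> n (v' * u) b = n v' b.
  move=> bI v'I; rewrite (n_mul nP) (WJup_n cox nP IS u0I) ?addbF //.
  by rewrite TJ_conj // TJ_gen.
have lu v' : v' \in <<I>> -> ell (v' * u) = (ell v' + ell u)%N.
  move=> v'I; rewrite -(ell_inv cox) invMg invgK (ell_add cox nP IS) ?groupV //.
  by rewrite addnC -(ell_inv cox v') -(ell_inv cox u) invgK.
have nvs : n v s by rewrite -(nu s v) // -we.
have nvt : n v t by rewrite -(nu t v) // -we.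
have [ev lv] := dihedral_longest IS sI tI Ist vI nvs nvt.
set m := #[s * t] in ev lv.
have ev' : v = altw t s m by rewrite ev braidW.
have ella b b' j : b \in I -> b' \in I -> v = altw b b' m -> j <= m ->
    ell (altw b b' j) = j.
  move=> bI b'I e'; apply: ell_altw_le; rewrite ?(subsetP IS) //.
  by rewrite -e'.
(* The induction hypothesis peels these letters: for [j < m] the element [altw b b' j * u] is
   shorter than [w]. *)
have main b b' j : b \in I -> b' \in I -> v = altw b b' m -> v = altw b' b m ->
    j < m -> opW (altw b b' j * u) x = altop (rho b) (rho b') j (opW u x).
  elim: j b b' => [|j IHj] b b' bI b'I e1 e2 jm /=; first by rewrite mul1g.
  have lj : ell (altw b b' j.+1) = j.+1 by apply: ella; rewrite // ltnW.
  have ljm : j <= m by apply: ltnW; apply: ltnW.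
  have nb : n (b * altw b' b j) b.
    rewrite (n_desc cox nP) ?(subsetP IS) //.
    by rewrite (mulSK cox) ?(subsetP IS) // -/(altw b b' j.+1) lj ella.
  have aI : altw b' b j \in <<I>> by apply: altw_in.
  have baI : b * altw b' b j \in <<I>> by rewrite groupM // mem_gen.
  rewrite (IH b).
  - by rewrite -mulgA (mulSK cox) ?(subsetP IS) // IHj // ltnW.
  - rewrite (lu _ baI) -/(altw b b' j.+1) lj.
    apply: (@leq_trans (ell w)); last by rewrite -ltnS.
    by rewrite we (lu _ vI) lv ltn_add2r.
  - exact: (subsetP IJ).
  - by rewrite groupM // (subsetP (genS IJ)).
  - by rewrite nu.
have m0 : 0 < m by apply: order_gt0.
have mm : m.-1 < m by rewrite prednK.
have sw : s * w = altw t s m.-1 * u.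
  by rewrite we ev -{1}(prednK m0) /= -!mulgA (mulSK cox).
have tw : t * w = altw s t m.-1 * u.
  by rewrite we ev' -{1}(prednK m0) /= -!mulgA (mulSK cox).
rewrite sw tw !main //.
have := braid sJ tJ (opW u x); rewrite -/m -(prednK m0) /=; exact: esym.
Qed.

Lemma opW_mull s w x : s \in J -> w \in <<J>> -> n w s = false ->
  opW (s * w) x = rho s (opW w x).
Proof.
move=> sJ wJ nw; have sS := subsetP JS s sJ.
rewrite (@opW_desc s) ?(mulSK cox) ?(n_mulss nP) ?nw //.
by rewrite groupM // mem_gen.
Qed.

Lemma opW_gen s x : s \in J -> opW s x = rho s x.
Proof.
by move=> sJ; rewrite -{1}(mulg1 s) opW_mull ?group1 ?(n1 nP) // opW1.
Qed.

Lemma opW_mul u v x : u \in <<J>> -> v \in <<J>> ->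
  ell (u * v) = (ell u + ell v)%N -> opW (u * v) x = opW u (opW v x).
Proof.
have [k] := ubnP (ell u); elim: k u => // k IH u uk uJ vJ e.
have [->|u1] := eqVneq u 1; first by rewrite mul1g opW1.
case: (desc_exists cox nP JS uJ u1) => s sJ ns; have sS := subsetP JS s sJ.
have su : ell u = (ell (s * u)).+1.
  by rewrite (ell_mull cox nP) // ns prednK // (ell_gt0 cox nP ns).
have suJ : s * u \in <<J>> by rewrite groupM // mem_gen.
have e1 : ell (s * u * v) = (ell (s * u) + ell v)%N.
  apply/eqP; rewrite eqn_leq (ell_mul_le cox) /=.
  have := len_mull sS (in_genS cox (s * u * v)).
  by rewrite -mulgA (mulSK cox) // e su addSn ltnS.
rewrite (opW_desc _ sJ uJ ns) -IH //; last by rewrite su ltnS in uk.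
rewrite -mulgA -(@opW_desc s) ?groupM // (n_desc cox nP) //.
by rewrite mulgA e e1 su addSn ltnS.
Qed.

End Operators.
End Matsumoto.

(** * Laurent polynomials *)

Section LaurentBar.
Local Open Scope ring_scope.

Lemma lval_inj : injective lval. Proof. exact: val_inj. Qed.
Lemma lvalD f g : lval (f + g) = lval f + lval g. Proof. by []. Qed.
Lemma lvalM f g : lval (f * g) = lval f * lval g. Proof. by []. Qed.
Lemma lvalX f k : lval (f ^+ k) = lval f ^+ k.
Proof. by elim: k => [|k IH]; rewrite ?expr0 // !exprS -IH. Qed.
Lemma lval_int c : lval c%:~R = c%:~R.
Proof. exact: (rmorph_int (\val : laurent -> Fx)). Qed.

Lemma xLV : xL * xLinv = 1.
Proof. by apply: lval_inj; rewrite lvalM /= divff // xF_neq0. Qed.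

Lemma xXV k : xL ^+ k * xLinv ^+ k = 1.
Proof. by rewrite -exprMn xLV expr1n. Qed.

Lemma xXB k N : (k <= N)%N -> xL ^+ N * xLinv ^+ k = xL ^+ (N - k).
Proof. by move=> kN; rewrite -{1}(subnK kN) exprD -mulrA xXV mulr1. Qed.

Lemma xBX i k : (i < k)%N -> xL ^+ i * xLinv ^+ k = xLinv * xLinv ^+ (k - i.+1).
Proof.
by move=> ik; rewrite -exprS subnSK // -{1}(subnKC (ltnW ik)) exprD mulrA xXV mul1r.
Qed.

(** Every Laurent polynomial is [p(x) x^-k]; the bar involution exchanges evaluation at [xL] with
    evaluation at [xLinv], and the negative part consists of the elements [x^-1 p(x^-1)]. *)
Definition intpoly_at (y : laurent) (p : {poly int}) : laurent :=
  (map_poly intr p).[y].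
Local Notation PL := intpoly_at.

Lemma PLD y p q : PL y (p + q) = PL y p + PL y q.
Proof. by rewrite /PL rmorphD hornerD. Qed.
Lemma PLN y p : PL y (- p) = - PL y p.
Proof. by rewrite /PL rmorphN hornerN. Qed.
Lemma PL0 y : PL y 0 = 0.
Proof. by rewrite /PL rmorph0 horner0. Qed.
Lemma PLM y p q : PL y (p * q) = PL y p * PL y q.
Proof. by rewrite /PL rmorphM hornerM. Qed.
Lemma PLX y : PL y 'X = y.
Proof. by rewrite /PL map_polyX hornerX. Qed.
Lemma PLXn y k : PL y 'X^k = y ^+ k.
Proof. by rewrite /PL map_polyXn hornerXn. Qed.
Lemma PLC y c : PL y c%:P = c%:~R.
Proof. by rewrite /PL map_polyC hornerC. Qed.
Lemma PLsum y k (F : 'I_k -> {poly int}) : PL y (\sum_i F i) = \sum_i PL y (F i).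
Proof.
exact: (big_morph (PL y) (PLD y) (PL0 y)).
Qed.

Lemma PL_coef y p : PL y p = \sum_(i < size p) (p`_i)%:~R * y ^+ i.
Proof.
rewrite /PL (@horner_coef_wide _ (size p)); last exact: size_poly.
by apply: eq_bigr => i _; rewrite coef_map.
Qed.

Lemma lval_PLx p : lval (PL xL p) = p%:F.
Proof.
elim/poly_ind: p => [|p c IH].
  by rewrite PL0 rmorph0.
rewrite PLD PLM PLX PLC lvalD lvalM IH lval_int rmorphD rmorphM /=.
have -> : c%:P = (c%:~R : {poly int}) by rewrite -[c in LHS]intz rmorph_int.
by rewrite rmorph_int.
Qed.

Lemma lval_PLinv p : lval (PL xLinv p) = \sum_(i < size p) (p`_i)%:~R / xF ^+ i.
Proof.
rewrite PL_coef (big_morph lval lvalD (id1 := 0)) //.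
by apply: eq_bigr => i _; rewrite lvalM lval_int lvalX exprVn.
Qed.

Lemma laurentE f : exists p k, f = PL xL p * xLinv ^+ k.
Proof.
case/is_laurentP: (lvalP f) => p [k e]; exists p, k.
by apply: lval_inj; rewrite lvalM lval_PLx lvalX e exprVn.
Qed.

Lemma PLx_inj : injective (PL xL).
Proof.
move=> p q /(congr1 lval); rewrite !lval_PLx => /eqP; rewrite tofrac_eq.
by move/eqP.
Qed.

(** As [lbar] is chosen by [epsilon], its relation has to be single valued:
    [p(x) / x^k = p'(x) / x^k'] becomes [p X^k' = p' X^k] in [Z[X]], where [x^-1] may be substituted
    for [X]. *)
Lemma lbarE p k : lbar (PL xL p * xLinv ^+ k) = PL xLinv p * xL ^+ k.
Proof.
set f := _ * _.
have ex : exists g, lbar_rel f g.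
  exists (PL xLinv p * xL ^+ k), p, k; split.
    by rewrite lvalM lval_PLx lvalX exprVn.
  by rewrite lvalM lval_PLinv lvalX.
have [p' [k' [e1 e2]]] := epsilon_spec (inhabits 0) (lbar_rel f) ex.
have e1' : f = PL xL p' * xLinv ^+ k'.
  by apply: lval_inj; rewrite e1 lvalM lval_PLx lvalX exprVn.
have -> : lbar f = PL xLinv p' * xL ^+ k'.
  by apply: lval_inj; rewrite /lbar e2 lvalM lval_PLinv lvalX.
have e3 : p * 'X^k' = p' * 'X^k.
  apply: PLx_inj; rewrite !PLM !PLXn.
  have := congr1 (fun z => z * xL ^+ k * xL ^+ k') e1'; rewrite /f.
  rewrite -(mulrA (PL xL p)) [xLinv ^+ k * _]mulrC xXV mulr1 => ->.
  by rewrite mulrAC -(mulrA (PL xL p')) [xLinv ^+ k' * _]mulrC xXV mulr1.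
have /(congr1 (PL xLinv)) := e3; rewrite !PLM !PLXn => e4.
have := congr1 (fun z => z * xL ^+ k * xL ^+ k') e4.
rewrite mulrAC -(mulrA (PL xLinv p)) [xLinv ^+ k' * _]mulrC xXV mulr1 => ->.
by rewrite -(mulrA (PL xLinv p')) [xLinv ^+ k * _]mulrC xXV mulr1.
Qed.

Lemma lbarD f g : lbar (f + g) = lbar f + lbar g.
Proof.
case: (laurentE f) => p [k ->]; case: (laurentE g) => q [l ->].
have -> : PL xL p * xLinv ^+ k + PL xL q * xLinv ^+ l =
          PL xL (p * 'X^l + q * 'X^k) * xLinv ^+ (k + l).
  rewrite PLD !PLM !PLXn mulrDl exprD; congr (_ + _).
    by rewrite -mulrA [_ ^+ k * _]mulrC (mulrA (xL ^+ l)) xXV mul1r.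
  by rewrite -mulrA (mulrA (xL ^+ k)) xXV mul1r.
rewrite !lbarE PLD !PLM !PLXn mulrDl exprD; congr (_ + _).
  by rewrite -mulrA [xL ^+ k * _]mulrC (mulrA (xLinv ^+ l)) [xLinv ^+ l * _]mulrC xXV mul1r.
by rewrite -mulrA (mulrA (xLinv ^+ k)) [xLinv ^+ k * _]mulrC xXV mul1r.
Qed.

Lemma lbarM f g : lbar (f * g) = lbar f * lbar g.
Proof.
case: (laurentE f) => p [k ->]; case: (laurentE g) => q [l ->].
by rewrite mulrACA -exprD -PLM !lbarE exprD PLM mulrACA.
Qed.

Lemma lbar_PLx p : lbar (PL xL p) = PL xLinv p.
Proof. by have := lbarE p 0; rewrite !expr0 !mulr1. Qed.

Lemma lbar_int c : lbar c%:~R = c%:~R.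
Proof. by rewrite -[in LHS](PLC xL) lbar_PLx PLC. Qed.

Lemma lbar1 : lbar 1 = 1. Proof. exact: (lbar_int 1). Qed.
Lemma lbar0 : lbar 0 = 0. Proof. exact: (lbar_int 0). Qed.
Lemma lbarN f : lbar (- f) = - lbar f.
Proof. by apply/eqP; rewrite -addr_eq0 -lbarD addNr lbar0. Qed.
Lemma lbarB f g : lbar (f - g) = lbar f - lbar g.
Proof. by rewrite lbarD lbarN. Qed.

Lemma lbar_x : lbar xL = xLinv.
Proof. by rewrite -(PLX xL) lbar_PLx PLX. Qed.

Lemma lbar_xinv : lbar xLinv = xL.
Proof.
have := lbarE 1 1; rewrite -[1]/(1%:P) !PLC mulr1z !mul1r !expr1; exact.
Qed.

Lemma lbarX f k : lbar (f ^+ k) = lbar f ^+ k.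
Proof. by elim: k => [|k IH]; rewrite ?expr0 ?lbar1 // !exprS lbarM IH. Qed.

Lemma lbar_PLinv p : lbar (PL xLinv p) = PL xL p.
Proof.
elim/poly_ind: p => [|p c IH]; first by rewrite !PL0 (lbar_int 0).
by rewrite !PLD !PLM !PLX !PLC lbarD lbarM IH lbar_xinv lbar_int.
Qed.

Lemma lbarK f : lbar (lbar f) = f.
Proof.
case: (laurentE f) => p [k ->].
by rewrite lbarE lbarM lbar_PLinv lbarX lbar_x.
Qed.

Lemma negpartP f : in_negpart f <-> exists p, f = xLinv * PL xLinv p.
Proof.
have E p : lval (xLinv * PL xLinv p) = \sum_(i < size p) (p`_i)%:~R / xF ^+ i.+1.
  rewrite lvalM lval_PLinv mulr_sumr; apply: eq_bigr => i _ /=.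
  by rewrite mulrCA exprS invfM.
by split=> [[p e]|[p ->]]; exists p; [apply: lval_inj; rewrite E|].
Qed.

Lemma negpart0 : in_negpart 0.
Proof. by apply/negpartP; exists 0; rewrite PL0 mulr0. Qed.

Lemma negpartD f g : in_negpart f -> in_negpart g -> in_negpart (f + g).
Proof.
move=> /negpartP [p ->] /negpartP [q ->]; apply/negpartP; exists (p + q).
by rewrite PLD mulrDr.
Qed.

Lemma negpartN f : in_negpart f -> in_negpart (- f).
Proof. by move=> /negpartP [p ->]; apply/negpartP; exists (- p); rewrite PLN mulrN. Qed.

Lemma negpartB f g : in_negpart f -> in_negpart g -> in_negpart (f - g).
Proof. by move=> hf hg; apply/negpartD/negpartN. Qed.

(** [Z[x]] and [x^-1 Z[x^-1]] meet in zero: after multiplication by a large [x^N], an element of the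
    second has degree below [N], while one of the first is a multiple of [x^N]. *)
Lemma neg_polynomial f q : in_negpart f -> f = PL xL q -> f = 0.
Proof.
move=> /negpartP [p ->] e; set N := size p.
(* The reversed coefficients of [p], so that [P(x) = x^N x^-1 p(x^-1)]. *)
pose P := \poly_(i < N) p`_(N - i.+1).
have eP : PL xL P = xL ^+ N * (xLinv * PL xLinv p).
  rewrite /P poly_def PLsum PL_coef mulrA mulr_sumr (reindex_inj rev_ord_inj) /=.
  apply: eq_bigr => i _; rewrite -mul_polyC PLM PLC PLXn.
  have iN : (i < N)%N := ltn_ord i.
  have -> : (N - (N - i.+1).+1 = i)%N by lia.
  rewrite mulrCA; congr (_ * _).
  by rewrite -mulrA -exprS xXB.
have e2 : P = q * 'X^N by apply: PLx_inj; rewrite eP PLM PLXn -e mulrC.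
have P0 : P = 0.
  apply/polyP => i; rewrite coef0; have [iN|iN] := ltnP i N.
    by rewrite e2 coefMXn iN.
  by rewrite nth_default // (leq_trans (size_poly _ _)).
have := congr1 (fun z => z * xLinv ^+ N) eP.
rewrite P0 PL0 mul0r => /esym.
by rewrite mulrAC xXV mul1r.
Qed.

Lemma laurent_split f : exists a q, in_negpart a /\ f = a + PL xL q.
Proof.
case: (laurentE f) => p [k ->].
exists (PL xL (take_poly k p) * xLinv ^+ k), (drop_poly k p).
split; last first.
  by rewrite -{1}(poly_take_drop k p) PLD mulrDl PLM PLXn -mulrA xXV mulr1.
rewrite PL_coef mulr_suml; apply: (big_ind in_negpart negpart0 negpartD) => i _.
have ik : (i < k)%N by apply: leq_trans (ltn_ord i) _; apply: size_take_poly.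
rewrite -mulrA xBX //.
apply/negpartP; exists (((take_poly k p)`_i)%:P * 'X^(k - i.+1)).
by rewrite PLM PLC PLXn mulrCA.
Qed.

Lemma neg_self_bar f : in_negpart f -> lbar f = f -> f = 0.
Proof.
move=> fn; have /negpartP [p e] := fn => fb; apply: (@neg_polynomial f ('X * p)) => //.
by rewrite -fb e lbarM lbar_xinv lbar_PLinv PLM PLX.
Qed.

(** Write [f = a + c + bar b] with [a], [b] in the negative part and [c] an integer. Antisymmetry
    makes [a + b] a polynomial, hence zero, and then [2c = 0]. *)
Lemma antisymmetric_split f : lbar f = - f ->
  exists g, in_negpart g /\ f = g - lbar g.
Proof.
move=> fb; case: (laurent_split f) => a [q [an e]]; exists a; split=> //.
pose c := q`_0; pose q' := drop_poly 1 q.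
have eq : q = c%:P + 'X * q'.
  rewrite -{1}(poly_take_drop 1 q) mulrC expr1; congr (_ + _).
  by apply/polyP => i; rewrite coef_take_poly coefC; case: i.
have eg : PL xL q = c%:~R + xL * PL xL q' by rewrite eq PLD PLC PLM PLX.
pose b := xLinv * PL xLinv q'.
have bn : in_negpart b by apply/negpartP; exists q'.
have bb : lbar b = xL * PL xL q' by rewrite lbarM lbar_xinv lbar_PLinv.
have fe : f = a + c%:~R + lbar b by rewrite e eg bb addrA.
have [p ap] : exists p, a = xLinv * PL xLinv p by apply/negpartP.
have ab : lbar a = PL xL ('X * p) by rewrite ap lbarM lbar_xinv lbar_PLinv PLM PLX.
have key : a + b = PL xL (- ('X * p + (c + c)%:P + 'X * q')).
  rewrite PLN !PLD -ab PLC PLM PLX -bb.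
  have := fb; rewrite {1}fe !lbarD lbar_int lbarK fe => h.
  apply/eqP; rewrite -subr_eq0 opprK; apply/eqP.
  transitivity (lbar a + c%:~R + b + (a + c%:~R + lbar b)).
    by rewrite intrD; ring.
  by rewrite h addNr.
have ab0 := neg_polynomial (negpartD an bn) key.
have c0 : c = 0.
  have : PL xL ('X * p + (c + c)%:P + 'X * q') = PL xL 0.
    by apply: oppr_inj; rewrite -PLN -key ab0 PL0 oppr0.
  move/PLx_inj/(congr1 (fun r : {poly int} => r`_0)).
  rewrite !coefD !coefXM coefC coef0 /= add0r addr0; lia.
have -> : a = - b by apply/eqP; rewrite -addr_eq0 ab0.
have -> : f = - b + lbar b.
  rewrite fe c0 addr0; congr (_ + _).
  by apply/eqP; rewrite -addr_eq0 ab0.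
by rewrite lbarN opprK.
Qed.

End LaurentBar.

(** * Free modules and canonical bases *)

(** One language for the free modules [Hk] and [Mod], to which [hsc], [msc], [Hb] and [Mb] are
    converted; locked so that rewriting does not unfold finite functions. *)
HB.lock Definition fsc (X : finType) (c : laurent) (m : {ffun X -> laurent})
  : {ffun X -> laurent} := [ffun i => (c * m i)%R].
HB.lock Definition fb (X : finType) (x : X)
  : {ffun X -> laurent} := [ffun i => if i == x then 1%R else 0%R].

Section FreeModule.
Local Open Scope ring_scope.
Variable X : finType.
Local Notation V := {ffun X -> laurent}.
Implicit Types (c d : laurent) (m : V) (x : X).

Lemma fscE c m i : fsc c m i = c * m i. Proof. by rewrite fsc.unlock ffunE. Qed.
Lemma fbE x i : fb x i = if i == x then 1 else 0. Proof. by rewrite fb.unlock ffunE. Qed.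
Lemma faddE m m' i : (m + m') i = m i + m' i. Proof. by rewrite ffunE. Qed.
Lemma foppE m i : (- m) i = - m i. Proof. by rewrite ffunE. Qed.
Lemma fzeroE i : (0 : V) i = 0. Proof. by rewrite ffunE. Qed.

Lemma fsumE I (r : seq I) P (F : I -> V) i :
  (\sum_(j <- r | P j) F j) i = \sum_(j <- r | P j) F j i.
Proof. by rewrite sum_ffunE. Qed.

Lemma fscDr c m m' : fsc c (m + m') = fsc c m + fsc c m'.
Proof. by apply/ffunP => i; rewrite !(fscE, faddE, foppE, fzeroE) mulrDr. Qed.
Lemma fscDl c d m : fsc (c + d) m = fsc c m + fsc d m.
Proof. by apply/ffunP => i; rewrite !(fscE, faddE, foppE, fzeroE) mulrDl. Qed.
Lemma fscA c d m : fsc c (fsc d m) = fsc (c * d) m.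
Proof. by apply/ffunP => i; rewrite !(fscE, faddE, foppE, fzeroE) mulrA. Qed.
Lemma fsc1 m : fsc 1 m = m.
Proof. by apply/ffunP => i; rewrite !(fscE, faddE, foppE, fzeroE) mul1r. Qed.
Lemma fsc0r c : fsc c (0 : V) = 0.
Proof. by apply/ffunP => i; rewrite !(fscE, faddE, foppE, fzeroE) mulr0. Qed.
Lemma fsc0l m : fsc 0 m = 0.
Proof. by apply/ffunP => i; rewrite !(fscE, faddE, foppE, fzeroE) mul0r. Qed.
Lemma fsc10 m m' : m = fsc 1 m + fsc 0 m'.
Proof. by rewrite fsc1 fsc0l addr0. Qed.
Lemma fsc01 m m' : m' = fsc 0 m + fsc 1 m'.
Proof. by rewrite fsc0l fsc1 add0r. Qed.
Lemma fscN c m : fsc (- c) m = - fsc c m.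
Proof. by apply/ffunP => i; rewrite !(fscE, faddE, foppE, fzeroE) mulNr. Qed.
Lemma fscNr c m : fsc c (- m) = - fsc c m.
Proof. by apply/ffunP => i; rewrite !(fscE, faddE, foppE, fzeroE) mulrN. Qed.

Lemma fsc_sum c I (r : seq I) P (F : I -> V) :
  fsc c (\sum_(j <- r | P j) F j) = \sum_(j <- r | P j) fsc c (F j).
Proof. exact: (big_morph (fsc c) (fscDr c) (fsc0r c)). Qed.

Lemma fb_expand m : m = \sum_x fsc (m x) (fb x).
Proof.
apply/ffunP => i; rewrite fsumE (bigD1 i) //= fscE fbE eqxx mulr1 big1 ?addr0 //.
by move=> j ji; rewrite fscE fbE eq_sym (negPf ji) mulr0.
Qed.

Lemma fsum_fb (P : pred X) (c : X -> laurent) i :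
  (\sum_(x | P x) fsc (c x) (fb x)) i = if P i then c i else 0.
Proof.
rewrite fsumE big_mkcond (bigD1 i) //= big1 ?addr0.
  by case: (P i); rewrite // fscE fbE eqxx mulr1.
by move=> j ji; case: (P j); rewrite // fscE fbE eq_sym (negPf ji) mulr0.
Qed.

End FreeModule.
Arguments fb {X}.

Section Semilinear.
Local Open Scope ring_scope.
Variables (X Y : finType).
Local Notation V := {ffun X -> laurent}.
Local Notation U := {ffun Y -> laurent}.

(** [th] is [id] for linear and [lbar] for antilinear maps, so one set of lemmas serves both. *)
Definition semilin (th : laurent -> laurent) (f : V -> U) : Prop :=
  forall c m m', f (fsc c m + m') = fsc (th c) (f m) + f m'.

Section Facts.
Variables (th : laurent -> laurent) (f : V -> U).
Hypotheses (th1 : th 1 = 1) (hf : semilin th f).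

Lemma sl_add m m' : f (m + m') = f m + f m'.
Proof. by have := hf 1 m m'; rewrite th1 !fsc1. Qed.
Lemma sl_zero : f 0 = 0.
Proof. by apply: (@addrI _ (f 0)); rewrite -sl_add !addr0. Qed.
Lemma sl_scale c m : f (fsc c m) = fsc (th c) (f m).
Proof. by have := hf c m 0; rewrite sl_zero !addr0. Qed.
Lemma sl_opp m : f (- m) = - f m.
Proof. by apply/eqP; rewrite -addr_eq0 -sl_add addNr sl_zero. Qed.
Lemma sl_sum I (r : seq I) P (F : I -> V) :
  f (\sum_(j <- r | P j) F j) = \sum_(j <- r | P j) f (F j).
Proof. exact: (big_morph f sl_add sl_zero). Qed.
Lemma sl_expand m : f m = \sum_x fsc (th (m x)) (f (fb x)).
Proof.
by rewrite {1}(fb_expand m) sl_sum; apply: eq_bigr => x _; rewrite sl_scale.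
Qed.
End Facts.

Lemma sl_ext th f g : th 1 = 1 -> semilin th f -> semilin th g ->
  (forall x, f (fb x) = g (fb x)) -> forall m, f m = g m.
Proof.
move=> th1 hf hg e m; rewrite (sl_expand th1 hf) (sl_expand th1 hg).
by apply: eq_bigr => x _; rewrite e.
Qed.

Definition sl_lift (th : laurent -> laurent) (v : X -> U) (m : V) : U :=
  \sum_x fsc (th (m x)) (v x).

Lemma sl_lift_sl th v : {morph th : c d / c + d} -> {morph th : c d / c * d} ->
  semilin th (sl_lift th v).
Proof.
move=> thD thM c m m'; rewrite /sl_lift fsc_sum -big_split /=.
by apply: eq_bigr => x _; rewrite faddE fscE thD thM fscDl fscA.
Qed.

Lemma sl_lift_fb th v x : th 0 = 0 -> th 1 = 1 -> sl_lift th v (fb x) = v x.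
Proof.
move=> th0 th1; rewrite /sl_lift (bigD1 x) //= fbE eqxx th1 fsc1 big1 ?addr0 //.
by move=> y yx; rewrite fbE (negPf yx) th0 fsc0l.
Qed.

Definition linear_lift := sl_lift id.

Lemma linear_lift_lin v : semilin id (linear_lift v).
Proof. by apply: sl_lift_sl. Qed.

Lemma linear_lift_fb v x : linear_lift v (fb x) = v x.
Proof. by apply: sl_lift_fb. Qed.

End Semilinear.

Lemma semilin_comp (X Y Z : finType) th th'
    (f : {ffun Y -> laurent} -> {ffun Z -> laurent})
    (g : {ffun X -> laurent} -> {ffun Y -> laurent}) :
  semilin th f -> semilin th' g ->
  semilin (fun c => th (th' c)) (fun m => f (g m)).
Proof. by move=> hf hg c m m'; rewrite hg hf. Qed.

Lemma semilin_compr (X Y Z : finType) th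
    (f : {ffun Y -> laurent} -> {ffun Z -> laurent})
    (g : {ffun X -> laurent} -> {ffun Y -> laurent}) :
  semilin th f -> semilin id g -> semilin th (fun m => f (g m)).
Proof. by move=> hf hg c m m'; rewrite hg hf. Qed.

(** * Kazhdan-Lusztig bases for a unitriangular antilinear involution *)

Section CanonicalBasis.
Local Open Scope ring_scope.
Variables (X : finType) (lt : rel X) (h : X -> rat).
Local Notation V := {ffun X -> laurent}.
Hypothesis lt_h : forall x y, lt x y -> (h x < h y)%R.
Hypothesis lt_trans : forall x y z, lt x y -> lt y z -> lt x z.
Variable psi : V -> V.
Hypothesis psi_sl : semilin lbar psi.
Hypothesis psiK : forall m, psi (psi m) = m.
Hypothesis psi_tri : forall x, exists c : X -> laurent,
  psi (fb x) = fb x + \sum_(y | lt y x) fsc (c y) (fb y).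

Let psiD := sl_add lbar1 psi_sl.
Let psiN := sl_opp lbar1 psi_sl.

Definition supported (A : {set X}) (m : V) : Prop :=
  forall x, x \notin A -> m x = 0.
Definition down_closed (A : {set X}) : Prop :=
  forall x y, lt x y -> y \in A -> x \in A.

Lemma lt_irr x : lt x x = false.
Proof. by apply/negP => /lt_h; rewrite Order.POrderTheory.ltxx. Qed.

Lemma psi_coef x y : psi (fb x) y = if y == x then 1 else if lt y x then psi (fb x) y else 0.
Proof.
case: (psi_tri x) => c ->; rewrite faddE fbE fsum_fb.
by case: eqP => [->|_]; rewrite ?lt_irr ?addr0 //; case: (lt y x); rewrite ?add0r.
Qed.

(* Splits off an element of maximal height, whose removal keeps the set closed. *)
Lemma down_closed_ind (P : {set X} -> Prop) :
  P set0 ->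
  (forall A x, down_closed A -> x \in A -> down_closed (A :\ x) ->
     {in A, forall y, lt x y = false} -> P (A :\ x) -> P A) ->
  forall A, down_closed A -> P A.
Proof.
move=> P0 PS A; have [k] := ubnP #|A|; elim: k A => // k IH A cA dA.
have [->//|/set0Pn [x0 x0A]] := eqVneq A set0.
have [x xA xmax] : exists2 x, x \in A & {in A, forall y, (h y <= h x)%R}.
  by case: (@Order.TotalTheory.arg_maxP _ _ X x0 (mem A) h x0A) => x xA hx; exists x.
have nlt : {in A, forall y, lt x y = false}.
  move=> y yA; apply/negP => /lt_h; rewrite Order.TotalTheory.ltNge.
  by rewrite xmax.
have dAx : down_closed (A :\ x).
  move=> y z yz; rewrite !inE => /andP [_ zA]; rewrite (dA y z) // andbT.
  by apply: contraTneq yz => ->; rewrite nlt.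
apply: (PS _ _ dA xA dAx nlt); apply: IH => //.
by move: cA; rewrite [in X in X -> _](cardsD1 x) xA.
Qed.

Lemma psi_supported A m : down_closed A -> supported A m -> supported A (psi m).
Proof.
move=> dA sm y yA; rewrite (sl_expand lbar1 psi_sl) fsumE big1 // => x _.
rewrite fscE; have [xA|xA] := boolP (x \in A); last by rewrite sm // lbar0 mul0r.
rewrite psi_coef; case: eqP => [e|_]; first by rewrite e xA in yA.
by case: ifP => [yx|_]; rewrite ?mulr0 //; case/negP: yA; apply: dA xA.
Qed.

Lemma psi_top A x m : down_closed A -> {in A, forall y, lt x y = false} ->
  x \in A -> supported A m -> psi m x = lbar (m x).
Proof.
move=> dA nlt xA sm; rewrite (sl_expand lbar1 psi_sl) fsumE (bigD1 x) //=.
rewrite fscE psi_coef eqxx mulr1 big1 ?addr0 // => y yx.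
rewrite fscE psi_coef eq_sym (negPf yx).
have [yA|yA] := boolP (y \in A); first by rewrite nlt // mulr0.
by rewrite sm // lbar0 mul0r.
Qed.

(** By triangularity the coefficient of [m] at a maximal [x] is antisymmetric under [lbar], so it is
    [a - lbar a]. Subtracting [e - psi e] with [e = a M_x] removes [x] from the support and keeps
    [m] antisymmetric. *)
Lemma antisymmetric_solve A : down_closed A -> forall m, supported A m ->
  psi m = - m -> exists g : V, [/\ supported A g, forall x, in_negpart (g x)
                                 & m = g - psi g].
Proof.
move: A; apply: down_closed_ind => [m sm _|A x dA xA dAx nlt IH m sm pm].
  have m0 : m = 0 by apply/ffunP => y; rewrite sm ?inE // ffunE.
  exists 0; rewrite m0 (sl_zero lbar1 psi_sl) subr0; split=> // y.
    by rewrite fzeroE.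
  by rewrite fzeroE; apply: negpart0.
have : lbar (m x) = - m x by rewrite -(psi_top dA nlt xA sm) pm foppE.
case/antisymmetric_split => a [an ea].
pose e : V := fsc a (fb x).
have se : supported A e.
  move=> y yA; rewrite fscE fbE; case: eqP => [e0|_]; last by rewrite mulr0.
  by rewrite e0 xA in yA.
have pe := psi_supported dA se.
pose m' := m - (e - psi e).
case: (IH m') => [y||g [sg ng eg]].
- rewrite !inE negb_and negbK => /orP [/eqP->|yA].
    rewrite /m' !faddE !foppE faddE foppE (psi_top dA nlt xA se) fscE fbE eqxx mulr1.
    by rewrite {1}ea subrr.
  by rewrite /m' !faddE !foppE faddE foppE sm // se // pe // !subr0.
- by rewrite /m' psiD pm psiN psiD psiN psiK !opprB addrC.
exists (g + e); split.
- move=> y yA; rewrite faddE se // addr0 sg // !inE negb_and.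
  by rewrite yA orbT.
- move=> y; rewrite faddE; apply: negpartD => //; rewrite fscE fbE.
  by case: eqP; rewrite ?mulr1 ?mulr0 //; move=> _; apply: negpart0.
- by rewrite psiD opprD addrACA -eg /m' subrK.
Qed.

Lemma down_closed_lt x : down_closed [set y | lt y x].
Proof. by move=> y z yz; rewrite !inE; apply: lt_trans. Qed.

Definition unitriangular (B : X -> V) : Prop := forall x,
  exists c : X -> laurent, B x = fb x + \sum_(y | lt y x) fsc (c y) (fb y).

Lemma unitri_coef B x y : unitriangular B ->
  B x y = if y == x then 1 else if lt y x then B x y else 0.
Proof.
move=> /(_ x) [c ->]; rewrite faddE fbE fsum_fb.
by case: eqP => [->|_]; rewrite ?lt_irr ?addr0 //; case: (lt y x); rewrite ?add0r.
Qed.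

Lemma unitri_span B : unitriangular B -> forall A, down_closed A ->
  forall m, supported A m -> exists c : {ffun X -> laurent},
    m = \sum_x fsc (c x) (B x).
Proof.
move=> tB; apply: down_closed_ind => [m sm|A x dA xA dAx nlt IH m sm].
  exists 0; rewrite big1; first by apply/ffunP => y; rewrite sm ?inE // ffunE.
  by move=> y _; rewrite ffunE fsc0l.
case: (IH (m - fsc (m x) (B x))) => [y|c ec].
  rewrite !inE negb_and negbK => /orP [/eqP->|yA].
    by rewrite faddE foppE fscE (unitri_coef x x tB) eqxx mulr1 subrr.
  rewrite faddE foppE fscE (unitri_coef x y tB) sm //.
  case: eqP => [e|_]; first by rewrite e xA in yA.
  case: ifP => [yx|_]; last by rewrite mulr0 subr0.
  by case/negP: yA; apply: dA xA.
exists (c + fsc (m x) (fb x)).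
under eq_bigr => y _ do rewrite faddE fscDl.
rewrite big_split -ec /= (bigD1 x) //= fscE fbE eqxx mulr1 big1 ?addr0 ?subrK //.
by move=> y yx; rewrite fscE fbE (negPf yx) mulr0 fsc0l.
Qed.

Lemma unitri_free B : unitriangular B -> forall c : {ffun X -> laurent},
  \sum_x fsc (c x) (B x) = 0 -> c = 0.
Proof.
move=> tB c.
have dT : down_closed setT by [].
have : supported setT c by move=> x; rewrite inE.
move: setT dT; apply: down_closed_ind => [sc _|A x dA xA dAx nlt IH sc e].
  by apply/ffunP => y; rewrite sc ?inE // ffunE.
apply: IH => // y; rewrite !inE negb_and negbK => /orP [/eqP->|]; last exact: sc.
have := congr1 (fun m : V => m x) e; rewrite fsumE (bigD1 x) //= fscE.
rewrite (unitri_coef x x tB) eqxx mulr1 big1 ?addr0 ?fzeroE // => z zx.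
rewrite fscE (unitri_coef z x tB) eq_sym (negPf zx).
have [zA|zA] := boolP (z \in A); first by rewrite nlt // mulr0.
by rewrite sc // mul0r.
Qed.

Lemma unitri_basis B : unitriangular B ->
  forall m : V, exists! c : {ffun X -> laurent}, m = \sum_x fsc (c x) (B x).
Proof.
move=> tB m; case: (@unitri_span B tB setT _ m) => [//|x|c e].
  by rewrite inE.
exists c; split=> // c' e'.
apply/eqP; rewrite -subr_eq0; apply/eqP; apply: (unitri_free tB).
under eq_bigr => x _ do rewrite faddE foppE fscDl fscN.
by rewrite big_split /= sumrN -e -e' subrr.
Qed.

Definition canonical (B : X -> V) : Prop := forall x,
  psi (B x) = B x /\ exists c : X -> laurent, (forall y, in_negpart (c y)) /\
    B x = fb x + \sum_(y | lt y x) fsc (c y) (fb y).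

Lemma canonical_unitri B : canonical B -> unitriangular B.
Proof. by move=> cB x; case: (cB x) => _ [c [_ e]]; exists c. Qed.

(** As [psi] is an involution, the defect [psi M_x - M_x] is antisymmetric; it equals [g - psi g],
    and [M_x + g] is fixed. *)
Lemma canonical_exists x : exists b : V, psi b = b /\
  exists c : X -> laurent, (forall y, in_negpart (c y)) /\
    b = fb x + \sum_(y | lt y x) fsc (c y) (fb y).
Proof.
case: (psi_tri x) => c ec.
pose m := psi (fb x) - fb x.
have sm : supported [set y | lt y x] m.
  move=> y; rewrite inE => yx; rewrite /m ec addrC addKr fsum_fb.
  by rewrite (negPf yx).
have pm : psi m = - m by rewrite /m psiD psiN psiK opprB.
case: (antisymmetric_solve (@down_closed_lt x) sm pm) => g [sg ng eg].
exists (fb x + g); split.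
  have e0 : psi (fb x) = fb x + (g - psi g) by rewrite -eg /m addrC subrK.
  by rewrite psiD e0 -addrA subrK.
exists g; split=> //; congr (_ + _); apply/ffunP => y; rewrite fsum_fb.
by case: ifP => // yx; rewrite sg // inE yx.
Qed.

(** The difference is [psi]-fixed with all coefficients in the negative part; a top coefficient is
    then [lbar]-invariant, hence zero. *)
Lemma canonical_unique B B' : canonical B -> canonical B' -> forall x, B x = B' x.
Proof.
move=> cB cB' x.
case: (cB x) => pb [c [nc eb]]; case: (cB' x) => pb' [c' [nc' eb']].
pose d := B x - B' x.
have pd : psi d = d by rewrite psiD psiN pb pb'.
have nd y : in_negpart (d y).
  rewrite /d eb eb' opprD addrACA subrr add0r faddE foppE !fsum_fb.
  by case: ifP => _; [apply: negpartB | rewrite subr0; apply: negpart0].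
have sd : supported setT d by move=> y; rewrite inE.
have dT : down_closed setT by [].
suff d0 : d = 0 by apply/eqP; rewrite -subr_eq0 -/d d0.
move: setT dT sd; apply: down_closed_ind => [sd|A y dA yA dAy nlt IH sd].
  by apply/ffunP => y; rewrite sd ?inE // ffunE.
apply: IH => z; rewrite !inE negb_and negbK => /orP [/eqP->|]; last exact: sd.
by apply: neg_self_bar => //; rewrite -(psi_top dA nlt yA sd) pd.
Qed.

End CanonicalBasis.

(** * The Hecke algebra *)

Section GraphOperator.
Local Open Scope ring_scope.

Definition qL : laurent := xL - xLinv.

Lemma lbar_q : lbar qL = - qL.
Proof. by rewrite lbarB lbar_x lbar_xinv opprB. Qed.

(** The two roots of [c^2 = 1 + (x - x^-1) c], the scalars by which a generator can act on a
    line. *)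
Definition hecke_eigen (c : laurent) : Prop := c = xL \/ c = - xLinv.

Lemma eigen_sqr c : hecke_eigen c -> c * c = 1 + qL * c.
Proof.
have e := xLV; rewrite /qL; case=> ->.
  by rewrite mulrBl [xLinv * _]mulrC e addrC subrK.
by rewrite mulrBl !mulrN e !mulNr opprK addrA addrN add0r.
Qed.

Lemma eigen_bar c : hecke_eigen c -> lbar c * c = 1.
Proof.
case=> ->; first by rewrite lbar_x mulrC xLV.
by rewrite lbarN lbar_xinv mulrNN xLV.
Qed.

Lemma eigen_sub c : hecke_eigen c -> c - qL = lbar c.
Proof.
rewrite /qL; case=> ->; first by rewrite lbar_x; ring.
by rewrite lbarN lbar_xinv; ring.
Qed.

Variables (X : finType) (st : X -> X) (h : X -> nat) (a : X -> laurent).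

(** A common template for [Lgen], [rhoN] and [rhoK]: [st] permutes the basis labels, [h] is a height
    with natural values, and [a] is the eigenvalue at labels whose height does not change. *)
Definition gop_fb (x : X) : {ffun X -> laurent} :=
  if (h x < h (st x))%N then fb (st x)
  else if (h (st x) < h x)%N then fb (st x) + fsc qL (fb x)
  else fsc (a x) (fb x).

Definition gop := linear_lift gop_fb.

Lemma gop_lin : semilin id gop. Proof. exact: linear_lift_lin. Qed.
Lemma gopE x : gop (fb x) = gop_fb x. Proof. exact: linear_lift_fb. Qed.

Lemma gop_quad m : (forall x, st (st x) = x) -> (forall x, hecke_eigen (a x)) ->
  gop (gop m) = m + fsc qL (gop m).
Proof.
move=> stK ea.
apply: (@sl_ext _ _ id (fun m => gop (gop m)) (fun m => m + fsc qL (gop m))) => //.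
- exact: (semilin_comp gop_lin gop_lin).
- move=> c u v; rewrite gop_lin !fscDr !fscA [c * _]mulrC addrACA.
  by congr (_ + _ + _); rewrite mulrC.
move=> x; rewrite gopE {1}/gop_fb; case: ltngtP => hx.
- have hx' : (h (st x) < h x)%N = false by rewrite ltnNge ltnW.
  by rewrite gopE /gop_fb stK hx hx'.
- have hx' : (h x < h (st x))%N = false by rewrite ltnNge ltnW.
  by rewrite (sl_add _ gop_lin) // (sl_scale _ gop_lin) // !gopE /gop_fb stK hx hx'.
rewrite (sl_scale _ gop_lin) // gopE /gop_fb hx ltnn !fscA eigen_sqr //.
by rewrite fscDl fsc1.
Qed.

End GraphOperator.

Lemma altop_lin (X : finType) (f g : {ffun X -> laurent} -> {ffun X -> laurent}) k :
  semilin id f -> semilin id g -> semilin id (altop f g k).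
Proof.
elim: k f g => [|k IH] f g hf hg c m m' /=; first by [].
by rewrite (IH g f hg hf) hf.
Qed.

Lemma altop_intertwine (V U : Type) (pi : V -> U) (f g : V -> V) (f' g' : U -> U) k v :
  (forall v, pi (f v) = f' (pi v)) -> (forall v, pi (g v) = g' (pi v)) ->
  pi (altop f g k v) = altop f' g' k (pi v).
Proof. by elim: k f g f' g' => //= k IH f g f' g' hf hg; rewrite hf (IH g f g' f'). Qed.

(** * The regular representation and its braid relations *)

Section Regular.
Variables (gT : finGroupType) (S : {set gT}) (n : gT -> gT -> bool).
Hypothesis cox : coxeter_system S.
Hypothesis nP : inversion_cocycle S n.
Local Open Scope ring_scope.
Local Notation ell := (len S).
Local Notation H := (Hk (gT := gT)).
Implicit Types (s t u w : gT) (b : H).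

Lemma Hb_fb w : Hb w = fb w. Proof. by rewrite fb.unlock. Qed.
Lemma hsc_fsc (c : laurent) b : hsc c b = fsc c b. Proof. by rewrite fsc.unlock. Qed.

Lemma ell_neq s w : s \in S -> ell (s * w)%g != ell w.
Proof.
move=> sS; rewrite (ell_mull cox nP) //; case: ifP => [/(ell_gt0 cox nP)|_]; lia.
Qed.

Lemma Lgen_lin s : semilin id (Lgen S s).
Proof.
move=> c b b'; apply/ffunP => u; rewrite ffunE !faddE !fscE !ffunE.
by case: ifP => _; rewrite ?addr0 /qL; ring.
Qed.

Lemma Lgen_fb s w : s \in S -> Lgen S s (fb w) =
  if n w s then fb (s * w)%g + fsc qL (fb w) else fb (s * w)%g.
Proof.
move=> sS; apply/ffunP => u; rewrite ffunE !fbE -/qL.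
have -> : (s * u == w)%g = (u == s * w)%g.
  by apply/eqP/eqP => [<-|->]; rewrite (mulSK cox).
rewrite -(n_desc cox nP) //.
case: (eqVneq u w) => [->|uw].
  by case: (n w s); rewrite ?faddE ?fscE ?fbE ?eqxx ?addr0.
by rewrite mulr0 if_same addr0; case: (n w s); rewrite ?faddE ?fscE !fbE ?(negPf uw) ?mulr0 ?addr0.
Qed.

(** Left multiplication by [s] always changes the length, so only the first two branches of the
    template occur; [xL] is a value that satisfies [hecke_eigen], as [gop_quad] asks. *)
Lemma Lgen_gop s b : s \in S -> Lgen S s b = gop (fun u => s * u)%g ell (fun=> xL) b.
Proof.
move=> sS; move: b; apply: (@sl_ext _ _ id) => //; [exact: Lgen_lin|exact: gop_lin|].
move=> w; rewrite Lgen_fb // gopE /gop_fb (n_desc cox nP) //.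
by have := ell_neq w sS; case: ltngtP.
Qed.

Lemma Lgen_quad s b : s \in S -> Lgen S s (Lgen S s b) = b + fsc qL (Lgen S s b).
Proof.
move=> sS; rewrite !(Lgen_gop _ sS); apply: gop_quad; last by left.
by move=> u; rewrite (mulSK cox).
Qed.

(** Right multiplication by [H_t], written as the mirror image of [Lgen]. *)
Definition Rgen t b : H :=
  [ffun u => b (u * t)%g + (if (ell (u * t)%g < ell u)%N then qL * b u else 0)].

Lemma desc_r u t : t \in S -> (ell (u * t)%g < ell u)%N = n u^-1%g t.
Proof.
by move=> tS; rewrite (n_desc cox nP) // -(ell_inv cox (t * _)) invMg invgK
  (invS cox tS) (ell_inv cox u).
Qed.

(** Left and right descents interact only where [s u = u t]: multiplying [u] by [t] changes the
    status of [s] exactly there, and there [s] is a left descent iff [t] is a right one. *)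
Lemma LR_comm s t b : s \in S -> t \in S -> Lgen S s (Rgen t b) = Rgen t (Lgen S s b).
Proof.
move=> sS tS; apply/ffunP => u; rewrite !ffunE -/qL !mulgA.
rewrite !desc_r // -!mulgA -!(n_desc cox nP) // !mulgA.
rewrite (n_mul nP u t s) (n_gen nP _ tS) !invMg (n_mul nP u^-1 s^-1 t).
rewrite (invS cox sS) (n_gen nP _ sS).
have E : (s ^ u == t)%g = (s * u == u * t)%g.
  by rewrite conjgE; apply/eqP/eqP => [<-|->]; rewrite ?mulKVg ?mulKg // mulgA.
have E' : (t ^ u^-1 == s)%g = (s * u == u * t)%g.
  rewrite conjgE invgK mulgA; apply/eqP/eqP => [<-|<-]; last by rewrite mulgK.
  by rewrite mulgKV.
rewrite E E'; case: eqP => [e|_].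
  have -> : n u^-1%g t = n u s.
    by rewrite -(desc_r u tS) -e (n_desc cox nP).
  by rewrite e; case: (n u s) => /=; ring.
by rewrite !addbF; case: (n u s); case: (n _ t); rewrite /=; ring.
Qed.

Lemma Rgen_fb t w : t \in S -> n w^-1%g t = false -> Rgen t (fb w) = fb (w * t)%g.
Proof.
move=> tS nw; apply/ffunP => u; rewrite ffunE !fbE.
have -> : (u * t == w)%g = (u == w * t)%g.
  by apply/eqP/eqP => [<-|->]; rewrite (mulKS cox).
case: (eqVneq u w) => [->|_]; last by rewrite mulr0 if_same addr0.
by rewrite desc_r // nw addr0.
Qed.

(* Left multiplications commute with right ones, hence are determined by their
   value at 1; this yields the braid relations for [Lgen]. *)
Lemma regular_ext (A B : H -> H) :
  semilin id A -> semilin id B ->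
  (forall t b, t \in S -> A (Rgen t b) = Rgen t (A b)) ->
  (forall t b, t \in S -> B (Rgen t b) = Rgen t (B b)) ->
  A Hone = B Hone -> forall b, A b = B b.
Proof.
move=> Al Bl Ac Bc e; apply: (sl_ext _ Al Bl) => // w.
have [k] := ubnP (ell w); elim: k w => // k IH w wk.
have [->|w1] := eqVneq w 1%g; first by rewrite -Hb_fb.
case: (@desc_exists _ _ _ cox nP S w^-1%g) => [//||| t tS nt].
- exact: (in_genS cox).
- by rewrite eq_invg1.
have nwt : n (w * t)^-1%g t = false.
  by rewrite invMg (invS cox tS) (n_mulss nP) // nt.
rewrite -[w](mulKS cox _ tS) -Rgen_fb // Ac // Bc // IH //.
by apply: (@leq_trans (ell w)); [rewrite desc_r | rewrite -ltnS].
Qed.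

Lemma alt_comm s t k r b : s \in S -> t \in S -> r \in S ->
  altop (Lgen S s) (Lgen S t) k (Rgen r b) = Rgen r (altop (Lgen S s) (Lgen S t) k b).
Proof.
move=> sS tS rS; symmetry; apply: altop_intertwine => v; rewrite LR_comm //.
Qed.

Lemma alt_one s t k : s \in S -> t \in S -> s != t -> (k <= #[s * t]%g)%N ->
  altop (Lgen S s) (Lgen S t) k Hone = Hb (altw s t k).
Proof.
elim: k s t => //= k IH s t sS tS st km.
rewrite IH // 1?eq_sym //; last by rewrite (order_mulSC cox) // ltnW.
rewrite !Hb_fb Lgen_fb // (n_desc cox nP) // -/(altw s t k.+1).
rewrite (ell_altw_eq cox nP sS tS st km).
rewrite (ell_altw_eq cox nP tS sS) 1?eq_sym // ?ltnNge ?leqnSn //.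
by rewrite (order_mulSC cox) // ltnW.
Qed.

Lemma braidL s t : s \in S -> t \in S -> forall b,
  altop (Lgen S s) (Lgen S t) #[s * t]%g b = altop (Lgen S t) (Lgen S s) #[s * t]%g b.
Proof.
move=> sS tS; have [<-//|st] := eqVneq s t.
apply: regular_ext.
- by apply: altop_lin; apply: Lgen_lin.
- by apply: altop_lin; apply: Lgen_lin.
- by move=> r b rS; apply: alt_comm.
- by move=> r b rS; apply: alt_comm.
rewrite !alt_one // 1?eq_sym //; last by rewrite (order_mulSC cox).
by rewrite (braidW cox).
Qed.

End Regular.

(** * Hecke modules from operators with quadratic and braid relations *)

Section HeckeAction.
Variables (gT : finGroupType) (S : {set gT}) (n : gT -> gT -> bool).
Hypothesis cox : coxeter_system S.
Hypothesis nP : inversion_cocycle S n.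
Variables (X : finType).
Local Open Scope ring_scope.
Local Notation ell := (len S).
Local Notation H := (Hk (gT := gT)).
Local Notation V := {ffun X -> laurent}.
Variable rho : gT -> V -> V.
Hypothesis rho_lin : forall s, s \in S -> semilin id (rho s).
Hypothesis rho_quad : forall s m, s \in S -> rho s (rho s m) = m + fsc qL (rho s m).
Hypothesis rho_braid : forall s t, s \in S -> t \in S -> forall m,
  altop (rho s) (rho t) #[s * t]%g m = altop (rho t) (rho s) #[s * t]%g m.
Local Notation opX := (opW S S rho).

Lemma opw_lin k w : semilin id (opw S S rho k w).
Proof.
elim: k w => [//|k IH] w c m m' /=.
by case: pickP => [s /andP [sS _]|_ //]; rewrite IH rho_lin.
Qed.

Lemma opX_lin w : semilin id (opX w). Proof. exact: opw_lin. Qed.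

Definition hact (h : H) (m : V) : V := linear_lift (fun w => opX w m) h.

Lemma hact_linh c h h' m : hact (fsc c h + h') m = fsc c (hact h m) + hact h' m.
Proof. exact: linear_lift_lin. Qed.

Lemma hact_linm h : semilin id (hact h).
Proof.
move=> c m m'; rewrite /hact /linear_lift /sl_lift fsc_sum -big_split /=.
by apply: eq_bigr => w _; rewrite opX_lin fscDr !fscA mulrC.
Qed.

Lemma hact_fb w m : hact (Hb w) m = opX w m.
Proof. by rewrite Hb_fb; apply: linear_lift_fb. Qed.

Lemma hact1 m : hact Hone m = m.
Proof. by rewrite hact_fb opW1. Qed.

Lemma hact_gen s m : s \in S -> hact (Hb s) m = rho s m.
Proof. by move=> sS; rewrite hact_fb (opW_gen cox nP). Qed.

(** If [s] is a descent of [w], this is the quadratic relation applied after [w = s (s w)];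
    otherwise it is [opW_mull]. Together with [hact_Happ] it yields the action law. *)
Lemma hact_Lgen s b m : s \in S -> hact (Lgen S s b) m = rho s (hact b m).
Proof.
move=> sS; move: b; apply: (@sl_ext _ _ id) => //.
- by move=> c b b'; rewrite (Lgen_lin S s) hact_linh.
- by move=> c b b'; rewrite hact_linh (rho_lin sS).
move=> w; rewrite (Lgen_fb cox nP) // -!Hb_fb hact_fb; case: ifP => nw; last first.
  by rewrite hact_fb (opW_mull cox nP (subxx S)) // (in_genS cox).
have wG := in_genS cox w.
rewrite addrC hact_linh !hact_fb (opW_desc cox nP (subxx S) rho_braid m sS wG nw).
by rewrite rho_quad // addrC.
Qed.

Lemma hact_Happ k w b m : hact (Happ S k w b) m = opw S S rho k w (hact b m).
Proof.
elim: k w => [//|k IH] w /=.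
by case: pickP => [s /andP [sS _]|_ //]; rewrite hact_Lgen // IH.
Qed.

Lemma hact_mul h h' m : hact (Hmul S h h') m = hact h (hact h' m).
Proof.
rewrite /Hmul; set F := fun w : gT => hsc (h w) (Happ S (ell w) w h').
have hD b b' : hact (b + b') m = hact b m + hact b' m.
  by have := hact_linh 1 b b' m; rewrite !fsc1.
have h0 : hact 0 m = 0 by rewrite /hact /linear_lift /sl_lift big1 // => w _; rewrite ffunE fsc0l.
rewrite (big_morph (hact^~ m) hD h0) {3}/hact /linear_lift /sl_lift.
apply: eq_bigr => w _; rewrite /F hsc_fsc.
by have := hact_linh (h w) (Happ S (ell w) w h') 0 m; rewrite !addr0 h0 addr0 hact_Happ.
Qed.

End HeckeAction.

(** * Inverses of the standard basis and the action of the bar involution *)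

Section HeckeInverse.
Variables (gT : finGroupType) (S : {set gT}) (n : gT -> gT -> bool).
Hypothesis cox : coxeter_system S.
Hypothesis nP : inversion_cocycle S n.
Local Open Scope ring_scope.
Local Notation ell := (len S).
Local Notation H := (Hk (gT := gT)).

Let Llin s (_ : s \in S) := Lgen_lin S s.
Let Lquad s b (sS : s \in S) := Lgen_quad cox nP b sS.
Let Lbraid s t (sS : s \in S) (tS : t \in S) := braidL cox nP sS tS.

Lemma Hmul_hact a b : Hmul S a b = hact S (Lgen S) a b.
Proof. by apply: eq_bigr => w _; rewrite hsc_fsc. Qed.

(** [Hmul] is the action [hact] of the algebra on itself through [Lgen], so associativity is an
    instance of [hact_mul]. *)
Lemma HmulA a b c : Hmul S (Hmul S a b) c = Hmul S a (Hmul S b c).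
Proof. by rewrite ![Hmul S _ c]Hmul_hact (hact_mul cox nP Llin Lquad Lbraid) Hmul_hact. Qed.

Lemma Hmul1l b : Hmul S Hone b = b.
Proof. by rewrite Hmul_hact hact1. Qed.

Lemma Hmul_gen s b : s \in S -> Hmul S (Hb s) b = Lgen S s b.
Proof. by move=> sS; rewrite Hmul_hact (hact_gen cox nP Lbraid). Qed.

Lemma Hmul_gen_fb s w : s \in S -> n w s = false -> Hmul S (Hb s) (Hb w) = Hb (s * w)%g.
Proof. by move=> sS nw; rewrite Hmul_gen // !Hb_fb (Lgen_fb cox nP) // nw. Qed.

Lemma Hb_ind (P : gT -> Prop) : P 1%g ->
  (forall s w, s \in S -> n w s = false -> P w -> P (s * w)%g) -> forall w, P w.
Proof.
move=> P1 PS w; have [k] := ubnP (ell w); elim: k w => // k IH w wk.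
have [->//|w1] := eqVneq w 1%g.
case: (desc_exists cox nP (subxx S) (in_genS cox w) w1) => s sS ns.
rewrite -[w](mulSK cox _ sS); apply: PS => //; first by rewrite (n_mulss nP) // ns.
apply: IH; apply: (@leq_trans (ell w)); last by rewrite -ltnS.
by rewrite -(n_desc cox nP).
Qed.

Lemma Hmul_linl c a a' b : Hmul S (fsc c a + a') b = fsc c (Hmul S a b) + Hmul S a' b.
Proof. by rewrite !Hmul_hact hact_linh. Qed.

Lemma Lgen_invl s b : s \in S -> Lgen S s b - fsc qL b = 
  Hmul S (fsc (- qL) Hone + Hb s) b.
Proof.
by move=> sS; rewrite Hmul_linl Hmul1l Hmul_gen // fscN addrC.
Qed.

Lemma Hb_invertible w : exists h, Hmul S h (Hb w) = Hone /\ Hmul S (Hb w) h = Hone.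
Proof.
move: w; apply: Hb_ind => [|s w sS nw [h [h1 h2]]].
  by exists Hone; rewrite Hmul1l.
(* [H_s^2 = 1 + q H_s] makes [H_s - q] the inverse of [H_s]. *)
pose hs : H := fsc (- qL) Hone + Hb s.
have hsl b : Hmul S hs (Lgen S s b) = b.
  by rewrite -Lgen_invl // (Lquad _ sS) addrK.
exists (Hmul S h hs); rewrite -Hmul_gen_fb //; split.
  by rewrite HmulA (Hmul_gen _ sS) hsl.
rewrite HmulA -(HmulA _ h) h2 Hmul1l Hmul_gen //.
have -> : hs = Hmul S hs Hone.
  by rewrite /hs Hmul_linl Hmul1l Hmul_gen // /Hone !Hb_fb (Lgen_fb cox nP) // (n1 nP) mulg1.
rewrite -Lgen_invl // (sl_add _ (Lgen_lin S s)) // -fscN (sl_scale _ (Lgen_lin S s)) //.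
by rewrite (Lquad _ sS) fscN addrK.
Qed.

Lemma HinvP w : Hmul S (Hinv S w) (Hb w) = Hone /\ Hmul S (Hb w) (Hinv S w) = Hone.
Proof. exact: (epsilon_spec (inhabits Hone) _ (Hb_invertible w)). Qed.

Variables (X : finType).
Local Notation V := {ffun X -> laurent}.
Variable rho : gT -> V -> V.
Hypothesis rho_lin : forall s, s \in S -> semilin id (rho s).
Hypothesis rho_quad : forall s m, s \in S -> rho s (rho s m) = m + fsc qL (rho s m).
Hypothesis rho_braid : forall s t, s \in S -> t \in S -> forall m,
  altop (rho s) (rho t) #[s * t]%g m = altop (rho t) (rho s) #[s * t]%g m.
Local Notation opX := (opW S S rho).
Local Notation hactX := (hact S rho).

(** The inverse of [rho s], which is how [bar H_s = H_s - q] acts. *)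
Definition rhoI (s : gT) (m : V) : V := rho s m - fsc qL m.

Lemma rhoI_lin s : s \in S -> semilin id (rhoI s).
Proof.
move=> sS c m m'; rewrite /rhoI (rho_lin sS) !fscDr opprD addrACA -fscNr.
by congr (_ + _ + _); rewrite !fscNr !fscA mulrC.
Qed.

Lemma rhoIK s m : s \in S -> rhoI s (rho s m) = m.
Proof. by move=> sS; rewrite /rhoI rho_quad // addrK. Qed.

Lemma rhoKI s m : s \in S -> rho s (rhoI s m) = m.
Proof.
move=> sS; rewrite /rhoI (sl_add _ (rho_lin sS)) // (sl_opp _ (rho_lin sS)) //.
by rewrite (sl_scale _ (rho_lin sS)) // rho_quad // addrK.
Qed.

Lemma rhoI_quad s m : s \in S -> rhoI s (rhoI s m) = m - fsc qL (rhoI s m).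
Proof. by move=> sS; rewrite {1}/rhoI rhoKI. Qed.

(** The action of [bar H_w]. Its properties are read off from those of [opW], since it inverts
    [opX w^-1]; the chosen value [Hinv] is never computed. *)
Definition barX (w : gT) (m : V) : V := hactX (Hinv S w^-1%g) m.

Lemma opX_barX w m : opX w^-1%g (barX w m) = m.
Proof.
rewrite /barX -(hact_fb S rho) -(hact_mul cox nP) //.
by case: (HinvP w^-1%g) => _ ->; rewrite hact1.
Qed.

Lemma barX_opX w m : barX w (opX w^-1%g m) = m.
Proof.
rewrite /barX -(hact_fb S rho) -(hact_mul cox nP) //.
by case: (HinvP w^-1%g) => -> _; rewrite hact1.
Qed.

Lemma barX_lin w : semilin id (barX w).
Proof. exact: hact_linm. Qed.

Lemma barX1 m : barX 1%g m = m.
Proof. by have := opX_barX 1%g m; rewrite invg1 opW1. Qed.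

Lemma barX_mul u v m : ell (u * v)%g = (ell u + ell v)%N ->
  barX (u * v)%g m = barX u (barX v m).
Proof.
move=> e; rewrite -{1}(opX_barX v m) -{1}(opX_barX u (barX v m)).
rewrite -(opW_mul cox nP (subxx S)) ?(in_genS cox) //.
  by rewrite -invMg barX_opX.
by rewrite -invMg !(ell_inv cox) e addnC.
Qed.

Lemma barX_gen s m : s \in S -> barX s m = rhoI s m.
Proof.
move=> sS; have := opX_barX s m; rewrite (invS cox sS) (opW_gen cox nP) // => e.
by rewrite -[in RHS]e rhoIK.
Qed.

Lemma barX_mull s w m : s \in S -> n w s = false ->
  barX (s * w)%g m = rhoI s (barX w m).
Proof.
move=> sS nw; rewrite barX_mul; first by rewrite (barX_gen _ sS).
by rewrite (ell_mull cox nP) // nw (ell_gen cox nP sS) add1n.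
Qed.

Lemma barX_mulr s w m : s \in S -> n w^-1%g s = false ->
  barX (w * s)%g m = barX w (rhoI s m).
Proof.
move=> sS nw; rewrite barX_mul; first by rewrite (barX_gen _ sS).
by rewrite (ell_mulr cox nP) // nw (ell_gen cox nP sS) addn1.
Qed.

Lemma hact_barH h m : hactX (barH S h) m = sl_lift lbar (fun w => barX w m) h.
Proof.
have hl : semilin id (fun b : H => hactX b m).
  by move=> c b b'; apply: hact_linh.
rewrite /barH (sl_sum _ hl) //; apply: eq_bigr => w _.
by rewrite hsc_fsc (sl_scale _ hl).
Qed.

End HeckeInverse.

(** * Perfect involutions *)

Section PerfectInvolutions.
Variables (gT : finGroupType) (S J : {set gT}) (n : gT -> gT -> bool).
Hypothesis cox : coxeter_system S.
Hypothesis nP : inversion_cocycle S n.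
Hypothesis JS : J \subset S.
Local Open Scope group_scope.
Local Notation ell := (len S).
Implicit Types (z : ext gT) (r s t u v w g q : gT).

Lemma JinS s : s \in J -> s \in S. Proof. exact: (subsetP JS). Qed.
Lemma JinG s : s \in J -> s \in <<J>>. Proof. exact: mem_gen. Qed.

(* [z r z^-1], computed in [W_J^+] *)
Definition zr z r : gT := z.1 * z.2 r * z.1^-1.

Lemma zrE z r : zr z r = (z.2 r) ^ z.1^-1.
Proof. by rewrite conjgE invgK mulgA. Qed.

Lemma TJ_mulrr r : r \in TJ J -> r * r = 1.
Proof. by move/(TJ_T cox JS)/(T_mulrr cox). Qed.

Lemma TJ_inv r : r \in TJ J -> r^-1 = r.
Proof. by move/(TJ_T cox JS)/(T_inv cox). Qed.

Lemma emul_refl z r : emul (emul (einj r) z) (einj r) = (r * z.1 * z.2 r, z.2).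
Proof. by rewrite /emul /= perm1 mulg1 mul1g. Qed.

(** Since [z^2 = 1], [(z r)^2 = (z r z^-1) r] lies in [W_J], and the fourth power is a square there.
    The hypotheses are spelled out because [vconj_IJ] applies this to an element not yet known to be
    in [IJ J]. *)
Lemma emul_four z r :
  {in <<J>> &, forall a b, z.2 (a * b) = z.2 a * z.2 b} ->
  {in <<J>>, forall a, z.2 a \in <<J>>} -> z.2 * z.2 = 1 ->
  z.1 \in <<J>> -> z.2 z.1 = z.1^-1 -> r \in <<J>> ->
  let u := emul z (einj r) in
  emul u (emul u (emul u u)) = (zr z r * r * (zr z r * r), 1).
Proof.
move=> thM thG tt yG yV rG u.
have ttK a : z.2 (z.2 a) = a by rewrite -permM tt perm1.
have eu : u = (z.1 * z.2 r, z.2) by rewrite /u /emul /= mul1g.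
have tu : z.2 (z.1 * z.2 r) = z.1^-1 * r by rewrite thM ?thG // yV ttK.
have uG : z.1 * z.2 r \in <<J>> by rewrite groupM // thG.
have e2 : emul u u = (zr z r * r, 1) by rewrite eu /emul /= tu tt mulgA.
have xG : zr z r * r \in <<J>> by rewrite /zr !groupM ?groupV ?thG.
rewrite e2 {2}eu {2}/emul /= mul1g eu /emul /= tt.
by rewrite (thM _ _ uG (thG _ xG)) tu ttK !mulgA.
Qed.

Section OneElement.
Variable z : ext gT.
Hypothesis zI : z \in IJ J.

Let zI' : in_ext (WJ J) J z /\ perfect (TJ J) z.
Proof. by move: zI; rewrite inE => /andP. Qed.

Lemma IJ_1 : z.1 \in <<J>>. Proof. by case: zI' => /and3P []. Qed.
Lemma IJ_Aut : z.2 \in Aut <<J>>. Proof. by case: zI' => /and3P []. Qed.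

Let zz : emul z z = eone gT.
Proof. by case: zI' => _ /andP [/eqP]. Qed.

Lemma IJ_ttK a : z.2 (z.2 a) = a.
Proof.
have : z.2 * z.2 = 1 by have := zz; case.
by move/permP => /(_ a); rewrite permM perm1.
Qed.

Lemma IJ_mulV : z.2 z.1 = z.1^-1.
Proof.
have : z.1 * z.2 z.1 = 1 by have := zz; case.
by move/eqP; rewrite -eq_invg_mul => /eqP ->.
Qed.

Lemma IJ_morph : {in <<J>> &, forall a b, z.2 (a * b) = z.2 a * z.2 b}.
Proof. by move=> a b aJ bJ; apply: (morphicP (Aut_morphic IJ_Aut)). Qed.

Lemma IJ_in a : a \in <<J>> -> z.2 a \in <<J>>.
Proof. by move=> aJ; apply: (@Aut_closed _ <<J>>%G _ IJ_Aut). Qed.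

Lemma IJ_J s : s \in J -> z.2 s \in J.
Proof.
by case: zI' => /and3P [_ _ /eqP e] _ sJ; rewrite -e imset_f.
Qed.

Lemma IJ_t1 : z.2 1 = 1.
Proof. by apply: (@mulgI _ (z.2 1)); rewrite -IJ_morph ?group1 // !mulg1. Qed.

Lemma IJ_tV a : a \in <<J>> -> z.2 a^-1 = (z.2 a)^-1.
Proof.
by move=> aJ; apply/eqP; rewrite eq_sym eq_invg_mul -IJ_morph ?groupV // mulgV IJ_t1.
Qed.

Lemma IJ_tJ a b : a \in <<J>> -> b \in <<J>> -> z.2 (a ^ b) = z.2 a ^ z.2 b.
Proof. by move=> aJ bJ; rewrite !conjgE !IJ_morph ?IJ_tV ?groupM ?groupV. Qed.

Lemma IJ_tTJ r : r \in TJ J -> z.2 r \in TJ J.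
Proof.
by case/TJP=> w [s [wJ sJ ->]]; rewrite (IJ_tJ (JinG sJ) wJ) TJ_conj ?IJ_in // TJ_gen // IJ_J.
Qed.

Lemma zr_in a : a \in <<J>> -> zr z a \in <<J>>.
Proof. by move=> aJ; rewrite zrE groupJ ?groupV ?IJ_1 // IJ_in. Qed.

Lemma zrM a b : a \in <<J>> -> b \in <<J>> -> zr z (a * b) = zr z a * zr z b.
Proof. by move=> aJ bJ; rewrite !zrE IJ_morph // conjMg. Qed.

Lemma zrK a : a \in <<J>> -> zr z (zr z a) = a.
Proof.
move=> aJ; rewrite !zrE IJ_tJ ?groupV ?IJ_1 ?IJ_in // IJ_tV ?IJ_1 // IJ_mulV invgK.
by rewrite IJ_ttK conjgK.
Qed.

Lemma zrV a : a \in <<J>> -> zr z a^-1 = (zr z a)^-1.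
Proof. by move=> aJ; rewrite !zrE IJ_tV // conjVg. Qed.

Lemma zrJ a b : a \in <<J>> -> b \in <<J>> -> zr z (a ^ b) = zr z a ^ zr z b.
Proof. by move=> aJ bJ; rewrite !conjgE !zrM ?zrV ?groupM ?groupV. Qed.

Lemma zrTJ r : r \in TJ J -> zr z r \in TJ J.
Proof. by move=> rJ; rewrite zrE TJ_conj ?groupV ?IJ_1 // IJ_tTJ. Qed.

(** A product of two involutions whose square is 1 makes them commute; perfection is used in this
    form from here on. *)
Lemma zr_commute r : r \in TJ J -> r * zr z r = zr z r * r.
Proof.
move=> rJ; case: zI' => _ /andP [_ /forall_inP /(_ r rJ) /eqP].
rewrite emul_four ?IJ_1 ?IJ_mulV ?TJ_sub //; last 3 first.
- exact: IJ_morph.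
- exact: IJ_in.
- by have := zz; case.
case=> e2.
have rT := zrTJ rJ; apply: esym.
by have := e2; move/eqP; rewrite -eq_invg_mul invMg !TJ_inv // => /eqP <-.
Qed.

Lemma zr_conj r : r \in TJ J -> zr z r ^ r = zr z r.
Proof. by move=> rJ; rewrite conjgE -(zr_commute rJ) mulKg. Qed.

Lemma conj_zr r : r \in TJ J -> r ^ zr z r = r.
Proof. by move=> rJ; rewrite conjgE (zr_commute rJ) mulKg. Qed.

Lemma n_theta w r : w \in <<J>> -> r \in <<J>> -> n (z.2 w) (z.2 r) = n w r.
Proof.
move=> wJ; move: w wJ r; apply: gen_ind => [r _|s w sJ wJ IH r rJ].
  by rewrite IJ_t1 !(n1 nP).
rewrite (IJ_morph (JinG sJ) wJ) !(n_mul nP).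
rewrite (n_gen nP _ (JinS sJ)) (n_gen nP _ (JinS (IJ_J sJ))).
by rewrite -(IJ_tJ rJ (JinG sJ)) IH ?groupJ ?(JinG sJ) // (inj_eq perm_inj).
Qed.

(** [th(y) = y^-1] and [th] preserves inversions, so [N(y)] is stable under conjugation by [z]. *)
Lemma D_zr r : r \in <<J>> -> n z.1 (zr z r) = n z.1 r.
Proof.
by move=> rJ; rewrite zrE -(n_inv nP) -IJ_mulV n_theta ?IJ_1.
Qed.

Lemma vconj_refl r : r \in TJ J -> vconj r z = (r * zr z r * z.1, z.2).
Proof.
move=> rJ; rewrite /vconj -IJ_tV ?TJ_sub // TJ_inv //; congr (_, _).
by rewrite /zr !mulgA mulgKV.
Qed.

Lemma vconj_emul r : r \in TJ J -> emul (emul (einj r) z) (einj r) = vconj r z.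
Proof.
move=> rJ; rewrite emul_refl vconj_refl //; congr (_, _).
by rewrite /zr !mulgA mulgKV.
Qed.

Lemma vconj_fix r : r \in TJ J -> (vconj r z == z) = (zr z r == r).
Proof.
move=> rJ; rewrite vconj_refl // [X in _ == X]surjective_pairing xpair_eqE.
rewrite eqxx andbT -[X in _ == X]mul1g (inj_eq (mulIg _)).
by rewrite -eq_invg_mul TJ_inv // eq_sym.
Qed.

Lemma vconj_zr r : r \in TJ J -> vconj (zr z r) z = vconj r z.
Proof.
by move=> rJ; rewrite !vconj_refl ?zrTJ // zrK ?TJ_sub // zr_commute.
Qed.

Lemma n_up w r : r \in TJ J -> n w r = false -> (ell w < ell (r * w))%N.
Proof.
move=> rJ nw; have rT := TJ_T cox JS rJ.
have : n (r * w) r by rewrite (n_mul nP) (n_refl cox nP) // conjgE mulKg nw.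
by move/(n_lt cox nP); rewrite mulgA (T_mulrr cox) // mul1g.
Qed.

(** [y] is multiplied by [z r z] and then by [r]. By [D_zr] neither is an inversion of [y], and as
    they commute, the first step does not turn [r] into one; so the length rises twice. *)
Lemma vconj_up r : r \in TJ J -> zr z r != r -> n z.1 r = false ->
  ((ell z.1).+1 < ell (vconj r z).1)%N.
Proof.
move=> rJ ne nr; rewrite vconj_refl //= -mulgA.
have rG := TJ_sub rJ; have r'J := zrTJ rJ.
have h1 : (ell z.1 < ell (zr z r * z.1))%N by apply: n_up; rewrite // D_zr.
apply: leq_ltn_trans h1 _; apply: n_up => //.
rewrite (n_mul nP) conj_zr // nr (n_commute cox nP) ?(TJ_T cox JS) //.
  by rewrite eq_sym.
exact: conj_zr.
Qed.

Lemma vconj_down r : r \in TJ J -> zr z r != r -> n z.1 r ->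
  ((ell (vconj r z).1).+1 < ell z.1)%N.
Proof.
move=> rJ ne nr; rewrite vconj_refl //= -mulgA.
have rG := TJ_sub rJ; have r'J := zrTJ rJ.
have h1 : (ell (zr z r * z.1) < ell z.1)%N by apply: (n_lt cox nP); rewrite D_zr.
apply: leq_trans h1; rewrite ltnS; apply: (n_lt cox nP).
rewrite (n_mul nP) conj_zr // nr (n_commute cox nP) ?(TJ_T cox JS) //.
  by rewrite eq_sym.
exact: conj_zr.
Qed.

(** The cocycle expansion of [g y th(g)^-1], with the last term carried back by [th] so that it
    involves [g^-1] and conjugation by [z]. Later comparisons of inversion sets within a class rest
    on this formula. *)
Lemma D_vconj g r : g \in <<J>> -> r \in <<J>> ->
  n (vconj g z).1 r = n g r (+) (n z.1 (r ^ g) (+) n g^-1 (zr z (r ^ g))).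
Proof.
move=> gJ rJ; rewrite /vconj /= -mulgA !(n_mul nP) -IJ_tV //; congr (_ (+) (_ (+) _)).
have qJ : r ^ g \in <<J>> by rewrite groupJ.
rewrite -[RHS]n_theta ?groupV ?zr_in // zrE IJ_tJ ?groupV ?IJ_1 ?IJ_in //.
by rewrite (IJ_tV IJ_1) IJ_mulV invgK IJ_ttK.
Qed.

Lemma vconj_1 g : g \in <<J>> -> (vconj g z).1 \in <<J>>.
Proof. by move=> gJ; rewrite /= !groupM ?groupV ?IJ_in ?IJ_1. Qed.

Lemma zr_vconj g r : g \in <<J>> -> r \in <<J>> ->
  zr (vconj g z) r = zr z (r ^ g) ^ g^-1.
Proof.
move=> gJ rJ; rewrite !zrE /= IJ_tJ // -!conjgM; congr (_ ^ _).
by rewrite !invMg invgK mulgA.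
Qed.

Lemma vconj_mulV g : g \in <<J>> -> z.2 (vconj g z).1 = (vconj g z).1^-1.
Proof.
move=> gJ; rewrite /= !IJ_morph ?groupM ?groupV ?IJ_in ?IJ_1 //.
by rewrite (IJ_tV (IJ_in gJ)) IJ_ttK IJ_mulV !invMg invgK mulgA.
Qed.

Lemma vconj_IJ g : g \in <<J>> -> vconj g z \in IJ J.
Proof.
move=> gJ; have tt : z.2 * z.2 = 1 by have := zz; case.
rewrite inE; apply/andP; split.
  case: zI' => /and3P [_ a b] _; apply/and3P; split=> //.
  exact: vconj_1.
apply/andP; split.
  by rewrite /emul -[(vconj g z).2]/(z.2) vconj_mulV // mulgV tt.
apply/forall_inP => r rJ /=; have rG := TJ_sub rJ.
rewrite (@emul_four (vconj g z)) ?vconj_1 ?vconj_mulV //; last 2 first.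
- exact: IJ_morph.
- exact: IJ_in.
rewrite zr_vconj // /eone xpair_eqE eqxx andbT.
have rgJ : r ^ g \in TJ J by rewrite TJ_conj.
have -> : zr z (r ^ g) ^ g^-1 * r = (zr z (r ^ g) * r ^ g) ^ g^-1.
  by rewrite [in RHS]conjMg conjgK.
have aa := TJ_mulrr (zrTJ rgJ); have bb := TJ_mulrr rgJ; have ab := zr_commute rgJ.
move: (zr z (r ^ g)) (r ^ g) aa bb ab => a b aa bb ab.
rewrite -conjMg -{1}ab.
by rewrite mulgA -(mulgA b) aa mulg1 bb conj1g.
Qed.

End OneElement.

Lemma vconj1 z : z \in IJ J -> vconj 1 z = z.
Proof. by move=> zI; rewrite /vconj (IJ_t1 zI) invg1 mul1g mulg1; case: z zI. Qed.

Lemma vconjM u v z : z \in IJ J -> u \in <<J>> -> v \in <<J>> ->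
  vconj (u * v) z = vconj u (vconj v z).
Proof.
by move=> zI uJ vJ; rewrite /vconj /= (IJ_morph zI) // invMg !mulgA.
Qed.

Lemma vconjK r z : z \in IJ J -> r \in TJ J -> vconj r (vconj r z) = z.
Proof.
by move=> zI rJ; rewrite -vconjM ?TJ_sub // TJ_mulrr // vconj1.
Qed.

End PerfectInvolutions.

(** * The module of perfect involutions *)

Section DihedralCenter.
Variables (gT : finGroupType) (S : {set gT}) (n : gT -> gT -> bool).
Hypothesis cox : coxeter_system S.
Hypothesis nP : inversion_cocycle S n.
Variables s t : gT.
Hypotheses (sS : s \in S) (tS : t \in S).
Local Open Scope group_scope.
Local Notation I := [set s; t].
Implicit Types (r q g c b : gT).

Lemma pair_sub : I \subset S.
Proof. by apply/subsetP => b; rewrite !inE => /orP [] /eqP ->. Qed.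

Lemma pairP b : b \in I -> b = s \/ b = t.
Proof. by rewrite !inE => /orP [] /eqP; auto. Qed.

(** Induction on the conjugating element; the step for the letter [t] is
    [q^t s = (t s) (s q) (t s)]. *)
Lemma pair_rotation q : q \in TJ I -> q * s \in <[s * t]>.
Proof.
have ts : t * s \in <[s * t]>.
  by rewrite -groupV invMg !(invS cox) // cycle_id.
case/TJP=> g [b [gI bI ->]]; move: g gI.
apply: gen_indr => [|c g cI gI IH].
  by rewrite conjg1; case: (pairP bI) => -> //; rewrite (mulSS cox).
rewrite conjgM; set q' := b ^ g in IH *.
have q'V : q'^-1 = q'.
  by rewrite (T_inv cox) // (TJ_T cox pair_sub) // TJ_conj // TJ_gen.
have sq : s * q' \in <[s * t]>.
  by rewrite -groupV invMg (invS cox sS) q'V.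
rewrite conjgE; case: (pairP cI) => ->; first by rewrite (invS cox sS) -!mulgA (mulSS cox) // mulg1.
rewrite (invS cox tS) (_ : _ * s = t * s * (s * q') * (t * s)).
  by rewrite (groupM (groupM ts sq) ts).
by rewrite !mulgA (mulKS cox).
Qed.

(** [c = r r'] is a rotation with [c^2 = 1]; as [s] inverts rotations, [c] is central. Then [N(c)]
    is stable under conjugation and contains both letters, so [c] is the longest element, and its
    order 2 divides the order [m] of [s t]. *)
Lemma dihedral_center r r' : r \in TJ I -> r' \in TJ I -> r != r' ->
  r * r' = r' * r ->
  [/\ r * r' = altw s t #[s * t], {in <<I>>, forall g, g * (r * r') = r * r' * g},
      {in TJ I, forall q, n (r * r') q} & ~~ odd #[s * t]].
Proof.
move=> rI r'I ne rr; set c := r * r'.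
have IS := pair_sub; have rT := TJ_T cox IS rI; have r'T := TJ_T cox IS r'I.
have cc : c * c = 1.
  by rewrite {2}/c rr /c mulgA -(mulgA r) (T_mulrr cox) // mulg1 (T_mulrr cox).
have cV : c^-1 = c by apply/eqP; rewrite eq_invg_mul cc.
have cp : c \in <[s * t]>.
  have -> : c = r * s * (r' * s)^-1.
    by rewrite invMg (invS cox sS) (T_inv cox r'T) mulgA (mulKS cox).
  by rewrite groupM ?groupV ?pair_rotation.
have cI : c \in <<I>> by rewrite groupM // TJ_sub.
have /cycleP [k ck] := cp.
have cs : s * c = c * s.
  have ps : (s * t) ^ s = (s * t)^-1.
    by rewrite conjgE !invMg !(invS cox) // -mulgA (mulSK cox).
  have : c ^ s = c by rewrite -[RHS]cV ck conjXg ps expgVn.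
  by rewrite conjgE => e; rewrite -[c in LHS]e mulKVg.
have ct : t * c = c * t.
  have pc : (s * t) * c = c * (s * t) by rewrite ck -expgS -expgSr.
  have -> : t = s * (s * t) by rewrite (mulSK cox).
  by rewrite -mulgA pc mulgA cs -mulgA.
have cent : {in <<I>>, forall g, g * c = c * g}.
  move=> g; move: g; apply: gen_ind; first by rewrite mul1g mulg1.
  move=> b g bI gI IH; rewrite -(mulgA b g c) IH (mulgA b c g) (mulgA c b g).
  by congr (_ * _); case: (pairP bI) => ->.
have ncr : n c r.
  rewrite (n_mul nP) (n_refl cox nP) // conjgE mulKg.
  by rewrite (n_commute cox nP) // conjgE rr mulKg.
have nconj g q : g \in <<I>> -> q \in <<I>> -> n c (q ^ g) = n c q.
  move=> gI qI; have qc : q ^ c = q by rewrite conjgE cent // mulKg.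
  have := n_mul nP g c q; rewrite cent // (n_mul nP) qc.
  by case: (n c q); case: (n g q); case: (n c _).
have c1 : c != 1 by apply: contraTneq ncr => ->; rewrite (n1 nP).
(* One descent [b] of [c] yields another: [b * c] is not 1, so it has a descent other than [b],
   which centrality of [c] carries over to [c]. *)
have step b : b \in I -> n c b -> exists b', [/\ b' \in I, b' != b & n c b'].
  move=> bI nb; have bS := subsetP IS b bI.
  have bc1 : b * c != 1.
    apply/eqP => e; have cb : c = b by rewrite -(mulSK cox c bS) e mulg1.
    have rb : r = b by move: ncr; rewrite cb (n_gen nP) // => /eqP.
    have r1 : r' = 1 by apply: (@mulgI _ r); rewrite -/c cb rb mulg1.
    by have := n_refl cox nP r'T; rewrite r1 (n1 nP).
  have bcI : b * c \in <<I>> by rewrite groupM // mem_gen.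
  have [b' b'I nb'] := desc_exists cox nP IS bcI bc1.
  have ne' : b' != b.
    by apply: contraTneq nb' => ->; rewrite (n_mulss nP) // nb.
  exists b'; split=> //; rewrite -(@nconj b b') ?mem_gen //.
  rewrite -[c in n c](mulSK cox c bS) (n_mul nP) (n_gen nP) // -conjgM (mulSS cox) // conjg1 nb'.
  rewrite (_ : (b' ^ b == b) = false) //; apply: contraNF ne' => /eqP e.
  by rewrite -(inj_eq (@conjg_inj _ b)) e conjgE mulKg.
have nb : {in I, forall b, n c b}.
  have [b bI nb] := desc_exists cox nP IS cI c1.
  have [b' [b'I ne' nb']] := step b bI nb.
  move=> a aI; case: (pairP aI) (pairP bI) (pairP b'I) => [->|->] [eb|eb] [eb'|eb'];
    by rewrite -?eb -?eb' // ?eb ?eb' ?eqxx in ne' nb nb' *.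
have nq : {in TJ I, forall q, n c q}.
  by move=> q /TJP [g [b [gI bI ->]]]; rewrite (nconj _ _ gI (mem_gen bI)) nb.
have sI : s \in I by rewrite !inE eqxx.
have tI : t \in I by rewrite !inE eqxx orbT.
split=> //.
  by case: (dihedral_longest cox nP IS sI tI pairP cI (nb s sI) (nb t tI)).
have o2 : #[c] = 2%N by apply: nt_prime_order.
have : #[c] %| #|<[s * t]>| by apply: order_dvdG.
by rewrite o2 -orderE dvdn2.
Qed.

End DihedralCenter.

(** With even length both products contain [j] copies of each operator, so commuting on an invariant
    [W] suffices. *)
Lemma altop_commute (V : Type) (W : V -> Prop) (f g : V -> V) j v :
  (forall v, W v -> W (f v)) -> (forall v, W v -> W (g v)) ->
  (forall v, W v -> f (g v) = g (f v)) -> W v ->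
  altop f g j.*2 v = altop g f j.*2 v.
Proof.
move=> Wf Wg fg Wv.
suff : altop f g j.*2 v = altop g f j.*2 v /\ W (altop f g j.*2 v) by case.
elim: j => [//|j [IH1 IH2]]; rewrite doubleS /= -IH1 fg //; split=> //.
by apply/Wg/Wf.
Qed.

Lemma altop_same (V : Type) (W : V -> Prop) (f g : V -> V) k v :
  (forall v, W v -> W (f v)) -> (forall v, W v -> f v = g v) -> W v ->
  altop f g k v = altop g f k v.
Proof.
move=> Wf fg Wv.
suff H k' : altop f g k' v = iter k' f v /\ altop g f k' v = iter k' f v.
  by case: (H k) => -> ->.
have Wi i : W (iter i f v) by elim: i => //= i IH; apply: Wf.
by elim: k' => //= k' [-> ->]; rewrite fg.
Qed.

Section InvolutionModule.
Variables (gT : finGroupType) (S J : {set gT}) (n : gT -> gT -> bool).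
Variable sigma : gT -> int.
Hypothesis cox : coxeter_system S.
Hypothesis nP : inversion_cocycle S n.
Hypothesis JS : J \subset S.
Hypothesis sigM : {in WJ J &, forall u v, sigma (u * v)%g = (sigma u * sigma v)%R}.
Hypothesis sigU : {in WJ J, forall u, sigma u = 1%R \/ sigma u = (-1)%R}.
Local Open Scope group_scope.
Local Notation ell := (len S).
Implicit Types (r s t u v w g q b : gT).

Definition sg r : laurent := if sigma r == (-1)%R then (- xLinv)%R else xL.

Lemma sg_eigen r : hecke_eigen (sg r).
Proof. by rewrite /sg; case: ifP => _; [right|left]. Qed.

Lemma sigma1 : sigma 1 = 1%R.
Proof.
have G1 : 1 \in WJ J by apply: group1.
by have := sigM G1 G1; rewrite mulg1; case: (sigU G1) => ->.
Qed.

Lemma sigma_conj r g : r \in <<J>> -> g \in <<J>> -> sigma (r ^ g) = sigma r.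
Proof.
move=> rJ gJ; have gV : g^-1 \in <<J>> by rewrite groupV.
rewrite conjgE !sigM ?(groupM rJ gJ) // mulrCA.
by rewrite -sigM // mulVg sigma1 mulr1.
Qed.

Lemma sg_conj r g : r \in <<J>> -> g \in <<J>> -> sg (r ^ g) = sg r.
Proof. by move=> rJ gJ; rewrite /sg sigma_conj. Qed.

Definition ZT : finType := {z : ext gT | z \in IJ J}.
Definition stN v (x : ZT) : ZT := insubd x (vconj v (val x)).
Definition hN (x : ZT) : nat := ell (val x).1.
Definition rhoN s := gop (stN s) hN (fun=> sg s).

Lemma valZ (x : ZT) : val x \in IJ J. Proof. exact: (valP x). Qed.

Lemma val_stN v x : v \in <<J>> -> val (stN v x) = vconj v (val x).
Proof.
by move=> vJ; rewrite val_insubd (vconj_IJ cox JS (valZ x)).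
Qed.

Lemma stN1 x : stN 1 x = x.
Proof. by apply: val_inj; rewrite val_stN ?group1 // (vconj1 (valZ x)). Qed.

Lemma stNM u v x : u \in <<J>> -> v \in <<J>> -> stN (u * v) x = stN u (stN v x).
Proof.
move=> uJ vJ; apply: val_inj; rewrite !val_stN ?groupM //.
by rewrite (vconjM (valZ x)).
Qed.

Lemma stNK s x : s \in J -> stN s (stN s x) = x.
Proof.
by move=> sJ; rewrite -stNM ?mem_gen // (mulSS cox (subsetP JS s sJ)) stN1.
Qed.

Lemma stN_fix s x : s \in J -> (stN s x == x) = (zr (val x) s == s).
Proof.
move=> sJ; rewrite -(inj_eq val_inj) val_stN ?mem_gen //.
by rewrite (vconj_fix cox JS (valZ x)) // TJ_gen.
Qed.

Lemma hN_up s x : s \in J -> zr (val x) s != s ->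
  (hN x < hN (stN s x))%N = ~~ n (val x).1 s.
Proof.
move=> sJ ne; have sT := TJ_gen sJ; rewrite /hN val_stN ?mem_gen //.
case E: (n _ s).
  have := vconj_down cox nP JS (valZ x) sT ne E => h.
  by apply/negP => h'; have := ltn_trans (ltnW h) h'; rewrite ltnn.
by have := vconj_up cox nP JS (valZ x) sT ne E => /ltnW.
Qed.

Lemma hN_down s x : s \in J -> zr (val x) s != s ->
  (hN (stN s x) < hN x)%N = n (val x).1 s.
Proof.
move=> sJ ne; have sT := TJ_gen sJ; rewrite /hN val_stN ?mem_gen //.
case E: (n _ s).
  by have := vconj_down cox nP JS (valZ x) sT ne E => /ltnW.
have := vconj_up cox nP JS (valZ x) sT ne E => h.
by apply/negP => h'; have := ltn_trans (ltnW h) h'; rewrite ltnn.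
Qed.

Lemma rhoN_lin s : semilin id (rhoN s). Proof. exact: gop_lin. Qed.

Lemma rhoN_fb s x : rhoN s (fb x) = gop_fb (stN s) hN (fun=> sg s) x.
Proof. exact: gopE. Qed.

Lemma rhoN_quad s m : s \in J -> rhoN s (rhoN s m) = (m + fsc qL (rhoN s m))%R.
Proof.
move=> sJ; apply: gop_quad => x; [exact: stNK | exact: sg_eigen].
Qed.

Lemma rhoN_fix s x : s \in J -> zr (val x) s = s -> rhoN s (fb x) = fsc (sg s) (fb x).
Proof.
move=> sJ /eqP; rewrite -stN_fix // => /eqP e.
by rewrite /rhoN gopE /gop_fb e ltnn.
Qed.

Lemma rhoN_moved s x : s \in J -> zr (val x) s != s ->
  rhoN s (fb x) = if n (val x).1 s then (fb (stN s x) + fsc qL (fb x))%R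
                  else fb (stN s x).
Proof.
move=> sJ ne; rewrite /rhoN gopE /gop_fb hN_up // hN_down //.
by case: (n _ s).
Qed.

(** * Braid relations on the orbit of a minimal element under a dihedral parabolic *)

Section Dihedral.
Variables (s t : gT) (x0 : ZT).
Hypotheses (sJ : s \in J) (tJ : t \in J) (st : s != t).
Local Notation I := [set s; t].
Local Notation z0 := (val x0).
Hypothesis x0min : {in I, forall b, (hN x0 <= hN (stN b x0))%N}.
Local Notation m := #[s * t].

Let sS := subsetP JS s sJ.
Let tS := subsetP JS t tJ.
Let z0I := valZ x0.
Let IS : I \subset S. Proof. exact: pair_sub. Qed.
Let IJ' : I \subset J.
Proof. by apply/subsetP => b; rewrite !inE => /orP [] /eqP ->. Qed.
Let IJG g : g \in <<I>> -> g \in <<J>>. Proof. exact: (subsetP (genS IJ')). Qed.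
Let bIG b : b \in I -> b \in <<J>>.
Proof. by move=> bI; rewrite mem_gen // (subsetP IJ'). Qed.
Let TIJ r : r \in TJ I -> r \in TJ J. Proof. exact: TJ_mono. Qed.
Let sI : s \in I. Proof. by rewrite !inE eqxx. Qed.
Let tI : t \in I. Proof. by rewrite !inE eqxx orbT. Qed.

Lemma x0_nodesc b : b \in I -> zr z0 b != b -> n z0.1 b = false.
Proof.
move=> bI ne; rewrite -hN_down ?(subsetP IJ') //.
by apply/negbTE; rewrite -leqNgt x0min.
Qed.

(** The orbit is one point, on which both operators are scalars. For even [m] these commute; for odd
    [m], [sigma ((s t)^m) = 1] forces [sigma s = sigma t], so they are equal. *)
Lemma braid_both_fixed u : zr z0 s = s -> zr z0 t = t -> u \in <<I>> ->
  altop (rhoN s) (rhoN t) m (fb (stN u x0)) = altop (rhoN t) (rhoN s) m (fb (stN u x0)).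
Proof.
move=> fs ft uI.
have -> : stN u x0 = x0.
  move: u uI; apply: gen_ind => [|b u bI uI IH]; first exact: stN1.
  rewrite (stNM _ (bIG bI) (IJG uI)) IH; apply/eqP.
  by rewrite stN_fix ?(subsetP IJ') //; case: (pairP bI) => ->; rewrite ?fs ?ft.
pose W (v : {ffun ZT -> laurent}) := exists c, v = fsc c (fb x0).
have Wx : W (fb x0) by exists 1%R; rewrite fsc1.
have Es c : rhoN s (fsc c (fb x0)) = fsc (c * sg s)%R (fb x0).
  by rewrite (sl_scale _ (rhoN_lin s)) // rhoN_fix // fscA.
have Et c : rhoN t (fsc c (fb x0)) = fsc (c * sg t)%R (fb x0).
  by rewrite (sl_scale _ (rhoN_lin t)) // rhoN_fix // fscA.
case E: (odd m).
  have sst : sg s = sg t.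
    have sG : s \in WJ J by apply: mem_gen.
    have tG : t \in WJ J by apply: mem_gen.
    have stG : s * t \in WJ J by apply: groupM.
    have X k : sigma ((s * t) ^+ k) = ((sigma s * sigma t) ^+ k)%R.
      elim: k => [|k IH]; first by rewrite expg0 expr0 sigma1.
      by rewrite expgS exprS !sigM ?IH ?sigM // groupX.
    have := X m; rewrite expg_order sigma1 /sg.
    case: (sigU sG) => ->; case: (sigU tG) => -> //;
      by rewrite ?mulr1 ?mul1r -signr_odd E expr1.
  apply: (@altop_same _ W) => //.
    by move=> v [c ->]; rewrite Es; exists (c * sg s)%R.
  by move=> v [c ->]; rewrite Es Et sst.
rewrite -[m]odd_double_half E add0n.
apply: (@altop_commute _ W) => //.
- by move=> v [c ->]; rewrite Es; exists (c * sg s)%R.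
- by move=> v [c ->]; rewrite Et; exists (c * sg t)%R.
- by move=> v [c ->]; rewrite Es !Et Es mulrAC.
Qed.

Definition special := exists2 r, r \in TJ I & (zr z0 r \in TJ I) /\ zr z0 r != r.

(* The product of [r] and its conjugate is the longest element of the dihedral
   group and fixes [z0]; comparing inversion sets, [z0] permutes [T_I]. *)
Lemma special_stable : special -> {in TJ I, forall q, zr z0 q \in TJ I}.
Proof.
case=> r rI [r'I ne] q qI; have rJ := TIJ rI; have rG := TJ_sub rJ.
have r'G : zr z0 r \in <<J>> by apply/TJ_sub/TIJ.
have [|cE cent nc _] := dihedral_center cox nP sS tS rI r'I _ (zr_commute cox JS z0I rJ).
  by rewrite eq_sym.
set c := r * zr z0 r in cE cent nc.
have cI : c \in <<I>> by rewrite groupM // TJ_sub.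
have cG := IJG cI.
have cx : vconj c z0 = z0.
  rewrite (vconjM z0I) // (vconj_zr cox JS z0I rJ).
  by rewrite (vconjK cox JS z0I rJ).
have qJ := TJ_sub (TIJ qI).
have qc : q ^ c = q by rewrite conjgE cent ?TJ_sub // mulKg.
have cV : c^-1 = c.
  apply/eqP; rewrite eq_invg_mul {2}/c (zr_commute cox JS z0I rJ) /c mulgA.
  rewrite -(mulgA r) (TJ_mulrr cox JS (TIJ r'I)).
  by rewrite mulg1 (TJ_mulrr cox JS rJ).
have := D_vconj nP JS z0I cG qJ; rewrite cx qc (nc q qI) cV => h.
have : n c (zr z0 q) by move: h; case: (n z0.1 q); case: (n c _).
exact: (n_TJ nP IS cI).
Qed.

(** The orbit is [{x0, t x0}]. As [t (z t z)] is central, [s] fixes both points and acts by one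
    scalar, which commutes with [rhoN t]; and [m] is even. *)
Lemma braid_special_fixed u : special -> zr z0 s = s -> zr z0 t != t -> u \in <<I>> ->
  altop (rhoN s) (rhoN t) m (fb (stN u x0)) = altop (rhoN t) (rhoN s) m (fb (stN u x0)).
Proof.
move=> sp fs nt uI.
have [x1 ex1] : {x1 : ZT | x1 = stN t x0} by exists (stN t x0).
pose W2 (v : {ffun ZT -> laurent}) := exists c d, v = (fsc c (fb x0) + fsc d (fb x1))%R.
have tT : t \in TJ I by apply: TJ_gen.
have t'T := special_stable sp tT.
have [|_ cent _ ev] := dihedral_center cox nP sS tS tT t'T _ (zr_commute cox JS z0I (TJ_gen tJ)).
  by rewrite eq_sym.
have sG : s \in <<J>> by apply: mem_gen.
have tG : t \in <<J>> by apply: mem_gen.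
have fs1 : zr (val x1) s = s.
  rewrite ex1 val_stN // (zr_vconj z0I) // (zrJ z0I) // fs.
  rewrite -conjgM (invS cox tS) conjgE -(zr_commute cox JS z0I (TJ_gen tJ)).
  by rewrite cent ?mem_gen // mulKg.
have ny := x0_nodesc tI nt.
have rt0 : rhoN t (fb x0) = fb x1 by rewrite rhoN_moved // ny ex1.
have rt1 : rhoN t (fb x1) = (fb x0 + fsc qL (fb x1))%R.
  by rewrite -rt0 rhoN_quad // rt0.
have orb : stN u x0 = x0 \/ stN u x0 = x1.
  move: u uI; apply: gen_ind => [|b u bI uI IH]; first by left; apply: stN1.
  rewrite (stNM _ (bIG bI) (IJG uI)).
  case: (pairP bI) => ->; case: IH => ->.
  - by left; apply/eqP; rewrite stN_fix // fs.
  - by right; apply/eqP; rewrite stN_fix // fs1.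
  - by right; rewrite ex1.
  - by left; rewrite ex1 stNK.
have Wu : W2 (fb (stN u x0)).
  by case: orb => ->; [exists 1%R, 0%R; apply: fsc10 | exists 0%R, 1%R; apply: fsc01].
have Es (v : {ffun ZT -> laurent}) : W2 v -> rhoN s v = fsc (sg s) v.
  move=> [c [d ->]]; rewrite (rhoN_lin s) (sl_scale _ (rhoN_lin s) d (fb x1)) //.
  by rewrite (rhoN_fix sJ fs) (rhoN_fix sJ fs1) fscDr !fscA (mulrC (sg s) c) (mulrC (sg s) d).
have Wt (v : {ffun ZT -> laurent}) : W2 v -> W2 (rhoN t v).
  move=> [c [d ->]]; rewrite (rhoN_lin t) (sl_scale _ (rhoN_lin t) d (fb x1)) // rt0 rt1.
  exists d, (c + d * qL)%R; rewrite fscDr fscA fscDl addrCA; congr (_ + _)%R.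
have Ws (v : {ffun ZT -> laurent}) : W2 v -> W2 (fsc (sg s) v).
  by move=> [c [d ->]]; exists (sg s * c)%R, (sg s * d)%R; rewrite fscDr !fscA.
rewrite -[m]odd_double_half (negPf ev) add0n.
apply: (@altop_commute _ W2) => //.
- by move=> v Wv; rewrite Es //; apply: Ws.
- by move=> v Wv; rewrite !Es ?(sl_scale _ (rhoN_lin t)) //; apply: Wt.
Qed.

(** [s (z s z)] and [t (z t z)] both equal the longest element, so [s] and [t] send [x0] to the same
    point and the two operators agree on the orbit. *)
Lemma braid_special_moved u : special -> zr z0 s != s -> zr z0 t != t -> u \in <<I>> ->
  altop (rhoN s) (rhoN t) m (fb (stN u x0)) = altop (rhoN t) (rhoN s) m (fb (stN u x0)).
Proof.
move=> sp ns nt uI.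
have [x1 ex1] : {x1 : ZT | x1 = stN t x0} by exists (stN t x0).
pose W2 (v : {ffun ZT -> laurent}) := exists c d, v = (fsc c (fb x0) + fsc d (fb x1))%R.
have ctr b : b \in I -> zr z0 b != b -> b * zr z0 b = altw s t m.
  move=> bI ne; have bT : b \in TJ I by apply: TJ_gen.
  have bJ := subsetP IJ' b bI.
  case: (dihedral_center cox nP sS tS bT (special_stable sp bT) _
    (zr_commute cox JS z0I (TJ_gen bJ))) => //; by rewrite eq_sym.
have e1 : stN s x0 = x1.
  rewrite ex1; apply: val_inj.
  rewrite !val_stN ?mem_gen // !(vconj_refl cox JS z0I) ?TJ_gen //.
  by rewrite !ctr.
have sx1 : stN s x1 = x0 by rewrite -e1 stNK.
have tx1 : stN t x1 = x0 by rewrite ex1 stNK.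
have ny := x0_nodesc tI nt; have nys := x0_nodesc sI ns.
have rt0 : rhoN t (fb x0) = fb x1 by rewrite rhoN_moved // ny ex1.
have rs0 : rhoN s (fb x0) = fb x1 by rewrite rhoN_moved // nys e1.
have rt1 : rhoN t (fb x1) = (fb x0 + fsc qL (fb x1))%R by rewrite -rt0 rhoN_quad // rt0.
have rs1 : rhoN s (fb x1) = (fb x0 + fsc qL (fb x1))%R by rewrite -rs0 rhoN_quad // rs0.
have orb : stN u x0 = x0 \/ stN u x0 = x1.
  move: u uI; apply: gen_ind => [|b u bI uI IH]; first by left; apply: stN1.
  rewrite (stNM _ (bIG bI) (IJG uI)).
  by case: (pairP bI) => ->; case: IH => ->; rewrite ?sx1 ?tx1 ?e1 -?ex1; auto.
have Wu : W2 (fb (stN u x0)).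
  by case: orb => ->; [exists 1%R, 0%R; apply: fsc10 | exists 0%R, 1%R; apply: fsc01].
apply: (@altop_same _ W2) => // v [c [d ->]].
  rewrite (rhoN_lin s) (sl_scale _ (rhoN_lin s) d (fb x1)) // rs0 rs1.
  by exists d, (c + d * qL)%R; rewrite fscDr fscA fscDl addrCA.
rewrite (rhoN_lin s) (sl_scale _ (rhoN_lin s) d (fb x1)) // (rhoN_lin t) (sl_scale _ (rhoN_lin t) d (fb x1)) //.
by rewrite rs0 rs1 rt0 rt1.
Qed.

Section Generic.
Hypothesis nsp : {in TJ I, forall r, zr z0 r \in TJ I -> zr z0 r = r}.
Hypothesis tmoved : zr z0 t != t.

Let sG : s \in <<J>>. Proof. exact: mem_gen. Qed.
Let tG : t \in <<J>>. Proof. exact: mem_gen. Qed.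
Let TIG q : q \in TJ I -> q \in <<J>>. Proof. by move/TIJ/TJ_sub. Qed.

Lemma pair_nodesc y q : n y s = false -> n y t = false -> q \in TJ I -> n y q = false.
Proof.
move=> ns nt qI; rewrite -[y]invgK; apply: (WJup_n cox nP IS) => //.
by apply/(WJupP cox nP) => // b bI; rewrite invgK; case: (pairP bI) => ->.
Qed.

(** Minimality of [x0] forbids moved letters as descents, so [s] must be a fixed descent. Then
    [N(y)] is stable under conjugation by [s], and [s y] has neither letter as a descent, hence no
    inversion in [T_I]; only [s] itself remains. *)
Lemma generic_desc q : q \in TJ I -> n z0.1 q -> q = s /\ zr z0 s = s.
Proof.
move=> qI nq; have nt := x0_nodesc tI tmoved.
have [fs|ms] := eqVneq (zr z0 s) s; last first.
  by rewrite (pair_nodesc (x0_nodesc sI ms) nt qI) in nq.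
case ns: (n z0.1 s); last by rewrite (pair_nodesc ns nt qI) in nq.
have dstab p : p \in <<J>> -> n z0.1 (p ^ s) = n z0.1 p.
  move=> pG; have := D_vconj nP JS z0I sG pG.
  have /eqP -> : vconj s z0 == z0 by rewrite (vconj_fix cox JS z0I) ?fs // TJ_gen.
  rewrite (invS cox sS) !(n_gen nP _ sS) (zrJ z0I) // fs.
  have -> : (zr z0 p ^ s == s) = (p == s).
    have ss : s ^ s = s by rewrite conjgE mulKg.
    rewrite -{2}ss (inj_eq (@conjg_inj _ s)); apply/eqP/eqP => [e|->] //.
    by rewrite -(zrK z0I pG) e fs.
  by case: (p == s); case: (n _ (p ^ s)); case: (n _ p).
split=> //; apply/eqP; move: nq; rewrite -[z0.1](mulSK cox _ sS) (n_mul nP).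
rewrite (n_gen nP _ sS) (@pair_nodesc (s * z0.1)) ?addbF //.
- by rewrite (n_mulss nP) // ns.
- by rewrite (n_mul nP) (n_gen nP _ sS) eq_sym (negPf st) dstab.
- by rewrite TJ_conj // mem_gen.
Qed.

(** In [D_vconj] the term of [g^-1] survives only if [z] keeps the reflection in [T_I], where
    inversions of [g^-1] lie; by [nsp] it is then fixed and cancels against [n g q]. *)
Lemma generic_D g q : g \in <<I>> -> q \in TJ I ->
  n (vconj g z0).1 q = n z0.1 (q ^ g) (+) (n g q && (zr z0 (q ^ g) != q ^ g)).
Proof.
move=> gI qI; rewrite (D_vconj nP JS z0I (IJG gI) (TIG qI)).
have e : n g^-1 (q ^ g) = n g q by rewrite (n_inv nP) conjgK.
have [f|f] := eqVneq (zr z0 (q ^ g)) (q ^ g).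
  by rewrite f e andbF addbF addbCA addbb addbF.
case E: (n g^-1 (zr z0 (q ^ g))); last by rewrite addbF andbT addbC.
have gV : g^-1 \in <<I>> by rewrite groupV.
have qgI : q ^ g \in TJ I by rewrite TJ_conj.
have f' := nsp qgI (n_TJ nP IS gV E).
by rewrite f' eqxx in f.
Qed.

(** As [r] fixes [z], [generic_D] shows that every inversion of [r] in [T_I] is fixed by [z]. So [t]
    is not one and [s] is the only descent; if [r] were not [s], then [t ^ s] would be an inversion
    of [r] too, and [t] would be fixed. *)
Lemma generic_fix r : r \in TJ I -> zr z0 r = r -> r = s /\ zr z0 s = s.
Proof.
move=> rI fr; have rJ := TIJ rI; have rV := TJ_inv cox JS rJ.
have rG := TJ_sub rI; have rG' := TIG rI.
have step q : q \in TJ I -> n r q -> zr z0 q = q.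
  move=> qI nq; apply/eqP/negPn/negP => mq.
  have pI : q ^ r \in TJ I by rewrite TJ_conj.
  have pr : (q ^ r) ^ r = q by rewrite -conjgM (TJ_mulrr cox JS rJ) conjg1.
  have := generic_D rG pI; rewrite pr mq andbT.
  have /eqP -> : vconj r z0 == z0 by rewrite (vconj_fix cox JS z0I) ?fr.
  have -> : n z0.1 q = false.
    by apply/negP => /(generic_desc qI) [e fs]; rewrite e fs eqxx in mq.
  have -> : n r (q ^ r) by rewrite -{1}rV (n_inv nP) rV pr.
  move=> /(generic_desc pI) [e fs]; case/negP: mq; apply/eqP.
  by rewrite -pr e (zrJ z0I) // fs fr.
have r1 : r != 1.
  by apply: contraTneq (n_refl cox nP (TJ_T cox IS rI)) => ->; rewrite (n1 nP).
have notT : n r t = false by apply/negP => /(step t (TJ_gen tI)) e; move: tmoved; rewrite e eqxx.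
case: (desc_exists cox nP IS rG r1) => b bI nb.
have nrs : n r s by case: (pairP bI) nb => ->; rewrite ?notT.
have fs : zr z0 s = s by apply: step; rewrite ?TJ_gen.
split=> //; apply/eqP/negPn/negP => rs.
have sr1 : s * r != 1.
  by apply: contra rs => /eqP e; rewrite -(mulSK cox r sS) e mulg1.
have srI : s * r \in <<I>> by rewrite groupM // mem_gen.
case: (desc_exists cox nP IS srI sr1) => b' b'I nb'.
have nt : n (s * r) t.
  by case: (pairP b'I) nb' => -> //; rewrite (n_mulss nP) // nrs.
have tsI : t ^ s \in TJ I by rewrite TJ_conj ?TJ_gen // mem_gen.
have : n r (t ^ s).
  rewrite -[r](mulSK cox _ sS) (n_mul nP) (n_gen nP _ sS) -conjgM (mulSS cox sS) conjg1 nt.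
  rewrite (_ : (t ^ s == s) = false) //; apply: contraNF st => /eqP e.
  by rewrite -(inj_eq (@conjg_inj _ s)) e conjgE mulKg.
move/(step _ tsI); rewrite (zrJ z0I) // fs => /conjg_inj e.
by move: tmoved; rewrite e eqxx.
Qed.

Let kk := zr z0 s == s.

(* The image of [H_u] is [H_u M_x0]: along the dihedral orbit heights follow the
   length of [u], so this intertwines [Lgen] with [rhoN]. *)
Definition dihedral_fb (u : gT) : {ffun ZT -> laurent} :=
  if u \in <<I>> then
    if kk && n u^-1 s then fsc (sg s) (fb (stN u x0)) else fb (stN u x0)
  else 0%R.

Definition dihedral_map := linear_lift dihedral_fb.

(** If [z] fixes [b ^ u], then [b ^ u = s] by [generic_fix], so [b u = u s] and only the factor
    [sg s] changes: it is the eigenvalue of a last letter [s] acting on [M_x0]. Otherwise that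
    factor is unchanged and [b] is a descent at the orbit point iff it is one of [u]. *)
Lemma dihedral_intertwine b h : b \in I ->
  dihedral_map (Lgen S b h) = rhoN b (dihedral_map h).
Proof.
move=> bI; have bS := subsetP IS b bI; have bJ := subsetP IJ' b bI; move: h.
have ml : semilin id dihedral_map by apply: linear_lift_lin.
have bl := rhoN_lin b.
apply: (@sl_ext _ _ id) => //.
- exact: (semilin_comp ml (Lgen_lin S b)).
- exact: (semilin_comp bl ml).
move=> u; rewrite (Lgen_fb cox nP) // [X in _ = rhoN b X]linear_lift_fb.
have mfb w : dihedral_map (fb w) = dihedral_fb w by apply: linear_lift_fb.
have -> : dihedral_map (if n u b then (fb (b * u)%g + fsc qL (fb u))%R else fb (b * u)) =
   if n u b then (dihedral_fb (b * u)%g + fsc qL (dihedral_fb u))%R else dihedral_fb (b * u).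
  case: (n u b); rewrite ?mfb //.
  by rewrite (sl_add erefl ml) (sl_scale erefl ml) !mfb.
have buI : (b * u \in <<I>>) = (u \in <<I>>) by rewrite groupMl // mem_gen.
rewrite /dihedral_fb buI; have [uI|_] := boolP (u \in <<I>>); last first.
  by rewrite (sl_zero erefl bl) fsc0r addr0 if_same.
have uG := IJG uI; have bG := bIG bI.
have bT : b \in TJ I by apply: TJ_gen.
have buT : b ^ u \in TJ I by rewrite TJ_conj.
have zx : (zr (val (stN u x0)) b == b) = (zr z0 (b ^ u) == b ^ u).
  rewrite val_stN // (zr_vconj z0I uG bG) -{2}(conjgK u b).
  by rewrite (inj_eq (@conjg_inj _ u^-1)).
have nx : n (val (stN u x0)).1 b =
    n z0.1 (b ^ u) (+) (n u b && (zr z0 (b ^ u) != b ^ u)).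
  by rewrite val_stN // generic_D.
have nbu : n (b * u)^-1 s = n u^-1 s (+) (s ^ u^-1 == b).
  by rewrite invMg (invS cox bS) (n_mul nP) (n_gen nP _ bS).
have sbu : stN (b * u) x0 = stN b (stN u x0) by rewrite stNM.
have [f|mv] := eqVneq (zr z0 (b ^ u)) (b ^ u).
  have [e fs] := generic_fix buT f.
  have eb : s ^ u^-1 = b by rewrite -e conjgK.
  have fx : zr (val (stN u x0)) b = b by apply/eqP; rewrite zx f.
  have bfix : stN b (stN u x0) = stN u x0 by apply/eqP; rewrite stN_fix ?fx.
  have sgb : sg b = sg s by rewrite -eb sg_conj // groupV.
  have nub : n u b = n u^-1 s by rewrite (n_inv nP) eb.
  rewrite /kk fs eqxx nbu eb eqxx sbu bfix nub; case: (n u^-1 s) => /=.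
    rewrite (sl_scale erefl bl) rhoN_fix // sgb !fscA (eigen_sqr (sg_eigen s)).
    by rewrite fscDl fsc1.
  by rewrite rhoN_fix // sgb.
have nz : n z0.1 (b ^ u) = false.
  by apply/negP => /(generic_desc buT) [e fs]; rewrite e fs eqxx in mv.
have mx : zr (val (stN u x0)) b != b by rewrite zx.
rewrite nz mv andbT /= in nx.
have -> : kk && n (b * u)^-1 s = kk && n u^-1 s.
  rewrite nbu /kk; case: eqP => //= fs.
  rewrite (_ : (s ^ u^-1 == b) = false) ?addbF //.
  by apply: contraNF mv => /eqP <-; rewrite conjgKV fs.
have rx := rhoN_moved bJ mx; rewrite nx -sbu in rx.
case: (kk && _); rewrite ?(sl_scale erefl bl) rx; case: (n u b) => //.
by rewrite fscDr !fscA [(_ * qL)%R]mulrC.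
Qed.

Lemma braid_generic u : u \in <<I>> ->
  altop (rhoN s) (rhoN t) m (fb (stN u x0)) = altop (rhoN t) (rhoN s) m (fb (stN u x0)).
Proof.
(* When [s] fixes [x0], [u] and [u s] reach the same point; the one not ending in [s] maps to the
   basis vector with coefficient 1. *)
move=> uI; have [v ->] : exists v, fb (stN u x0) = dihedral_map (fb v).
  case E: (kk && n u^-1 s).
    exists (u * s); rewrite /dihedral_map linear_lift_fb /dihedral_fb.
    rewrite (groupM uI (mem_gen sI)) invMg (invS cox sS) (n_mulss nP) //.
    case/andP: E => /eqP fs ->; rewrite andbF (stNM _ (IJG uI) sG).
    by congr (fb (stN u _)); apply/esym/eqP; rewrite stN_fix ?fs.
  by exists u; rewrite /dihedral_map linear_lift_fb /dihedral_fb uI E.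
rewrite -!(altop_intertwine (pi := dihedral_map) (f := Lgen S s) (g := Lgen S t)
  (f' := rhoN s) (g' := rhoN t)); [|by move=> h; apply: dihedral_intertwine..].
rewrite -(altop_intertwine (pi := dihedral_map) (f := Lgen S t) (g := Lgen S s)
  (f' := rhoN t) (g' := rhoN s)); [|by move=> h; apply: dihedral_intertwine..].
by rewrite (braidL cox nP).
Qed.

End Generic.

Lemma braid_moved u : zr z0 t != t -> u \in <<I>> ->
  altop (rhoN s) (rhoN t) m (fb (stN u x0)) = altop (rhoN t) (rhoN s) m (fb (stN u x0)).
Proof.
move=> mt uI.
have [/exists_inP [r rI /andP [r'I ne]]|/exists_inPn nsp] :=
  boolP [exists r in TJ I, (zr z0 r \in TJ I) && (zr z0 r != r)].
  have sp : special by exists r.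
  have [fs|ms] := eqVneq (zr z0 s) s; first exact: braid_special_fixed.
  exact: braid_special_moved.
apply: braid_generic => // r rI r'I; apply/eqP.
by have := nsp r rI; rewrite r'I /= negbK.
Qed.

End Dihedral.

Lemma rhoN_braid s t : s \in J -> t \in J -> forall f,
  altop (rhoN s) (rhoN t) #[s * t] f = altop (rhoN t) (rhoN s) #[s * t] f.
Proof.
move=> sJ tJ; have [<-//|st] := eqVneq s t.
apply: (@sl_ext _ _ id) => //; try by apply: altop_lin; apply: rhoN_lin.
move=> x; pose I := [set s; t].
have IJ' : I \subset J by apply/subsetP => b; rewrite !inE => /orP [] /eqP ->.
have IJG g : g \in <<I>> -> g \in <<J>> by apply: (subsetP (genS IJ')).
case: (@arg_minnP _ 1 (mem <<I>>) (fun u => hN (stN u x))) => /=; first exact: group1.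
move=> v vI vmin; pose x0 := stN v x.
have -> : x = stN v^-1 x0 by rewrite /x0 -stNM ?groupV ?IJG // mulVg stN1.
have vV : v^-1 \in <<I>> by rewrite groupV.
have x0min : {in I, forall b, (hN x0 <= hN (stN b x0))%N}.
  move=> b bI; have bG : b \in <<I>> by apply: mem_gen.
  by rewrite /x0 -(stNM _ (IJG _ bG) (IJG _ vI)) vmin // groupM.
have sS := subsetP JS s sJ; have tS := subsetP JS t tJ.
have [ft|mt] := eqVneq (zr (val x0) t) t; last exact: braid_moved.
have [fs|ms] := eqVneq (zr (val x0) s) s; first exact: braid_both_fixed.
(* Here [t] is fixed and [s] moved: the previous case with the letters exchanged. *)
rewrite -(order_mulSC cox sS tS); apply/esym; apply: braid_moved => //.
- by rewrite eq_sym.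
- by rewrite setUC.
- by rewrite setUC.
Qed.

End InvolutionModule.

(** * The induced module *)

Section KModule.
Variables (gT : finGroupType) (S J : {set gT}) (n : gT -> gT -> bool).
Variable sigma : gT -> int.
Hypothesis cox : coxeter_system S.
Hypothesis nP : inversion_cocycle S n.
Hypothesis JS : J \subset S.
Hypothesis sigM : {in WJ J &, forall u v, sigma (u * v)%g = (sigma u * sigma v)%R}.
Hypothesis sigU : {in WJ J, forall u, sigma u = 1%R \/ sigma u = (-1)%R}.
Local Open Scope group_scope.
Local Notation ell := (len S).
Local Notation K := (KJt S J).
Local Notation V := {ffun K -> laurent}.
Local Notation rhoN := (@rhoN gT S J sigma).
Local Notation sg := (sg sigma).
Implicit Types (r s t u v w g q b : gT) (tau : gT * ext gT) (i j : K).

Lemma KJP (i : K) : (val i).1 \in WJup S J /\ (val i).2 \in IJ J.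
Proof. by have := valP i; rewrite inE => /andP. Qed.

Lemma KJ_pair w z : w \in WJup S J -> z \in IJ J -> (w, z) \in KJ S J.
Proof. by move=> wK zI; rewrite inE wK zI. Qed.

Lemma sact_up s tau : s * tau.1 \in WJup S J -> sact S J s tau = (s * tau.1, tau.2).
Proof. by rewrite /sact => ->. Qed.

Lemma sact_in s tau : tau \in KJ S J -> s \in S -> s * tau.1 \notin WJup S J ->
  [/\ tau.1^-1 * s * tau.1 \in J, n tau.1 s = false
    & sact S J s tau = (tau.1, vconj (tau.1^-1 * s * tau.1) tau.2)].
Proof.
rewrite inE => /andP [wK zI] sS h.
case: (deodhar cox nP JS wK sS h) => tJ nw; split=> //.
by rewrite /sact (negPf h) (vconj_emul cox JS zI) // TJ_gen.
Qed.

Lemma sact_KJ s tau : tau \in KJ S J -> s \in S -> sact S J s tau \in KJ S J.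
Proof.
move=> tK sS; have := tK; rewrite inE => /andP [wK zI].
case: (boolP (s * tau.1 \in WJup S J)) => h; first by rewrite sact_up // KJ_pair.
case: (sact_in tK sS h) => tJ _ ->; apply: KJ_pair => //.
by apply: (vconj_IJ cox JS zI); apply: mem_gen.
Qed.

Lemma sactK s tau : tau \in KJ S J -> s \in S -> sact S J s (sact S J s tau) = tau.
Proof.
move=> tK sS; have := tK; rewrite inE => /andP [wK zI].
case: (boolP (s * tau.1 \in WJup S J)) => h.
  rewrite (sact_up h) sact_up /= (mulSK cox) //.
  by case: tau wK {tK zI h}.
case: (sact_in tK sS h) => tJ nw e.
have tK' := sact_KJ tK sS; rewrite e in tK'; rewrite e.
case: (sact_in tK' sS h) => _ _ -> /=.
by rewrite (vconjK cox JS zI) ?TJ_gen //; case: tau {tK zI h wK tJ nw e tK'}.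
Qed.

Definition stK s (i : K) : K := insubd i (sact S J s (val i)).
(** Twice [ht], up to the constant [len_zmin] of the class; this replaces rational heights by
    natural ones. *)
Definition hK (i : K) : nat := ((ell (val i).1).*2 + ell (val i).2.1)%N.
Definition aK s (i : K) : laurent := sg ((val i).1^-1 * s * (val i).1).
Definition rhoK s := gop (stK s) hK (aK s).

Lemma val_stK s i : s \in S -> val (stK s i) = sact S J s (val i).
Proof. by move=> sS; rewrite val_insubd sact_KJ //; apply: valP. Qed.

Lemma stKK s i : s \in S -> stK s (stK s i) = i.
Proof.
by move=> sS; apply: val_inj; rewrite !val_stK // sactK //; apply: valP.
Qed.

Lemma rhoK_lin s : semilin id (rhoK s). Proof. exact: gop_lin. Qed.

Lemma rhoK_quad s m : s \in S -> rhoK s (rhoK s m) = (m + fsc qL (rhoK s m))%R.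
Proof.
by move=> sS; apply: gop_quad => i; [apply: stKK | apply: sg_eigen].
Qed.

Lemma Mb_fb (i : K) : Mb S J (val i) = fb i.
Proof.
by apply/ffunP => j; rewrite fbE ffunE val_eqE.
Qed.

Lemma msc_fsc (c : laurent) (m : V) : msc S J c m = fsc c m.
Proof. by rewrite fsc.unlock. Qed.

Lemma zclass_vconj v z : z \in IJ J -> v \in <<J>> -> zclass J (vconj v z) = zclass J z.
Proof.
move=> zI vJ; apply/setP => y; apply/imsetP/imsetP => [[u uJ ->]|[u uJ ->]].
  by exists (u * v); [apply: groupM | rewrite (vconjM zI)].
exists (u * v^-1); first by apply: groupM; rewrite ?groupV.
have uvJ : u * v^-1 \in <<J>> by apply: groupM; rewrite ?groupV.
by rewrite -(vconjM zI) // mulgKV.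
Qed.

Lemma len_zmin_vconj v z : z \in IJ J -> v \in <<J>> ->
  len_zmin J (vconj v z) = len_zmin J z.
Proof. by move=> zI vJ; rewrite /len_zmin zclass_vconj. Qed.

Lemma elenE z : z \in IJ J -> elen J z = ell z.1.
Proof. by move=> zI; rewrite /elen (lenJ cox nP JS) // IJ_1. Qed.

Lemma len_zmin_sact s tau : tau \in KJ S J -> s \in S ->
  len_zmin J (sact S J s tau).2 = len_zmin J tau.2.
Proof.
move=> tK sS; have := tK; rewrite inE => /andP [wK zI].
case: (boolP (s * tau.1 \in WJup S J)) => h; first by rewrite sact_up.
case: (sact_in tK sS h) => tJ _ -> /=.
by rewrite len_zmin_vconj // mem_gen.
Qed.

Lemma htE i :
  ht S J (val i) = (((hK i)%:R - (len_zmin J (val i).2)%:R) / 2%:R :> rat)%R.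
Proof.
have [_ zi] := KJP i; rewrite /ht (elenE zi) /hK natrD -muln2 natrM.
by field.
Qed.

Lemma ht_lt i j : len_zmin J (val i).2 = len_zmin J (val j).2 ->
  (ht S J (val i) < ht S J (val j))%R = (hK i < hK j)%N.
Proof.
move=> e; rewrite !htE e ltr_pM2r ?invr_gt0 ?ltr0n //.
by rewrite ltrD2r ltr_nat.
Qed.

Lemma ht_stK s i : s \in S ->
  ((ht S J (val i) < ht S J (sact S J s (val i)))%R = (hK i < hK (stK s i))%N) *
  ((ht S J (sact S J s (val i)) < ht S J (val i))%R = (hK (stK s i) < hK i)%N).
Proof.
move=> sS; have e := len_zmin_sact (valP i) sS.
by rewrite -val_stK // !ht_lt ?val_stK.
Qed.

Lemma Hs_Mb_rhoK s i : s \in S -> Hs_Mb S J sigma s (val i) = rhoK s (fb i).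
Proof.
move=> sS; rewrite /rhoK gopE /gop_fb /Hs_Mb !(ht_stK i sS) -(val_stK _ sS) !Mb_fb.
rewrite !msc_fsc; case: (hK i < _)%N => //; case: (_ < hK i)%N => //.
by rewrite /aK /sg; case: ifP.
Qed.

(** The summand of the induced module spanned by [H_w] tensor the module of [W_J]. *)
Definition emb w (f : {ffun ZT J -> laurent}) : V :=
  linear_lift (fun x : ZT J => Mb S J (w, val x)) f.

(** The minimal representative of [g W_J]; [vp g] is the remaining factor in [W_J]. *)
Definition pw g : gT :=
  if [pick w in WJup S J | w^-1 * g \in <<J>>] is Some w then w else 1.
Definition vp g : gT := (pw g)^-1 * g.

Lemma pwE w v : w \in WJup S J -> v \in <<J>> -> pw (w * v) = w.
Proof.
move=> wK vJ; rewrite /pw; case: pickP => [w' /andP [w'K h]|/(_ w)].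
  case: (WJ_uniq cox nP JS w'K wK h vJ); first by rewrite mulKVg.
  by [].
by rewrite wK mulKg vJ.
Qed.

Lemma vpE w v : w \in WJup S J -> v \in <<J>> -> vp (w * v) = v.
Proof. by move=> wK vJ; rewrite /vp pwE // mulKg. Qed.

Lemma emb_lin w : semilin id (emb w). Proof. exact: linear_lift_lin. Qed.

Lemma emb_fb w x (wK : w \in WJup S J) :
  emb w (fb x) = fb (Sub (w, val x) (KJ_pair wK (valP x)) : K).
Proof. by rewrite /emb linear_lift_fb -Mb_fb SubK. Qed.

Lemma hK_Sub w (x : ZT J) (wK : (w, val x) \in KJ S J) :
  hK (Sub (w, val x) wK : K) = ((ell w).*2 + ell (val x).1)%N.
Proof. by rewrite /hK SubK. Qed.

Lemma rhoK_emb_up s w f : s \in S -> w \in WJup S J -> s * w \in WJup S J ->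
  rhoK s (emb w f) = if n w s then (emb (s * w)%g f + fsc qL (emb w f))%R
                     else emb (s * w) f.
Proof.
move=> sS wK swK; move: f.
have E (b : bool) (f : {ffun ZT J -> laurent}) :
  (if b then (emb (s * w)%g f + fsc qL (emb w f))%R else emb (s * w) f) =
  (emb (s * w)%g f + fsc (if b then qL else 0) (emb w f))%R.
  by case: b; rewrite ?fsc0l ?addr0.
apply: (@sl_ext _ _ id) => //.
- exact: (semilin_comp (rhoK_lin s) (emb_lin w)).
- move=> c f f'; rewrite !E (emb_lin w) (emb_lin (s * w)) !fscDr !fscA.
  by rewrite mulrC addrACA.
move=> x; rewrite !emb_fb /rhoK gopE /gop_fb.
set i : K := Sub (w, val x) _; set j : K := Sub (s * w, val x) _.
have e : stK s i = j.
  by apply: val_inj; rewrite val_stK // /i /j !SubK sact_up.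
rewrite e /i /j !hK_Sub !ltn_add2r !ltn_double (ell_mull cox nP) //.
case E': (n w s); last by rewrite ltnS leqnn.
have := ell_gt0 cox nP E'; case: (ell w) => // k _ /=.
by rewrite ltnS leqnn ltnNge leqnSn.
Qed.

Lemma rhoK_emb_in s w f : s \in S -> w \in WJup S J -> s * w \notin WJup S J ->
  rhoK s (emb w f) = emb w (rhoN (w^-1 * s * w) f).
Proof.
move=> sS wK swK; move: f.
case: (deodhar cox nP JS wK sS swK) => tJ nw; set t := w^-1 * s * w in tJ *.
apply: (@sl_ext _ _ id) => //.
- exact: (semilin_comp (rhoK_lin s) (emb_lin w)).
- exact: (semilin_comp (emb_lin w) (rhoN_lin _ _ t)).
move=> x; rewrite !emb_fb /rhoK gopE /gop_fb rhoN_fb /gop_fb.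
set i : K := Sub (w, val x) _.
pose j : K := Sub (w, val (stN t x)) (KJ_pair wK (valP (stN t x))).
have e : stK s i = j.
  apply: val_inj; rewrite val_stK // /i /j !SubK.
  case: (@sact_in s (w, val x) (KJ_pair wK (valP x)) sS swK) => _ _ -> /=.
  by rewrite (val_stN cox JS) // mem_gen.
rewrite e /i /j !hK_Sub !ltn_add2l -!/(hN S _) -/j -/i.
case: ifP => _; first by rewrite emb_fb.
case: ifP => _; first by rewrite (sl_add erefl (emb_lin w)) (sl_scale erefl (emb_lin w)) !emb_fb.
by rewrite (sl_scale erefl (emb_lin w)) emb_fb /aK /i SubK.
Qed.

(* [H_(w v) (x) f |-> w (x) H_v f], with [w] in [W^J] and [v] in [W_J]: the braid
   relations on the induced module come from those of the Hecke algebra. *)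
Definition ind_fb (f : {ffun ZT J -> laurent}) g : V :=
  emb (pw g) (opW S J rhoN (vp g) f).
Definition ind_map f := linear_lift (ind_fb f).

Let Nbraid s t (sJ : s \in J) (tJ : t \in J) := rhoN_braid cox nP JS sigM sigU sJ tJ.

Lemma ind_intertwine f s h : s \in S ->
  ind_map f (Lgen S s h) = rhoK s (ind_map f h).
Proof.
move=> sS; move: h.
have ml : semilin id (ind_map f) by apply: linear_lift_lin.
apply: (@sl_ext _ _ id) => //.
- exact: (semilin_comp ml (Lgen_lin S s)).
- exact: (semilin_comp (rhoK_lin s) ml).
move=> g; case: (WJ_decomp cox nP g JS) => w [v [wK vJ ->]].
have mfb u : ind_map f (fb u) = ind_fb f u by apply: linear_lift_fb.
have E : ind_map f (Lgen S s (fb (w * v))) =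
  if n (w * v) s then (ind_fb f (s * (w * v))%g + fsc qL (ind_fb f (w * v)%g))%R
  else ind_fb f (s * (w * v)).
  rewrite (Lgen_fb cox nP) //; case: (n _ s); rewrite ?mfb //.
  by rewrite (sl_add erefl ml) (sl_scale erefl ml) !mfb.
rewrite {}E mfb /ind_fb (pwE wK vJ) (vpE wK vJ).
have [swK|swK] := boolP (s * w \in WJup S J).
  have -> : n (w * v) s = n w s.
    (* An inversion [s ^ w] of [v] would lie in [W_J], and [s w = w (s ^ w)] would be a second
       parabolic decomposition of [s w]. *)
    rewrite (n_mul nP); case E: (n v _); rewrite ?addbF //.
    have rJ := n_TJ nP JS vJ E; have rG := TJ_sub rJ.
    have [||_ r1] := @WJ_uniq _ _ _ cox nP J (s * w) w 1 (s ^ w) JS swK wK _ rG.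
    - exact: group1.
    - by rewrite mulg1 conjgE mulKVg.
    have := n_refl cox nP (TJ_T cox JS rJ); rewrite -r1 (n1 nP); by [].
  by rewrite (mulgA s w v) (pwE swK vJ) (vpE swK vJ) rhoK_emb_up.
case: (deodhar cox nP JS wK sS swK) => tJ nw; rewrite rhoK_emb_in //.
set t := w^-1 * s * w in tJ *.
have st : s ^ w = t by rewrite conjgE mulgA.
have sw : s * (w * v) = w * (t * v) by rewrite /t !mulgA mulgV mul1g.
have tvJ : t * v \in <<J>> by rewrite groupM // mem_gen.
rewrite (n_mul nP) nw st sw (pwE wK tvJ) (vpE wK tvJ) /=; case E: (n v t).
  rewrite (opW_desc cox nP JS Nbraid _ tJ vJ E) (rhoN_quad sigma cox JS _ tJ).
  by rewrite (sl_add erefl (emb_lin w)) (sl_scale erefl (emb_lin w)).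
by rewrite (opW_mull cox nP JS Nbraid _ tJ vJ E).
Qed.

Lemma ind_surj (i : K) : exists f h, fb i = ind_map f h.
Proof.
have [wK zI] := KJP i.
exists (fb (Sub (val i).2 zI : ZT J)), (fb (val i).1).
rewrite /ind_map linear_lift_fb /ind_fb -[(val i).1]mulg1 pwE ?group1 // vpE ?group1 //.
rewrite opW1 emb_fb; congr (fb _); apply: val_inj; rewrite !SubK.
by case: (val i).
Qed.

Lemma rhoK_braid s t : s \in S -> t \in S -> forall m,
  altop (rhoK s) (rhoK t) #[s * t] m = altop (rhoK t) (rhoK s) #[s * t] m.
Proof.
move=> sS tS; apply: (@sl_ext _ _ id) => //; try by apply: altop_lin; apply: rhoK_lin.
move=> i; have [f [h ->]] := ind_surj i.
rewrite -(altop_intertwine (pi := ind_map f) (f := Lgen S s) (g := Lgen S t)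
  (f' := rhoK s) (g' := rhoK t)); [|by move=> b; apply: ind_intertwine..].
rewrite -(altop_intertwine (pi := ind_map f) (f := Lgen S t) (g := Lgen S s)
  (f' := rhoK t) (g' := rhoK s)); [|by move=> b; apply: ind_intertwine..].
by rewrite (braidL cox nP).
Qed.

Local Notation actK := (hact S rhoK).

Lemma actK_structure : hecke_module_structure S J sigma actK.
Proof.
split.
- by move=> c h h' m; rewrite hsc_fsc msc_fsc hact_linh.
- by move=> c h m m'; rewrite !msc_fsc hact_linm // => s _; apply: rhoK_lin.
- by move=> m; apply: hact1.
- move=> h h' m; apply: (hact_mul cox nP).
  + by move=> s _; apply: rhoK_lin.
  + by move=> s b sS; apply: rhoK_quad.
  + exact: rhoK_braid.
by move=> s i sS; rewrite (hact_gen cox nP rhoK_braid) // Mb_fb Hs_Mb_rhoK.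
Qed.

Lemma structure_unique act : hecke_module_structure S J sigma act ->
  forall h m, act h m = actK h m.
Proof.
case=> linh linm a1 aM ag h m.
have linh' m' : semilin id (fun h => act h m').
  by move=> c b b'; have := linh c b b' m'; rewrite hsc_fsc msc_fsc.
have linm' h' : semilin id (act h').
  by move=> c b b'; have := linm c h' b b'; rewrite !msc_fsc.
have kl m' : semilin id (fun h => actK h m') by move=> c b b'; apply: hact_linh.
have gen s m' : s \in S -> act (Hb s) m' = rhoK s m'.
  move=> sS; move: m'; apply: (@sl_ext _ _ id) => //; first exact: rhoK_lin.
  by move=> i; rewrite -[in LHS]Mb_fb ag // Hs_Mb_rhoK.
move: h; apply: (@sl_ext _ _ id) => // w; rewrite -Hb_fb hact_fb.
move: w; apply: (Hb_ind cox nP) => [|s w sS nw IH]; first by rewrite opW1 a1.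
rewrite -(Hmul_gen_fb cox nP) // aM gen // IH.
by rewrite (opW_mull cox nP (subxx S) rhoK_braid) // (in_genS cox).
Qed.

End KModule.

(** * The bar operator *)

Section MinimalInvolutions.
Variables (gT : finGroupType) (S J : {set gT}) (n : gT -> gT -> bool).
Hypothesis cox : coxeter_system S.
Hypothesis nP : inversion_cocycle S n.
Hypothesis JS : J \subset S.
Local Open Scope group_scope.
Local Notation ell := (len S).
Implicit Types (r s t u v w g q b : gT) (z : ext gT).

(** [Wmin] in terms of inversions: by [vconj_up] and [vconj_down] a moved letter lowers the length
    exactly when it is a descent. *)
Definition minimal z : bool := [forall s in J, n z.1 s ==> (zr z s == s)].
Definition fixers z : {set gT} := [set s in J | zr z s == s].

Lemma fixers_sub z : fixers z \subset J.
Proof. by apply/subsetP => s; rewrite inE => /andP []. Qed.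

Lemma fixers_zr z q : z \in IJ J -> q \in <<fixers z>> -> zr z q = q.
Proof.
move=> zI; move: q; apply: gen_ind => [|s q sF qF IH].
  by rewrite /zr (IJ_t1 zI) mulg1 mulgV.
have FJ := subsetP (genS (fixers_sub z)).
rewrite (zrM zI) ?FJ ?(mem_gen sF) // IH.
by move: sF; rewrite inE => /andP [_ /eqP ->].
Qed.

Lemma fixers_vconj z u : z \in IJ J -> u \in <<fixers z>> -> vconj u z = z.
Proof.
move=> zI; move: u; apply: gen_ind => [|s u sF uF IH]; first exact: (vconj1 zI).
have FJ := subsetP (genS (fixers_sub z)).
rewrite (vconjM zI) ?FJ ?(mem_gen sF) // IH; apply/eqP.
move: sF; rewrite inE => /andP [sJ /eqP e].
by rewrite (vconj_fix cox JS zI) ?e // TJ_gen.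
Qed.

(** As [u] fixes [z], [D_vconj] compares [N(y)] with itself. The two terms of [u] cancel, because
    inversions of [u^-1] lie in the subgroup of fixers, where [zr z] is the identity. *)
Lemma fixers_D z u q : z \in IJ J -> u \in <<fixers z>> -> q \in <<J>> ->
  n z.1 (q ^ u) = n z.1 q.
Proof.
move=> zI uF qJ; have uJ := subsetP (genS (fixers_sub z)) u uF.
have := D_vconj nP JS zI uJ qJ; rewrite fixers_vconj //.
have -> : n u^-1 (zr z (q ^ u)) = n u q.
  have e : n u^-1 (q ^ u) = n u q by rewrite (n_inv nP) conjgK.
  case E: (n u^-1 (zr z (q ^ u))).
    have FS : fixers z \subset S := subset_trans (fixers_sub z) JS.
    have uV : u^-1 \in <<fixers z>> by rewrite groupV.
    have := n_TJ nP FS uV E => /TJ_sub h.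
    have := fixers_zr zI h; rewrite (zrK zI) ?groupJ // => h'.
    by rewrite -e h' E.
  rewrite -e; apply/esym/negP => h.
  have FS : fixers z \subset S := subset_trans (fixers_sub z) JS.
  have uV : u^-1 \in <<fixers z>> by rewrite groupV.
  have h' := fixers_zr zI (TJ_sub (n_TJ nP FS uV h)).
  by rewrite h' h in E.
by case: (n u q); case: (n _ (q ^ u)); case: (n _ q).
Qed.

(** Split [y = u v] with [u] in the subgroup of fixers and [v] without left descents among them. By
    [fixers_D], a left descent of [v] in [J] is a descent of [y] or lies in that subgroup; either
    way it fixes [z], a contradiction, so [v = 1]. *)
Lemma minimal_fixers z : z \in IJ J -> minimal z -> z.1 \in <<fixers z>>.
Proof.
move=> zI /forall_inP zmin.
have FS : fixers z \subset S := subset_trans (fixers_sub z) JS.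
have FJ := subsetP (genS (fixers_sub z)).
case: (WJ_decomp cox nP z.1^-1 FS) => v0 [u0 [v0F u0F e]].
have ey : z.1 = u0^-1 * v0^-1 by rewrite -[z.1]invgK e invMg.
have uF : u0^-1 \in <<fixers z>> by rewrite groupV.
have [v1|v1] := eqVneq v0^-1 1; first by rewrite ey v1 mulg1.
have vJ : v0^-1 \in <<J>>.
  have -> : v0^-1 = u0 * z.1 by rewrite ey mulKVg.
  by rewrite groupM ?IJ_1 // FJ.
case: (desc_exists cox nP JS vJ v1) => s sJ ns.
suff sF : s \in fixers z.
  by move/(WJupP cox nP _ FS): v0F => /(_ s sF); rewrite ns.
rewrite inE sJ /=; apply: (implyP (zmin s sJ)).
rewrite -(@fixers_D z u0 s zI u0F (mem_gen sJ)).
rewrite {1}ey (n_mul nP) -conjgM mulgV conjg1 ns.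
case E: (n u0^-1 (s ^ u0)) => //.
have h := TJ_sub (n_TJ nP FS uF E).
have sG : s \in <<fixers z>> by rewrite -(conjgK u0 s) groupJ // groupV.
have := fixers_zr zI sG => fs.
by have := ns; rewrite (WJupP cox nP _ FS v0F) // inE sJ fs eqxx.
Qed.

Lemma minimal_desc_fixed z r : z \in IJ J -> minimal z -> n z.1 r -> zr z r = r.
Proof.
move=> zI zmin nr; apply: fixers_zr => //.
have FS : fixers z \subset S := subset_trans (fixers_sub z) JS.
by apply: TJ_sub (n_TJ nP FS (minimal_fixers zI zmin) nr).
Qed.

(** Take [g] shortest with the given conjugate and let [s] be its last letter, which then moves [z].
    By minimality at both ends, [D_vconj] makes [z s z] a right inversion of [g] as well, so
    [g s (z s z)] is shorter, yet gives the same conjugate. *)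
Lemma minimal_unique z v : z \in IJ J -> v \in <<J>> ->
  minimal z -> minimal (vconj v z) -> vconj v z = z.
Proof.
move=> zI vJ zmin z2min.
case: (@arg_minnP _ v [pred g | (g \in <<J>>) && (vconj g z == vconj v z)] ell) => /=.
  by rewrite vJ eqxx.
move=> g /andP [gJ /eqP gv] gmin; rewrite -gv in z2min *.
have z2I := vconj_IJ cox JS zI gJ.
have [->|g1] := eqVneq g 1; first exact: (vconj1 zI).
have short r : r \in <<J>> -> vconj r z = z -> (ell g <= ell (g * r))%N.
  by move=> rJ e; apply: gmin; rewrite groupM //= (vconjM zI) // e gv.
have gV1 : g^-1 != 1 by rewrite eq_invg1.
have gVJ : g^-1 \in <<J>> by rewrite groupV.
case: (desc_exists cox nP JS gVJ gV1) => s sJ ns.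
have sS := subsetP JS s sJ; have sT := TJ_gen sJ; have sG : s \in <<J>> by apply: mem_gen.
have lt1 : (ell (g * s) < ell g)%N by rewrite (desc_r cox nP).
have ms : zr z s != s.
  apply/eqP => fs; have := short s sG; rewrite leqNgt lt1.
  by move=> h; case: notF; apply: h; apply/eqP; rewrite (vconj_fix cox JS zI) ?fs.
have sgG : s ^ g^-1 \in <<J>> by rewrite groupJ.
have := D_vconj nP JS zI gJ sgG; rewrite conjgKV -(n_inv nP) ns.
have -> : n z.1 s = false.
  by apply/negP => /(minimal_desc_fixed zI zmin) e; rewrite e eqxx in ms.
have -> : n (vconj g z).1 (s ^ g^-1) = false.
  apply/negP => /(minimal_desc_fixed z2I z2min).
  rewrite (zr_vconj zI) // conjgKV => /conjg_inj e; by rewrite e eqxx in ms.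
move=> /= /esym /negbFE nr.
have rT := zrTJ zI sT; have rG := TJ_sub rT.
have e : vconj (s * zr z s) z = z.
  by rewrite (vconjM zI) // (vconj_zr cox JS zI) // (vconjK cox JS zI).
have := short _ (groupM sG rG) e; rewrite leqNgt; case/negP.
apply: ltn_trans lt1; rewrite mulgA.
rewrite -(ell_inv cox (g * s * zr z s)) -(ell_inv cox (g * s)) (invMg (g * s)).
rewrite (TJ_inv cox JS rT) (invMg g s).
apply: (n_lt cox nP); rewrite (n_mul nP) (invS cox sS) (n_gen nP _ sS) (negPf ms).
by rewrite (zr_conj cox JS zI).
Qed.

End MinimalInvolutions.

Lemma add_squeeze a b c d e : (b <= d + c)%N -> (c <= a + e)%N -> d = 1%N -> e = 1%N ->
  (a.+1 < b)%N -> b = (d + c)%N /\ c = (a + e)%N.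
Proof. lia. Qed.

Section BarOperator.
Variables (gT : finGroupType) (S J : {set gT}) (n : gT -> gT -> bool).
Variable sigma : gT -> int.
Hypothesis cox : coxeter_system S.
Hypothesis nP : inversion_cocycle S n.
Hypothesis JS : J \subset S.
Hypothesis sigM : {in WJ J &, forall u v, sigma (u * v)%g = (sigma u * sigma v)%R}.
Hypothesis sigU : {in WJ J, forall u, sigma u = 1%R \/ sigma u = (-1)%R}.
Local Open Scope group_scope.
Local Notation ell := (len S).
Local Notation K := (KJt S J).
Local Notation V := {ffun K -> laurent}.
Local Notation rhoN := (@rhoN gT S J sigma).
Local Notation rhoK := (@rhoK gT S J sigma).
Local Notation sg := (sg sigma).
Local Notation barK := (barX S rhoK).
Local Notation rhoIM := (rhoI rhoK).
Implicit Types (r s t u v w g q b : gT) (i j : K) (x : ZT J).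

Let Klin s (_ : s \in S) := @rhoK_lin gT S J sigma s.
Let Kquad s m (sS : s \in S) := rhoK_quad sigma cox nP JS m sS.
Let Kbraid s t (sS : s \in S) (tS : t \in S) := rhoK_braid cox nP JS sigM sigU sS tS.

Let barK_mul u v m := @barX_mul _ _ _ cox nP _ _ Klin Kquad Kbraid u v m.
Let barK_mull s w m := @barX_mull _ _ _ cox nP _ _ Klin Kquad Kbraid s w m.
Let barK_mulr s w m := @barX_mulr _ _ _ cox nP _ _ Klin Kquad Kbraid s w m.
Let barK1 m := @barX1 _ _ _ cox nP _ _ Klin Kquad Kbraid m.
Let barK_gen s m := @barX_gen _ _ _ cox nP _ _ Klin Kquad Kbraid s m.
Let barK_lin w : semilin id (barK w) := barX_lin Klin w.
Let IK_lin s (sS : s \in S) : semilin id (rhoIM s) := rhoI_lin Klin sS.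

Definition E1 x : V := emb S 1 (fb x).

Lemma rhoK_emb1 s f : s \in J -> rhoK s (emb S 1 f) = emb S 1 (rhoN s f).
Proof.
move=> sJ; have sS := subsetP JS s sJ.
rewrite (rhoK_emb_in sigma cox nP JS _ sS) ?(WJup1 cox nP JS) //.
  by rewrite invg1 mul1g mulg1.
by rewrite mulg1 (WJup_nJ cox nP JS).
Qed.

Lemma E1_fix s x : s \in J -> zr (val x) s = s -> rhoK s (E1 x) = fsc (sg s) (E1 x).
Proof.
move=> sJ fs; rewrite /E1 rhoK_emb1 // (rhoN_fix sigma cox JS sJ fs).
by rewrite (sl_scale erefl (emb_lin S _)).
Qed.

Lemma E1_up s x : s \in J -> zr (val x) s != s -> n (val x).1 s = false ->
  rhoK s (E1 x) = E1 (stN s x).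
Proof.
by move=> sJ ms ns; rewrite /E1 rhoK_emb1 // (rhoN_moved sigma cox nP JS sJ ms) ns.
Qed.

(** The element [(y^-1, th)], obtained by conjugation with [y^-1], which keeps it in the class. *)
Definition dual x : ZT J := stN (val x).1^-1 x.

Lemma val_dual x : val (dual x) = ((val x).1^-1, (val x).2).
Proof.
have zI := valZ x; have yG := IJ_1 zI.
rewrite (val_stN cox JS) ?groupV // /vconj mulVg mul1g.
by rewrite -(IJ_tV zI) ?groupV // invgK (IJ_mulV zI).
Qed.

(* Up to a scalar constant on each class, [bar M_(y, th) = bar H_y M_(y^-1, th)]. *)
Definition bar0 x : V := barK (val x).1 (E1 (dual x)).

Section OnePoint.
Variables (s : gT) (x : ZT J).
Hypothesis sJ : s \in J.
Let z := val x.
Let zI : z \in IJ J := valZ x.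
Let t := z.2 s.
Let sS : s \in S := subsetP JS s sJ.
Let tJ : t \in J. Proof. exact: IJ_J zI _ sJ. Qed.
Let tS : t \in S := subsetP JS t tJ.
Let sG : s \in <<J>>. Proof. exact: mem_gen. Qed.
Let tG : t \in <<J>>. Proof. exact: mem_gen. Qed.
Let yG : z.1 \in <<J>> := IJ_1 zI.

Lemma dual_n : n (val (dual x)).1 t = n z.1 s.
Proof. by rewrite val_dual /= -(IJ_mulV zI) (n_theta nP JS zI). Qed.

Lemma dual_zr : (zr (val (dual x)) t == t) = (zr z s == s).
Proof.
rewrite val_dual /zr /= (IJ_ttK zI) invgK -/z -/t.
rewrite -(inj_eq (mulgI z.1)) !mulgA mulgV mul1g.
by rewrite -[in RHS](inj_eq (mulIg z.1)) mulgKV eq_sym.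
Qed.

Lemma dual_stN : dual (stN s x) = stN t (dual x).
Proof.
apply: val_inj; rewrite (val_stN cox JS) // !val_dual (val_stN cox JS) // /vconj /=.
by rewrite (IJ_ttK zI) !invMg invgK (invS cox sS) mulgA.
Qed.

(** [vconj_up] forces [l(s y t) = l(y) + 2], so [bar H_(s y t)] factors; its last factor [bar H_t]
    undoes the ascent by [t] between the dual elements. *)
Lemma bar0_up : zr z s != s -> n z.1 s = false -> bar0 (stN s x) = rhoIM s (bar0 x).
Proof.
move=> ms ns; rewrite /bar0 dual_stN.
have lt := vconj_up cox nP JS zI (TJ_gen sJ) ms ns.
have e : (val (stN s x)).1 = s * (z.1 * t).
  by rewrite (val_stN cox JS) //= (invS cox tS) mulgA.
have e' : (vconj s z).1 = s * (z.1 * t) by rewrite /= (invS cox tS) mulgA.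
have h1 := ell_mul_le cox s (z.1 * t); have h2 := ell_mul_le cox z.1 t.
have hs := ell_gen cox nP sS; have ht := ell_gen cox nP tS.
rewrite e' in lt; have [q1 q2] := add_squeeze h1 h2 hs ht lt.
rewrite e (barK_mul _ q1) (barK_mul _ q2).
rewrite (barK_gen _ sS) (barK_gen _ tS) -E1_up ?dual_n ?dual_zr //.
by rewrite (rhoIK Kquad) //.
Qed.

(** Here [s y = y t], so [bar H_s bar H_y = bar H_y bar H_t] whether or not [s] is a descent of [y];
    [t] fixes the dual element, and being conjugate to [s] it has the same eigenvalue. *)
Lemma bar0_fix : zr z s = s -> rhoIM s (bar0 x) = fsc (lbar (sg s)) (bar0 x).
Proof.
move=> fs; have sy : s * z.1 = z.1 * t by rewrite -{1}fs /zr mulgKV.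
have nt : n z.1^-1 t = n z.1 s by have := dual_n; rewrite val_dual.
have comm m : rhoIM s (barK z.1 m) = barK z.1 (rhoIM t m).
  case E: (n z.1 s).
    have ns' : n (s * z.1) s = false by rewrite (n_mulss nP) // E.
    have nt' : n (z.1 * t)^-1 t = false.
      by rewrite invMg (invS cox tS) (n_mulss nP) // nt E.
    have e1 m' : barK z.1 m' = rhoIM s (barK (s * z.1) m').
      by rewrite -barK_mull // (mulSK cox).
    have e2 m' : barK z.1 m' = barK (z.1 * t) (rhoIM t m').
      by rewrite -barK_mulr // (mulKS cox).
    by rewrite {1}e2 -sy -e1.
  by rewrite -barK_mull // sy barK_mulr // nt.
rewrite /bar0 comm; have ft : zr (val (dual x)) t = t by apply/eqP; rewrite dual_zr fs.
have st : t = s ^ z.1 by rewrite conjgE sy mulKg.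
have sgt : sg t = sg s by rewrite st (sg_conj sigM sigU).
rewrite /rhoI E1_fix // sgt -fscN -fscDl (eigen_sub (sg_eigen sigma s)).
by rewrite (sl_scale erefl (barK_lin _)).
Qed.

End OnePoint.

(** By [minimal_fixers], [y] is a word in letters fixing [z], so [dual x = x]. Each [bar H_s]
    multiplies [M_z] by [lbar (sg s)], which the factor [sg s] undoes. *)
Lemma minimal_bar0 x : minimal J n (val x) -> exists c, fsc c (bar0 x) = E1 x.
Proof.
move=> xmin; have zI := valZ x; have yF := minimal_fixers cox nP JS zI xmin.
have FJ := fixers_sub J (val x).
have dx : dual x = x.
  have vJ : (val x).1^-1 \in <<J>> by rewrite groupV IJ_1.
  apply: val_inj; rewrite (val_stN cox JS) //.
  by apply: (fixers_vconj cox JS zI); rewrite groupV.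
rewrite /bar0 dx; move: (val x).1 yF => u.
have [k] := ubnP (ell u); elim: k u => // k IH u uk uF.
have [->|u1] := eqVneq u 1.
  by exists 1%R; rewrite fsc1 barK1.
have FS := subset_trans FJ JS.
case: (desc_exists cox nP FS uF u1) => s sF ns.
have := sF; rewrite inE => /andP [sJ /eqP fs]; have sS := subsetP JS s sJ.
case: (IH (s * u)) => [||c ec].
- by apply: (@leq_trans (ell u)); [rewrite -(n_desc cox nP) | rewrite -ltnS].
- by rewrite groupM // mem_gen.
exists (sg s * c)%R; rewrite -[u](mulSK cox _ sS) barK_mull ?(n_mulss nP) ?ns //.
rewrite -fscA -(sl_scale erefl (IK_lin sS)) ec /rhoI E1_fix //.
by rewrite -fscN -fscDl (eigen_sub (sg_eigen sigma s)) fscA mulrC (eigen_bar (sg_eigen sigma s)) fsc1.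
Qed.

Definition orbN x : {set ZT J} := [set stN v x | v in <<J>>].
Definition repN x : ZT J :=
  if [pick x' in orbN x | minimal J n (val x')] is Some x' then x' else x.
(** Chosen at the minimal representative, hence constant along the orbit, as the recursion of
    [barN_up] requires. Existence is [minimal_bar0]. *)
Definition scal x : laurent := epsilon (inhabits 0%R) (fun c => fsc c (bar0 (repN x)) = E1 (repN x)).

Lemma orbN_stN v x : v \in <<J>> -> orbN (stN v x) = orbN x.
Proof.
move=> vJ; apply/setP => y; apply/imsetP/imsetP => [[u uJ ->]|[u uJ ->]].
  by exists (u * v); [apply: groupM | rewrite (stNM cox JS)].
have uvJ : u * v^-1 \in <<J>> by rewrite groupM ?groupV.
by exists (u * v^-1); rewrite // -(stNM cox JS) // mulgKV.
Qed.

Lemma minimal_exists x : exists2 v, v \in <<J>> & minimal J n (val (stN v x)).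
Proof.
case: (@arg_minnP _ 1 (mem <<J>>) (fun u => hN S (stN u x))) => /=; first exact: group1.
move=> v vJ vmin; exists v => //; apply/forall_inP => s sJ; apply/implyP => ns.
have sG : s \in <<J>> by apply: mem_gen.
apply/negPn/negP => ms.
have := hN_down cox nP JS sJ ms; rewrite ns => lt.
by have := vmin (s * v) (groupM sG vJ); rewrite (stNM cox JS) // leqNgt lt.
Qed.

Lemma repN_minimal x : minimal J n (val (repN x)).
Proof.
rewrite /repN; case: pickP => [x' /andP []//|h].
have [v vJ vmin] := minimal_exists x.
by have /negbT := h (stN v x); rewrite /= vmin andbT => /negP []; apply: imset_f.
Qed.

Lemma repN_stN v x : v \in <<J>> -> repN (stN v x) = repN x.
Proof.
move=> vJ; rewrite /repN orbN_stN //; case: pickP => // h.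
have [u uJ umin] := minimal_exists x.
by have /negbT := h (stN u x); rewrite /= umin andbT => /negP []; apply: imset_f.
Qed.

Lemma repN_min x : minimal J n (val x) -> repN x = x.
Proof.
move=> xmin; have := repN_minimal x; rewrite /repN; case: pickP => // x'.
case/andP=> /imsetP [v vJ ->] _ ymin; apply: val_inj; rewrite (val_stN cox JS) //.
rewrite (val_stN cox JS) // in ymin.
exact: (minimal_unique cox nP JS (valZ x) vJ).
Qed.

Definition barN_fb x : V := fsc (scal x) (bar0 x).
Definition barN := sl_lift lbar barN_fb.

Lemma scal_stN v x : v \in <<J>> -> scal (stN v x) = scal x.
Proof. by move=> vJ; rewrite /scal repN_stN. Qed.

Lemma barN_min x : minimal J n (val x) -> barN_fb x = E1 x.
Proof.
move=> xmin; rewrite /barN_fb /scal (repN_min xmin).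
exact: (epsilon_spec (inhabits 0%R) _ (minimal_bar0 xmin)).
Qed.

Lemma barN_sl : semilin lbar barN.
Proof. by apply: sl_lift_sl; [apply: lbarD | apply: lbarM]. Qed.

Lemma barNE x : barN (fb x) = barN_fb x.
Proof. by apply: sl_lift_fb; [apply: lbar0 | apply: lbar1]. Qed.

Lemma barN_up s x : s \in J -> zr (val x) s != s -> n (val x).1 s = false ->
  barN_fb (stN s x) = rhoIM s (barN_fb x).
Proof.
move=> sJ ms ns; have sS := subsetP JS s sJ.
rewrite /barN_fb scal_stN ?mem_gen // bar0_up //.
by rewrite (sl_scale erefl (IK_lin sS)).
Qed.

Lemma barN_rho s f : s \in J -> barN (rhoN s f) = rhoIM s (barN f).
Proof.
move=> sJ; have sS := subsetP JS s sJ; move: f.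
apply: (@sl_ext _ _ lbar); first exact: lbar1.
- by apply: (semilin_compr barN_sl); apply: rhoN_lin.
- exact: (semilin_comp (IK_lin sS) barN_sl).
move=> x; rewrite barNE.
have [fs|ms] := eqVneq (zr (val x) s) s.
  rewrite (rhoN_fix sigma cox JS sJ fs) (sl_scale lbar1 barN_sl) barNE /barN_fb.
  by rewrite (sl_scale erefl (IK_lin sS)) bar0_fix // !fscA mulrC.
rewrite (rhoN_moved sigma cox nP JS sJ ms); case E: (n (val x).1 s); last first.
  by rewrite barNE barN_up.
(* A descent is an ascent from [s x] read backwards; the quadratic relation of [rhoI] supplies the
   extra term. *)
pose x' := stN s x; have xE : x = stN s x' by rewrite /x' (stNK cox JS).
have sT := TJ_gen sJ; have sG : s \in <<J>> by apply: mem_gen.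
have ms' : zr (val x') s != s.
  rewrite /x' (val_stN cox JS) // (zr_vconj (valZ x)) //.
  have ss : s ^ s = s by rewrite conjgE mulKg.
  by rewrite ss (invS cox sS) -[X in _ != X]ss (inj_eq (@conjg_inj _ s)).
have ns' : n (val x').1 s = false.
  have := hN_up cox nP JS sJ ms'; rewrite -xE.
  have := hN_down cox nP JS sJ ms; rewrite E => lt.
  by rewrite lt => /esym/negbTE.
rewrite (sl_add lbar1 barN_sl) (sl_scale lbar1 barN_sl) !barNE -/x'.
have -> : barN_fb x = rhoIM s (barN_fb x') by rewrite {1}xE barN_up.
by rewrite (rhoI_quad Klin Kquad) // lbar_q fscN.
Qed.

Definition ZofK i : ZT J := Sub (val i).2 (proj2 (KJP i)).
Definition bar_fb i : V := barK (val i).1 (barN_fb (ZofK i)).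
Definition barM := sl_lift lbar bar_fb.

Lemma barM_sl : semilin lbar barM.
Proof. by apply: sl_lift_sl; [apply: lbarD | apply: lbarM]. Qed.

Lemma barME i : barM (fb i) = bar_fb i.
Proof. by apply: sl_lift_fb; [apply: lbar0 | apply: lbar1]. Qed.

Lemma barM_emb w f : w \in WJup S J -> barM (emb S w f) = barK w (barN f).
Proof.
move=> wK; move: f; apply: (@sl_ext _ _ lbar); first exact: lbar1.
- exact: (semilin_compr barM_sl (emb_lin S w)).
- exact: (semilin_comp (barK_lin w) barN_sl).
move=> x; rewrite emb_fb barME barNE /bar_fb SubK; congr (barK _ (barN_fb _)).
by apply: val_inj; rewrite !SubK.
Qed.

Lemma emb_ZofK i : fb i = emb S (val i).1 (fb (ZofK i)).
Proof.
have [wK zI] := KJP i; rewrite (emb_fb _ wK); congr (fb _).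
by apply: val_inj; rewrite !SubK; case: (val i).
Qed.

(** If [s w] leaves [W^J], then [s w = w t] with [t] in [J], and [bar H_s bar H_w = bar H_w bar H_t]
    reduces the claim to [barN_rho]. *)
Lemma barM_rho s m : s \in S -> barM (rhoK s m) = rhoIM s (barM m).
Proof.
move=> sS; move: m; apply: (@sl_ext _ _ lbar); first exact: lbar1.
- by apply: (semilin_compr barM_sl); apply: rhoK_lin.
- exact: (semilin_comp (IK_lin sS) barM_sl).
move=> i; have [wK zI] := KJP i; rewrite emb_ZofK; move: (fb (ZofK i)) => f.
set w := (val i).1 in wK *.
rewrite (barM_emb _ wK).
have [swK|swK] := boolP (s * w \in WJup S J).
  rewrite (rhoK_emb_up sigma cox nP JS) //; case E: (n w s); last first.
    by rewrite barM_emb // barK_mull.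
  rewrite (sl_add lbar1 barM_sl) (sl_scale lbar1 barM_sl) !barM_emb //.
  have ns' : n (s * w) s = false by rewrite (n_mulss nP) // E.
  have e1 m' : barK w m' = rhoIM s (barK (s * w) m').
    by rewrite -barK_mull // (mulSK cox).
  by rewrite !e1 (rhoI_quad Klin Kquad) // lbar_q fscN.
rewrite (rhoK_emb_in sigma cox nP JS) // barM_emb //.
case: (deodhar cox nP JS wK sS swK) => tJ nw; rewrite barN_rho //.
rewrite -barK_mull // -barK_mulr.
- by congr (barK _ _); rewrite !mulgA mulgV mul1g.
- exact: (subsetP JS).
- exact: (WJup_n cox nP JS wK (TJ_gen tJ)).
Qed.

Lemma barM_act h m : barM (hact S rhoK h m) = hact S rhoK (barH S h) (barM m).
Proof.
rewrite (hact_barH S rhoK) /sl_lift.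
have hl : semilin id (fun b : {ffun gT -> laurent} => hact S rhoK b m).
  by move=> c b b'; apply: hact_linh.
rewrite (sl_expand lbar1 (semilin_compr barM_sl hl) h); apply: eq_bigr => w _.
congr (fsc _ _); rewrite -Hb_fb hact_fb.
move: w; apply: (Hb_ind cox nP) => [|s w sS nw IH]; first by rewrite opW1 barK1.
rewrite (opW_mull cox nP (subxx S) Kbraid) // ?(in_genS cox) //.
by rewrite barM_rho // IH barK_mull.
Qed.

Lemma nodesc_minimal i : no_strict_descent S J (val i) ->
  (val i).1 = 1 /\ minimal J n (val i).2.
Proof.
move=> /forall_inP nd; have [wK zI] := KJP i.
have nd' s : s \in S -> (hK i <= hK (stK s i))%N.
  by move=> sS; have := nd s sS; rewrite (ht_stK cox nP JS i sS) -leqNgt.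
have w1 : (val i).1 = 1.
  apply/eqP/negPn/negP => w1.
  case: (desc_exists cox nP (subxx S) (in_genS cox _) w1) => s sS ns.
  have swK := WJup_desc cox nP JS wK sS ns.
  have := nd' s sS; rewrite /hK (val_stK cox nP JS) // sact_up //= leq_add2r leq_double.
  by rewrite leqNgt -(n_desc cox nP) // ns.
split=> //; apply/forall_inP => s sJ; apply/implyP => ns; apply/negPn/negP => ms.
have sS := subsetP JS s sJ; have sG : s \in <<J>> by apply: mem_gen.
have swK : s * (val i).1 \notin WJup S J by rewrite w1 mulg1 (WJup_nJ cox nP JS).
have := nd' s sS; rewrite /hK (val_stK cox nP JS) //.
case: (sact_in cox nP JS (valP i) sS swK) => _ _ -> /=.
rewrite w1 invg1 mul1g mulg1 leq_add2l leqNgt.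
by have := vconj_down cox nP JS zI (TJ_gen sJ) ms ns => /ltnW ->.
Qed.

Lemma barM_nodesc i : no_strict_descent S J (val i) -> barM (fb i) = fb i.
Proof.
case/nodesc_minimal=> w1 zmin; rewrite barME /bar_fb w1 barK1 barN_min ?SubK //.
by rewrite [RHS]emb_ZofK w1.
Qed.

End BarOperator.

(** * Bruhat orders and triangularity *)

Lemma connect_lind (X : finType) (e : rel X) (P : X -> Prop) y :
  P y -> (forall x x', e x x' -> connect e x' y -> P x' -> P x) ->
  forall x, connect e x y -> P x.
Proof.
move=> Py PS x /connectP [p pth ey]; rewrite {}ey in Py PS *.
elim: p x pth Py PS => [//|x' p IH] x /= /andP [xx' pth] Py PS.
have PS' := PS; apply: (PS x x') => //; last exact: IH.
by apply/connectP; exists p.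
Qed.

Section Bruhat.
Variables (gT : finGroupType) (S J : {set gT}) (n : gT -> gT -> bool).
Hypothesis cox : coxeter_system S.
Hypothesis nP : inversion_cocycle S n.
Hypothesis JS : J \subset S.
Local Open Scope group_scope.
Local Notation ell := (len S).
Implicit Types (r s t u v w x y a b : gT) (z c d : ext gT).

Definition bedge a b : bool := [exists t in T S, (b == a * t) && (len S a < len S b)%N].
Definition qedge c d : bool := [&& c \in IJ J, d \in IJ J &
  [exists t in TJ J, (d == emul (emul (einj t) c) (einj t)) && (elen J c < elen J d)%N]].

(** The right factor [t] becomes a left reflection, for which the length condition is a value of
    [n]. *)
Lemma bedgeP a b : bedge a b -> exists r, [/\ r \in T S, b = r * a & n a r = false].
Proof.
case/exists_inP=> t tT /andP [/eqP -> lt]; exists (t ^ a^-1).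
have rT : t ^ a^-1 \in T S by rewrite (T_conj cox).
have e : t ^ a^-1 * a = a * t by rewrite conjgE invgK !mulgA mulgKV.
split=> //; rewrite (n_reflE cox nP) // e.
by apply/negbTE; rewrite -leqNgt ltnW.
Qed.

Lemma bedge_build r a : r \in T S -> n a r = false -> bedge a (r * a).
Proof.
move=> rT nr; apply/exists_inP; exists (r ^ a); first by rewrite (T_conj cox).
rewrite conjgE mulKVg eqxx /=; apply: (n_up cox nP (subxx S)) => //.
by rewrite -TS_eq.
Qed.

Lemma gen_T s : s \in S -> s \in T S.
Proof. by move=> sS; rewrite (TS_eq cox) TJ_gen. Qed.

Lemma bedge_left s a b : s \in S -> bedge a b -> bedge (s * a) (s * b) \/ b = s * a.
Proof.
move=> sS /bedgeP [r [rT -> nr]]; have [->|rs] := eqVneq r s; first by right.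
left; have -> : s * (r * a) = r ^ s * (s * a).
  by rewrite conjgE (invS cox sS) -!mulgA (mulSK cox).
apply: bedge_build; first by rewrite (T_conj cox).
rewrite (n_mul nP) (n_gen nP _ sS) -conjgM (mulSS cox sS) conjg1 nr addbF.
have ss : s ^ s = s by rewrite conjgE mulKg.
by rewrite -{2}ss (inj_eq (@conjg_inj _ s)) (negPf rs).
Qed.

Lemma bedge_right t a b : t \in S -> bedge a b -> bedge (a * t) (b * t) \/ b = a * t.
Proof.
move=> tS /bedgeP [r [rT -> nr]]; have [e|ne] := eqVneq (r ^ a) t.
  by right; rewrite -e conjgE mulKVg.
left; rewrite -mulgA; apply: bedge_build => //.
by rewrite (n_mul nP) nr (n_gen nP _ tS) (negPf ne).
Qed.

Lemma bedge_upl s w : s \in S -> n w s = false -> bedge w (s * w).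
Proof. by move=> sS; apply: bedge_build; apply: gen_T. Qed.

Lemma bedge_upr t w : t \in S -> n w^-1 t = false -> bedge w (w * t).
Proof.
move=> tS nw; have -> : w * t = t ^ w^-1 * w by rewrite conjgE invgK !mulgA mulgKV.
apply: bedge_build; first by rewrite (T_conj cox) gen_T.
by rewrite -(n_inv nP).
Qed.

Lemma bedge_downr t w : t \in S -> n w^-1 t -> bedge (w * t) w.
Proof.
move=> tS nw; have := @bedge_upr t (w * t) tS; rewrite (mulKS cox) //; apply.
by rewrite invMg (invS cox tS) (n_mulss nP) // nw.
Qed.

Lemma bruhat_lift s v w : s \in S -> n w s = false ->
  connect bedge v w -> connect bedge (s * v) (s * w).
Proof.
move=> sS nw; apply: (connect_lind (P := fun v => connect bedge (s * v) (s * w))).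
  exact: connect0.
move=> a b ab bw IH; case: (bedge_left sS ab) => [e|eb].
  exact: connect_trans (connect1 e) IH.
rewrite -eb; apply: connect_trans bw (connect1 _).
exact: bedge_upl.
Qed.

Lemma bruhat_lift_desc t x y : t \in S -> n y^-1 t -> n x^-1 t = false ->
  connect bedge x y -> connect bedge x (y * t).
Proof.
move=> tS ny nx xy.
(* The claim for [x] without the descent [t] is not inductive along a chain; the stronger one also
   lowers those [x] that have it. *)
suff : if n x^-1 t then connect bedge (x * t) (y * t) else connect bedge x (y * t).
  by rewrite nx.
move: x xy {nx}; apply: connect_lind; first by rewrite ny connect0.
move=> a b ab _; case E: (n b^-1 t) => IH; case E': (n a^-1 t).
- case: (bedge_right tS ab) => [e|eb]; first exact: connect_trans (connect1 e) IH.
  by move: E; rewrite eb invMg (invS cox tS) (n_mulss nP) // E'.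
- case: (bedge_right tS ab) => [e|eb].
    apply: connect_trans (connect1 (bedge_upr tS E')) _.
    exact: connect_trans (connect1 e) IH.
  by move: IH; rewrite {1}eb (mulKS cox).
- apply: connect_trans (connect1 (bedge_downr tS E')) _.
  exact: connect_trans (connect1 ab) IH.
exact: connect_trans (connect1 ab) IH.
Qed.

Lemma bruhat_len v w : connect bedge v w -> v != w -> (ell v < ell w)%N.
Proof.
move: v; apply: connect_lind; first by rewrite eqxx.
move=> a b ab _ IH _; have lt : (ell a < ell b)%N by case/exists_inP: ab => t _ /andP [].
by have [<-//|/IH] := eqVneq b w; apply: ltn_trans.
Qed.

Lemma qedgeP c d : qedge c d -> [/\ c \in IJ J, d \in IJ J &
  exists r, [/\ r \in TJ J, d = vconj r c, zr c r != r & n c.1 r = false]].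
Proof.
case/and3P=> cI dI /exists_inP [r rT /andP [/eqP e lt]].
rewrite (vconj_emul cox JS cI rT) in e; split=> //; exists r; split=> //.
  rewrite -(vconj_fix cox JS cI) // -e; apply/eqP => ecd.
  by rewrite ecd ltnn in lt.
have mr : zr c r != r.
  rewrite -(vconj_fix cox JS cI) // -e; apply/eqP => ecd.
  by rewrite ecd ltnn in lt.
rewrite !(elenE cox nP JS) // in lt.
apply/negP => nr; have := vconj_down cox nP JS cI rT mr nr; rewrite -e => /ltnW.
by rewrite ltnNge ltnW.
Qed.

Lemma qedge_build c r : c \in IJ J -> r \in TJ J -> zr c r != r -> n c.1 r = false ->
  qedge c (vconj r c).
Proof.
move=> cI rT mr nr; have dI := vconj_IJ cox JS cI (TJ_sub rT).
apply/and3P; split=> //; apply/exists_inP; exists r => //.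
rewrite (vconj_emul cox JS cI rT) eqxx !(elenE cox nP JS) //=.
by have := vconj_up cox nP JS cI rT mr nr => /ltnW.
Qed.

(** Conjugation by [s] carries the edge of [r] to that of [r ^ s], unless [r] or [z r z] is [s].
    Both of these reflections give the same edge, which is then the edge of [s] itself. *)
Lemma qedge_step s c d : s \in J -> qedge c d ->
  qedge (vconj s c) (vconj s d) \/ d = vconj s c.
Proof.
move=> sJ /qedgeP [cI dI [r [rT e mr nr]]].
have sS := subsetP JS s sJ; have sG : s \in <<J>> by apply: mem_gen.
have rG := TJ_sub rT; have ss : s ^ s = s by rewrite conjgE mulKg.
have [rs|rs] := eqVneq r s; first by right; rewrite e rs.
have [rs'|rs'] := eqVneq (zr c r) s.
  by right; rewrite e -(vconj_zr cox JS cI) // rs'.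
left; have r'T : r ^ s \in TJ J by rewrite TJ_conj.
have r'r : (r ^ s) ^ s = r by rewrite -conjgM (mulSS cox sS) conjg1.
have -> : vconj s d = vconj (r ^ s) (vconj s c).
  rewrite e -(vconjM cI sG rG) -(vconjM cI (TJ_sub r'T) sG); congr (vconj _ c).
  by rewrite conjgE (invS cox sS) -!mulgA (mulSS cox sS) mulg1.
apply: qedge_build => //; first exact: (vconj_IJ cox JS cI sG).
  rewrite (zr_vconj cI sG (TJ_sub r'T)) r'r (invS cox sS).
  by rewrite (inj_eq (@conjg_inj _ s)).
rewrite (D_vconj nP JS cI sG (TJ_sub r'T)) r'r nr (invS cox sS) !(n_gen nP _ sS).
by rewrite (negPf rs') addbF -[X in _ == X]ss (inj_eq (@conjg_inj _ s)) (negPf rs).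
Qed.

Lemma qbruhat_lift s c d : s \in J -> d \in IJ J -> zr d s != s -> n d.1 s = false ->
  connect qedge c d -> connect qedge (vconj s c) (vconj s d).
Proof.
move=> sJ dI md nd.
apply: (connect_lind (P := fun c => connect qedge (vconj s c) (vconj s d))).
  exact: connect0.
move=> a b ab bd IH; case: (qedge_step sJ ab) => [e|eb].
  exact: connect_trans (connect1 e) IH.
rewrite -eb; apply: connect_trans bd (connect1 _).
by apply: qedge_build => //; apply: TJ_gen.
Qed.

Lemma qbruhat_len c d : connect qedge c d -> c != d -> (elen J c < elen J d)%N.
Proof.
move: c; apply: connect_lind; first by rewrite eqxx.
move=> a b ab _ IH _.
have lt : (elen J a < elen J b)%N by case/and3P: ab => _ _ /exists_inP [t _ /andP []].
by have [<-//|/IH] := eqVneq b d; apply: ltn_trans.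
Qed.

End Bruhat.

(** * The partial order on labels and its lifting property *)

Section Order.
Variables (gT : finGroupType) (S J : {set gT}) (n : gT -> gT -> bool).
Hypothesis cox : coxeter_system S.
Hypothesis nP : inversion_cocycle S n.
Hypothesis JS : J \subset S.
Local Open Scope group_scope.
Local Notation ell := (len S).
Local Notation K := (KJt S J).
Implicit Types (i j k : K) (s : gT).

Definition precK j i : bool := prec S J (val j) (val i).

Lemma bruhat_lt_trans u v w : connect (bedge S) u v -> connect (bedge S) v w ->
  (u != v) || (v != w) -> bruhat_lt S u w.
Proof.
move=> uv vw ne; apply/andP; split; last exact: (connect_trans uv vw).
apply/eqP => e; subst w.
have [euv|nuv] := eqVneq u v; first by rewrite euv eqxx in ne.
have l1 := bruhat_len uv nuv; rewrite eq_sym in nuv.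
by have := ltn_trans l1 (bruhat_len vw nuv); rewrite ltnn.
Qed.

Lemma qbruhat_lt_trans (c d e : ext gT) : qbruhat_lt J c d -> qbruhat_lt J d e ->
  qbruhat_lt J c e.
Proof.
move=> /andP [n1 c1] /andP [n2 c2]; apply/andP; split; last exact: (connect_trans c1 c2).
have l1 := qbruhat_len c1 n1; have l2 := qbruhat_len c2 n2.
by apply/eqP => e'; subst e; have := ltn_trans l1 l2; rewrite ltnn.
Qed.

Lemma precK_ht j i : precK j i -> (ht S J (val j) < ht S J (val i))%R.
Proof. by case/and3P. Qed.

Lemma precK_irr i : precK i i = false.
Proof. by apply/negP => /precK_ht; rewrite Order.POrderTheory.ltxx. Qed.

Lemma precK_trans k j i : precK k j -> precK j i -> precK k i.
Proof.
move=> /and3P [o1 h1 b1] /and3P [o2 h2 b2]; apply/and3P; split.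
- exact: connect_trans o1 o2.
- exact: Order.POrderTheory.lt_trans h1 h2.
case/orP: b1 => [b1|/andP [/eqP e1 q1]]; case/orP: b2 => [b2|/andP [/eqP e2 q2]].
- case/andP: b1 => n1 c1; case/andP: b2 => n2 c2.
  by rewrite (@bruhat_lt_trans _ (val j).1) // n1.
- by rewrite -e2 b1.
- by rewrite e1 b2.
- by rewrite e1 e2 eqxx (qbruhat_lt_trans q1 q2) orbT.
Qed.

Lemma orbit_step s i : s \in S -> same_orbit S J (val i) (val (stK s i)).
Proof.
move=> sS; apply: connect1; apply/exists_inP; exists s => //.
by rewrite (val_stK cox nP JS).
Qed.

Lemma stK_moved s i : s \in S -> (hK i < hK (stK s i))%N ->
  if s * (val i).1 \in WJup S J then n (val i).1 s = false /\
     val (stK s i) = (s * (val i).1, (val i).2)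
  else let t := (val i).1^-1 * s * (val i).1 in
    [/\ t \in J, zr (val i).2 t != t, n (val i).2.1 t = false, n (val i).1 s = false
      & val (stK s i) = ((val i).1, vconj t (val i).2)].
Proof.
move=> sS; have [wK zI] := KJP i; rewrite /hK !(val_stK cox nP JS) //.
case: (boolP (s * (val i).1 \in WJup S J)) => h.
  rewrite (sact_up h) /= ltn_add2r ltn_double => lt; split=> //.
  by apply/negP => /(n_lt cox nP); rewrite ltnNge ltnW.
case: (sact_in cox nP JS (valP i) sS h) => tJ nw -> /=.
rewrite ltn_add2l => lt; have tT := TJ_gen tJ.
set t := _ * s * _ in tJ lt tT *.
have mt : zr (val i).2 t != t.
  rewrite -(vconj_fix cox JS zI) //; apply/eqP => e.
  by move: lt; rewrite -[X in (_ < X)%N]/(ell (vconj t (val i).2).1) e ltnn.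
split=> //; apply/negP => nt.
have := vconj_down cox nP JS zI tT mt nt => /ltnW.
by rewrite ltnNge ltnW.
Qed.

Lemma precK_up s i : s \in S -> (hK i < hK (stK s i))%N -> precK i (stK s i).
Proof.
move=> sS lt; have [wK zI] := KJP i; apply/and3P; split.
- exact: orbit_step.
- by rewrite (val_stK cox nP JS) // (ht_stK cox nP JS).
have := stK_moved sS lt; case: ifP => _ /=.
  case=> nw ->; apply/orP; left; apply/andP; split; last first.
    by apply: connect1; apply: (bedge_upl cox nP).
  by apply/eqP => /= e; have := ell_neq cox nP (sval i).1 sS; rewrite -e eqxx.
case=> tJ mt nt nw ->; apply/orP; right; rewrite eqxx /=; apply/andP; split.
  by rewrite eq_sym (vconj_fix cox JS zI) ?TJ_gen.
by apply: connect1; apply: (qedge_build cox nP JS) => //; apply: TJ_gen.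
Qed.

(** On the first component the length counts twice. On the second, [y] gains at most one letter on
    each side, and [vconj_up] gives at least two. Equal increments preserve strict height
    inequalities under lifting. *)
Lemma hK_up s i : s \in S -> (hK i < hK (stK s i))%N -> hK (stK s i) = (hK i + 2)%N.
Proof.
move=> sS lt; have [wK zI] := KJP i; have := stK_moved sS lt; rewrite /hK.
case: ifP => _ /=.
  by case=> nw -> /=; rewrite (ell_mull cox nP) // nw doubleS !addSn addn2.
case=> tJ mt nt nw e; rewrite e /= in lt *; set t := _ * s * _ in tJ mt nt lt *.
have tT := TJ_gen tJ; have := vconj_up cox nP JS zI tT mt nt.
have t'S := subsetP JS _ (IJ_J zI tJ); have tS := subsetP JS _ tJ.
rewrite /= (invS cox t'S) -mulgA.
have h1 := ell_mul_le cox t ((val i).2.1 * (val i).2.2 t).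
have h2 := ell_mul_le cox (val i).2.1 ((val i).2.2 t).
have e1 := ell_gen cox nP tS; have e2 := ell_gen cox nP t'S => h3.
have [q1 q2] := add_squeeze h1 h2 e1 e2 h3.
by rewrite q1 q2 e1 e2 add1n addn1 addnS addnS addn2.
Qed.

Lemma ht_up s i : s \in S -> (hK i < hK (stK s i))%N ->
  ht S J (val (stK s i)) = (ht S J (val i) + 1)%R.
Proof.
move=> sS lt; rewrite !(htE cox nP JS) hK_up // (val_stK cox nP JS) //.
rewrite (len_zmin_sact cox nP JS (valP i) sS) natrD.
by field.
Qed.

Lemma precK_lift s j i : s \in S -> precK j i -> (hK i < hK (stK s i))%N ->
  (hK j < hK (stK s j))%N -> precK (stK s j) (stK s i).
Proof.
move=> sS pji li lj; have [wiK ziI] := KJP i; have [wjK zjI] := KJP j.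
have [o h b] := and3P pji; apply/and3P; split.
- apply: connect_trans (connect_trans o (orbit_step i sS)).
  by have := orbit_step (stK s j) sS; rewrite (stKK cox nP JS).
- by rewrite !ht_up // ltrD2r.
have := stK_moved sS li; have := stK_moved sS lj.
have [swi|swi] := boolP (s * (val i).1 \in WJup S J);
  have [swj|swj] := boolP (s * (val j).1 \in WJup S J).
- case=> nj -> [ni ->] /=; case/orP: b => [/andP [ne c]|/andP [/eqP e q]].
    rewrite /bruhat_lt (inj_eq (mulgI s)) ne; apply/orP; left.
    exact: (bruhat_lift cox nP sS ni).
  by rewrite e eqxx q orbT.
(* [s] moves [i] in [W^J] but [j] inside its fibre: [w_j < w_i < s w_i] suffices. *)
- case=> tJ mt nt nj -> [ni ->] /=; case/orP: b => [/andP [ne c]|/andP [/eqP e q]].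
    apply/orP; left; apply: (@bruhat_lt_trans _ (val i).1) => //; last by rewrite ne.
    by apply: connect1; apply: (bedge_upl cox nP).
  by rewrite e swi in swj.
(* [s] moves [j] in [W^J] but [i] inside its fibre, so [s w_i = w_i t]. Lifting gives
   [s w_j <= w_i t], and [t], a right descent of the larger side only, can be removed. *)
- case=> nj -> [tJ mt nt ni ->] /=; case/orP: b => [/andP [ne c]|/andP [/eqP e q]].
    apply/orP; left; set t := _ * s * _ in tJ mt nt.
    have tS := subsetP JS _ tJ.
    have swt : s * (val i).1 = (val i).1 * t by rewrite /t !mulgA mulgV mul1g.
    have := bruhat_lift cox nP sS ni c; rewrite swt => c'.
    have nit : n ((val i).1 * t)^-1 t.
      by rewrite invMg (invS cox tS) (n_mulss nP) // (WJup_n cox nP JS wiK) ?TJ_gen.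
    have njt : n (s * (val j).1)^-1 t = false by rewrite (WJup_n cox nP JS swj) ?TJ_gen.
    have := bruhat_lift_desc cox nP tS nit njt c'; rewrite (mulKS cox) // => c2.
    apply/andP; split=> //; apply/eqP => e.
    by move: swi; rewrite -e (mulSK cox) // wjK.
  by rewrite -e swj in swi.
- case=> tJ mt nt nj -> [tiJ mti nti ni ->] /=.
  case/orP: b => [->//|/andP [/eqP e /andP [ne q]]].
  apply/orP; right; rewrite e eqxx /=; rewrite e in tJ mt nt.
  apply/andP; split; last exact: (qbruhat_lift cox nP JS tiJ ziI mti nti).
  apply: contra ne => /eqP e'.
  have := congr1 (vconj ((val i).1^-1 * s * (val i).1)) e'.
  by rewrite !(vconjK cox JS) ?TJ_gen // => ->.
Qed.

End Order.

(** * Triangularity, involutivity and uniqueness of the bar operator *)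

Section Main.
Variables (gT : finGroupType) (S J : {set gT}) (n : gT -> gT -> bool).
Variable sigma : gT -> int.
Hypothesis cox : coxeter_system S.
Hypothesis nP : inversion_cocycle S n.
Hypothesis JS : J \subset S.
Hypothesis sigM : {in WJ J &, forall u v, sigma (u * v)%g = (sigma u * sigma v)%R}.
Hypothesis sigU : {in WJ J, forall u, sigma u = 1%R \/ sigma u = (-1)%R}.
Local Open Scope ring_scope.
Local Notation K := (KJt S J).
Local Notation V := {ffun K -> laurent}.
Local Notation rhoK := (@rhoK gT S J sigma).
Local Notation rhoV := (rhoI rhoK).
Local Notation psi := (@barM gT S J n sigma).
Local Notation actK := (hact S rhoK).
Implicit Types (i j k : K) (s : gT) (m : V).

Let Klin s (_ : s \in S) := @rhoK_lin gT S J sigma s.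
Let Kquad s m (sS : s \in S) := rhoK_quad sigma cox nP JS m sS.
Let Kbraid s t (sS : s \in S) (tS : t \in S) := rhoK_braid cox nP JS sigM sigU sS tS.
Let psi_sl : semilin lbar psi. Proof. exact: barM_sl. Qed.
Let psi_rho s m (sS : s \in S) := barM_rho cox nP JS sigM sigU m sS.

(** Strict ascents reach every label from one without strict descents, and along them [rhoK s] maps
    basis vector to basis vector. *)
Lemma descent_ind (P : K -> Prop) :
  (forall i, no_strict_descent S J (val i) -> P i) ->
  (forall s i, s \in S -> (hK i < hK (stK s i))%N -> rhoK s (fb i) = fb (stK s i) ->
     P i -> P (stK s i)) ->
  forall i, P i.
Proof.
move=> P0 PS i; have [k] := ubnP (hK i); elim: k i => // k IH i ik.
have [nd|] := boolP (no_strict_descent S J (val i)); first exact: P0.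
case/forall_inPn=> s sS; rewrite negbK (ht_stK cox nP JS i sS) => lt.
rewrite -(stKK cox nP JS i sS); apply: PS => //.
- by rewrite (stKK cox nP JS).
- by rewrite /rhoK gopE /gop_fb (stKK cox nP JS) // lt.
by apply: IH; apply: leq_trans lt _; rewrite -ltnS.
Qed.

Lemma rhoV_coef s j k : s \in S -> k != j -> rhoV s (fb j) k =
  if (k == stK s j) && (hK j != hK (stK s j)) then 1 else 0.
Proof.
move=> sS kj; rewrite /rhoI /rhoK gopE /gop_fb faddE foppE fscE [fb j k]fbE (negPf kj).
rewrite mulr0 subr0; case: ltngtP => h; rewrite /= ?andbT ?andbF.
- by rewrite fbE.
- by rewrite faddE fscE !fbE (negPf kj) mulr0 addr0.
by rewrite fscE fbE (negPf kj) mulr0.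
Qed.

(** Along an ascent [psi M_(s i) = bar H_s (psi M_i)], and [bar H_s] maps [M_j] into the span of
    [M_j] and [M_(s j)]. For [j] below [i] both labels stay below [s i], so only [j = i] contributes
    to the leading coefficient. *)
Lemma psi_support i : psi (fb i) i = 1 /\
  forall j, j != i -> precK j i = false -> psi (fb i) j = 0.
Proof.
move: i; apply: descent_ind => [i nd|s i sS lt e [IH1 IH2]].
  rewrite (barM_nodesc cox nP JS sigM sigU) //; split; first by rewrite fbE eqxx.
  by move=> j ji _; rewrite fbE (negPf ji).
have -> : psi (fb (stK s i)) = rhoV s (psi (fb i)) by rewrite -e (psi_rho _ sS).
move: (psi (fb i)) IH1 IH2 => m IH1 IH2.
have rl : semilin id (rhoV s) := rhoI_lin Klin sS.
have pi := precK_up cox nP JS sS lt.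
have stK_neq : stK s i != i by apply: contraTneq lt => ->; rewrite ltnn.
have coef k : rhoV s m k = \sum_j m j * rhoV s (fb j) k.
  rewrite {1}(sl_expand erefl rl m) fsumE; apply: eq_bigr => j _.
  by rewrite fscE.
(* If [s] raises [j], the lifting property applies; otherwise [s j], [j], [i], [s i] is an
   increasing chain. *)
have lower j : precK j i -> hK j != hK (stK s j) -> precK (stK s j) (stK s i).
  move=> pj; rewrite neq_ltn => /orP [lj|lj]; first exact: (precK_lift cox nP JS).
  apply: (precK_trans _ (precK_trans pj pi)).
  have := @precK_up _ _ _ _ cox nP JS s (stK s j) sS.
  by rewrite (stKK cox nP JS) //; apply.
have zero k j : k != i -> precK k (stK s i) = false -> j != i ->
    m j * rhoV s (fb j) k = 0.
  move=> ki pk ji; case pj: (precK j i); last by rewrite IH2 ?mul0r.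
  have kj : k != j.
    by apply: contraFneq pk => ->; apply: precK_trans pj pi.
  rewrite rhoV_coef //; case: andP => [[/eqP ek hj]|_]; last by rewrite mulr0.
  by rewrite ek lower in pk.
split.
  rewrite coef (bigD1 i) //= IH1 mul1r big1 ?addr0.
    by rewrite rhoV_coef // eqxx neq_ltn lt.
  by move=> j ji; apply: zero => //; apply: precK_irr.
move=> k ks pk; have ki : k != i by apply: contraFneq pk => ->.
rewrite coef big1 // => j _; have [->|ji] := eqVneq j i; last exact: zero.
by rewrite rhoV_coef // (negPf ks) mulr0.
Qed.

Lemma psi_triangular i : exists c : K -> laurent,
  psi (fb i) = fb i + \sum_(j | precK j i) fsc (c j) (fb j).
Proof.
have [h1 h2] := psi_support i; exists (fun j => psi (fb i) j).
apply/ffunP => k; rewrite faddE fsum_fb fbE.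
have [->|ki] := eqVneq k i; first by rewrite precK_irr addr0 h1.
by case: ifP => pk; rewrite ?add0r // h2.
Qed.

Lemma psi_rhoV s m : s \in S -> psi (rhoV s m) = rhoK s (psi m).
Proof.
move=> sS; rewrite {1}/rhoI (sl_add lbar1 psi_sl) (sl_opp lbar1 psi_sl).
rewrite (sl_scale lbar1 psi_sl) psi_rho // lbar_q fscN opprK /rhoI.
by rewrite subrK.
Qed.

(** [psi] exchanges [rhoK s] with its inverse, so its square is linear, commutes with the generators
    and fixes the labels without strict descents. *)
Lemma psiK m : psi (psi m) = m.
Proof.
have h : semilin (fun c => lbar (lbar c)) (fun m => psi (psi m)).
  exact: (semilin_comp psi_sl psi_sl).
have h' : semilin id (fun m => psi (psi m)).
  by move=> c u v; rewrite h lbarK.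
move: m; apply: (sl_ext _ h') => //.
apply: descent_ind => [i nd|s i sS _ e IH]; first by rewrite !barM_nodesc.
by rewrite -e psi_rho // psi_rhoV // IH.
Qed.

Lemma psi_bar : bar_operator S J actK psi.
Proof.
split.
- by move=> c m m'; rewrite !msc_fsc; apply: psi_sl.
- by move=> h m; rewrite (barM_act cox nP JS sigM sigU).
by move=> i nd; rewrite Mb_fb barM_nodesc.
Qed.

Lemma bar_unique psi' : bar_operator S J actK psi' -> forall m, psi' m = psi m.
Proof.
case=> sl' act' fix'.
have psi'_sl : semilin lbar psi'.
  by move=> c m m'; have := sl' c m m'; rewrite !msc_fsc.
have psi'_rho s m : s \in S -> psi' (rhoK s m) = rhoV s (psi' m).
  move=> sS; rewrite -(hact_gen cox nP Kbraid m sS) act' hact_barH Hb_fb.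
  rewrite sl_lift_fb; [|exact: lbar0|exact: lbar1].
  exact: (barX_gen cox nP Klin Kquad Kbraid).
apply: (sl_ext lbar1 psi'_sl psi_sl).
apply: descent_ind => [i nd|s i sS _ e IH].
  by rewrite barM_nodesc // -Mb_fb fix'.
by rewrite -e psi'_rho // psi_rho // IH.
Qed.

Lemma canonical_family : exists B : K -> V, canonical (@precK gT S J) psi B.
Proof.
have h (i : K) := canonical_exists (@precK_ht _ S J) (@precK_trans _ S J) psi_sl psiK psi_triangular i.
exists (fun i => proj1_sig (constructive_indefinite_description _ (h i))) => i.
exact: (proj2_sig (constructive_indefinite_description _ (h i))).
Qed.

End Main.

Local Open Scope ring_scope.

Theorem mainTheorem11 (gT : finGroupType) (S J : {set gT}) (sigma : gT -> int) :
  coxeter_system S -> J \subset S ->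
  {in WJ J &, forall u v, sigma (u * v)%g = sigma u * sigma v} ->
  {in WJ J, forall u, sigma u = 1 \/ sigma u = -1} ->
  (* (a) *)
  (exists! act, hecke_module_structure S J sigma act) /\
  forall act, hecke_module_structure S J sigma act ->
  (* (b) *)
  (exists! psi, bar_operator S J act psi) /\
  forall psi, bar_operator S J act psi ->
    (forall m, psi (psi m) = m) /\
    (forall i : KJt S J, exists c : KJt S J -> laurent,
        psi (Mb S J (val i)) =
        Mb S J (val i) + \sum_(j : KJt S J | prec S J (val j) (val i)) msc S J (c j) (Mb S J (val j))) /\
  (* (c) *)
    (exists! B : KJt S J -> Mod S J,
       is_basis S J B /\
       forall i : KJt S J,
         psi (B i) = B i /\
         exists c : KJt S J -> laurent,
           (forall j, in_negpart (c j)) /\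
           B i = Mb S J (val i) + \sum_(j : KJt S J | prec S J (val j) (val i)) msc S J (c j) (Mb S J (val j))).

Proof.
move=> cox JS sigM sigU; have [n nP] := coxeter_cocycle cox.
pose actK := hact S (@rhoK gT S J sigma).
have actP : hecke_module_structure S J sigma actK.
  exact: (actK_structure cox nP JS sigM sigU).
(* [exists!] asks for equality of functions, so pointwise uniqueness is promoted by
   extensionality. *)
have actE act : hecke_module_structure S J sigma act -> act = actK.
  move=> h; apply: functional_extensionality => x; apply: functional_extensionality => m.
  exact: (structure_unique cox nP JS sigM sigU h).
split; first by exists actK; split=> // act /actE.
move=> act /actE ->.
pose psi := @barM gT S J n sigma.
have psiP : bar_operator S J actK psi by apply: psi_bar.
have psiE f : bar_operator S J actK f -> f = psi.
  by move=> h; apply: functional_extensionality => m; apply: (bar_unique cox nP JS sigM sigU h).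
split; first by exists psi; split=> // f /psiE.
move=> f /psiE ->; split; first exact: (psiK cox nP JS sigM sigU).
have Mbfun i : Mb S J (val i) = fb i := Mb_fb i.
have sumE (P : pred (KJt S J)) (c : KJt S J -> laurent) :
    \sum_(j | P j) msc S J (c j) (Mb S J (val j)) = \sum_(j | P j) fsc (c j) (fb j).
  by apply: eq_bigr => j _; rewrite msc_fsc Mb_fb.
split.
  move=> i; have [c e] := psi_triangular cox nP JS sigM sigU i.
  by exists c; rewrite sumE Mb_fb.
have canE (B : KJt S J -> Mod S J) :
    (forall i : KJt S J, psi (B i) = B i /\ exists c : KJt S J -> laurent,
      (forall j, in_negpart (c j)) /\ B i = Mb S J (val i) +
        \sum_(j : KJt S J | prec S J (val j) (val i)) msc S J (c j) (Mb S J (val j))) <->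
    canonical (@precK _ S J) psi B.
  split=> h i; have [h1 [c [h2 h3]]] := h i; split=> //; exists c; split=> //.
    by rewrite h3 sumE Mb_fb.
  by rewrite h3 sumE Mb_fb.
have [B cB] := canonical_family cox nP JS sigM sigU.
have psl : semilin lbar psi by apply: barM_sl.
exists B; split.
  split; last exact/canE.
  move=> m; have [c [e u]] := unitri_basis (@precK_ht _ S J) (canonical_unitri cB) m.
  have mE (d : {ffun KJt S J -> laurent}) :
      \sum_i msc S J (d i) (B i) = \sum_i fsc (d i) (B i).
    by apply: eq_bigr => i _; rewrite msc_fsc.
  by exists c; split=> [|d]; rewrite mE //; apply: u.
move=> B' [_ /canE cB']; apply: functional_extensionality => i.
exact: (canonical_unique (@precK_ht _ S J) psl (psi_triangular cox nP JS sigM sigU) cB cB').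
Qed.
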